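(* Consider Assumptions 1 and 2 (both stated in the context). Choose $D=C_{deg}\frac{a}{K}$ and $\theta=\chi a$, where the constant $C_{deg}$ is sufficiently large and $\chi>0$ is sufficiently small depending only on $\rho_+$. There exist constants $L,c>0$ such that if $\varepsilon\ge L\log(nK)$, the Main Algorithm described in the context (run with parameters $K,D,\theta,\varepsilon$) has the following properties: (i) For every input graph $A\in\mathcal G_n$, it outputs an exact sample from the Gibbs law $\pi_A(\sigma)=\exp\{\eta\widetilde T_{A,D}(\sigma)\}/\sum_{\tau\in\Sigma}\exp\{\eta\widetilde T_{A,D}(\tau)\}$ on $\Sigma$, where $\eta=\frac{\varepsilon}{2D}$. (ii) For every input graph, it is pure $\varepsilon$-node-DP. (iii) With probability at least $1-n^{-c}-(nK)^{-cA_0}$ over the SBM input $A$ (with ground truth $\sigma_0\in\Sigma$), the certified branch is used (i.e. the certification condition in step 3 of the algorithm holds) and the conditional expected runtime, over the internal randomness of the sampler, is $\mathrm{poly}(n)$.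
   Context: Setting. $n,K$ are positive integers with $K\mid n$, $s=n/K$; $[m]=\{1,\dots,m\}$. $\mathcal G_n$ is the set of undirected graphs on $[n]$, identified with symmetric zero-diagonal matrices $A\in\{0,1\}^{n\times n}$; $E(A)$ is the set of unordered edges $ij$. $\Sigma=\{\sigma:[n]\to[K]: |\sigma^{-1}(k)|=s\ \forall k\in[K]\}$. $Y^\sigma_{ij}=\mathbf 1\{\sigma(i)=\sigma(j)\}$ is the cluster matrix of $\sigma\in\Sigma$. $h(\sigma,\tau)=|\{i:\sigma_i\ne\tau_i\}|$. $\mathfrak S_K$ is the group of permutations of $[K]$. $\|\cdot\|_1$ is the entrywise $\ell_1$ norm, $\langle A,B\rangle=\mathrm{Tr}(AB^T)$. $\mathrm{poly}(n)$ stands for a quantity of order $n^\alpha$ for some constant $\alpha>0$. SBM with ground truth $\sigma_0\in\Sigma$: the upper-triangular entries of $A$ are independent, $\mathbb P(A_{ij}=1)=a/n$ if $\sigma_0(i)=\sigma_0(j)$ and $b/n$ otherwise. Node privacy. $A\sim_v A'$ if $A,A'\in\mathcal G_n$ differ only on edges incident to a single vertex. A randomized algorithm $\mathcal A$ on $\mathcal G_n$ is pure $\varepsilon$-node-DP if $\mathbb P(\mathcal A(A)\in S)\le e^\varepsilon\mathbb P(\mathcal A(A')\in S)$ for all $A\sim_vA'$ and measurable $S$. Score. For $D>0$, $Y\in[0,1]^{n\times n}$, let $\widetilde H_{A,D}(Y)=\min_{q,z}\{\sum_{ij\in E(A)}z_{ij}Y_{ij}+D\sum_{i=1}^nq_i\}$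 over $0\le q_i\le1$ $(i\in[n])$, $0\le z_{ij}\le1$ and $z_{ij}\ge1-q_i-q_j$ $(ij\in E(A))$. Let $\widetilde\Psi_{A,D}(Y)=\widetilde H_{A,D}(Y)-\lambda\sum_{i<j}Y_{ij}$ and $\widetilde T_{A,D}(\sigma)=\widetilde\Psi_{A,D}(Y^\sigma)$. Here $\lambda$ is the penalty parameter of the penalized likelihood score $T_A(\sigma)=\sum_{i<j}(A_{ij}-\lambda)\mathbf 1\{\sigma(i)=\sigma(j)\}$, chosen as in Klopp and Zadik (2026); the penalty does not depend on $A$, and since $\sum_{i<j}Y_{ij}$ is constant over the set $\mathcal C$ below (which contains all $Y^\sigma$, $\sigma\in\Sigma$), the value of $\lambda$ affects neither $\pi_A$ nor any step of the algorithm. Certificate. $\mathcal C=\{Y\in\mathbb R^{n\times n}: Y\succeq0,\ Y_{ii}=1\ \forall i,\ Y_{ij}\ge0\ \forall i,j,\ Y\mathbf 1=s\mathbf 1\}$ and, for a cluster matrix $Z$, $V_\theta(Z)=\max_{Y\in\mathcal C}\{\widetilde\Psi_{A,D}(Y)+\frac\theta n\|Y-Z\|_1\}$. Canonical labelings. For $\sigma,\sigma^\star\in\Sigma$, $\mathrm{Can}_{\sigma^\star}(\sigma)$ is the lexicographically smallest vector among the labelings $\pi\circ\sigma$ with $\pi\in\arg\min_{\pi\in\mathfrak S_K}h(\pi\circ\sigma,\sigma^\star)$, and $R_{\sigma^\star}=\{\sigma\in\Sigma:\mathrm{Can}_{\sigma^\star}(\sigma)=\sigma\}$. Main Algorithm.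 Input $A$, $K,D,\theta,\varepsilon$, with $\eta=\frac{\varepsilon}{2D}$ and $\kappa=2\eta\theta/K$, so that $\kappa\ge\log(4n(K-1))$. 1. Compute an optimal solution $\widehat X$ of the candidate SDP: $\max_X\langle A,X\rangle$ s.t. $X\succeq0$, $X\mathbf 1\le\mathbf 1$, $\mathrm{Tr}(X)=K$, $X\ge0$ entrywise. 2. If $s\widehat X=Y^{\sigma}$ for some $\sigma\in\Sigma$, let $\sigma^\star$ be such a $\sigma$; otherwise choose an arbitrary $\sigma^\star\in\Sigma$. 3. Check whether $V_\theta(Y^{\sigma^\star})=\widetilde\Psi_{A,D}(Y^{\sigma^\star})$ (certification condition). 4. If yes (certified branch), run the certified rejection sampler: repeat independent trials: propose $\sigma\in[K]^n$ with independent coordinates, $\mathbb P(\sigma_i=\sigma^\star_i)=\frac1{1+(K-1)e^{-\kappa}}$, $\mathbb P(\sigma_i=\ell)=\frac{e^{-\kappa}}{1+(K-1)e^{-\kappa}}$ for $\ell\ne\sigma^\star_i$; reject if $\sigma\notin\Sigma$ or $\sigma\notin R_{\sigma^\star}$; otherwise accept with probability $b_A(\sigma)=\exp\{\eta[\widetilde T_{A,D}(\sigma)-\widetilde T_{A,D}(\sigma^\star)]+\kappa h(\sigma,\sigma^\star)\}$. At the first acceptance, draw $\Pi\sim\mathrm{Unif}(\mathfrak S_K)$ and return $\Pi\circ\sigma$. 5. If no, sample exactly from $\pi_A$ by brute-force enumeration of $\Sigma$. Runtime convention: polynomial-size linear and semidefinite programs are solved exactly in polynomial time (exact-oracle convention),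 and uniform $[0,1]$ variables are generated in constant time. Assumptions. $K,a,b$ may depend on $n$; $o(\cdot)$ refers to $n\to\infty$; constants are absolute positive constants. Assumption 1: there is an absolute constant $C_{\mathrm{mg}}>0$ with $K\log(K)\le C_{\mathrm{mg}}\log(n)$. Assumption 2: there are absolute constants $0<\rho_-\le\rho_+<1$ and $A_0>0$ with $\frac aK\ge A_0\log(nK)$, $a,b=o(n)$, and $0<\rho_-\le b/a\le\rho_+<1$.
   Formalization: In (iii) the constant A_0 of Assumption 2 must be sufficiently large, depending on the other constants; for small A_0 the SBM graph has isolated vertices and certification fails with high probability. (iii) is asserted for all large n. *)

(* Defs.v *)
From HB Require Import structures.
From mathcomp Require Import all_boot all_order all_algebra all_fingroup.
From mathcomp Require Import all_classical all_reals all_analysis.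
Set Implicit Arguments.
Unset Strict Implicit.
Unset Printing Implicit Defensive.
Import Order.TTheory GRing.Theory Num.Theory.
Import numFieldNormedType.Exports.
Local Open Scope ring_scope.

Definition is_graph (n : nat) (A : 'M[bool]_n) : bool :=
  (A^T == A) && [forall i, ~~ A i i].
Definition graph (n : nat) := {A : 'M[bool]_n | is_graph A}.

(* Unordered edges are represented by the pairs with i < j. *)
Definition edge (n : nat) (A : graph n) (i j : 'I_n) : bool :=
  (i < j)%N && val A i j.

Definition node_adjacent (n : nat) (A A' : graph n) : Prop :=
  exists v : 'I_n, forall i j, i != v -> j != v -> val A i j = val A' i j.

Definition labeling (n K : nat) := {ffun 'I_n -> 'I_K}.

Definition balanced (n K : nat) (sigma : labeling n K) : bool :=
  [forall k, #|[set i | sigma i == k]| == (n %/ K)%N].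

Definition hamming (n K : nat) (sigma tau : labeling n K) : nat :=
  #|[set i | sigma i != tau i]|.

Definition relabel (n K : nat) (p : {perm 'I_K}) (sigma : labeling n K) :
  labeling n K := [ffun i => p (sigma i)].

Definition lex_le (n K : nat) (sigma tau : labeling n K) : bool :=
  (sigma == tau) ||
  [exists i : 'I_n, [forall j : 'I_n, (j < i)%N ==> (sigma j == tau j)] &&
                    (sigma i < tau i)%N].

Definition best_relabelings (n K : nat) (sstar sigma : labeling n K) :
    {set labeling n K} :=
  [set relabel p sigma | p : {perm 'I_K} &
     [forall p' : {perm 'I_K}, (hamming (relabel p sigma) sstar
                                <= hamming (relabel p' sigma) sstar)%N]].

(* The default value of [odflt] is never used: a minimum always exists. *)
Definition can (n K : nat) (sstar sigma : labeling n K) : labeling n K :=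
  odflt sigma [pick tau in best_relabelings sstar sigma |
    [forall tau' in best_relabelings sstar sigma, lex_le tau tau']].

Section Score.
Variables (R : realType) (n : nat).
Implicit Types (A : graph n) (Y Z : 'M[R]_n) (D lam theta : R).

Definition cluster_mx (K : nat) (sigma : labeling n K) : 'M[R]_n :=
  \matrix_(i, j) (sigma i == sigma j)%:R.

Definition l1norm Y : R := \sum_(i < n) \sum_(j < n) `|Y i j|.

Definition lp_feasible A (q : 'I_n -> R) (z : 'I_n -> 'I_n -> R) : Prop :=
  (forall i, 0 <= q i <= 1) /\
  (forall i j, edge A i j -> 0 <= z i j <= 1 /\ 1 - q i - q j <= z i j).

(* The minimum and (in [Vcert]) the maximum are attained, so that they are the
   infimum and the supremum of the sets of values. *)
Definition Hscore A D Y : R :=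
  inf [set v : R | exists q z, lp_feasible A q z /\
    v = \sum_(i < n) \sum_(j < n | edge A i j) z i j * Y i j
        + D * \sum_(i < n) q i]%classic.

Definition upper_sum Y : R := \sum_(i < n) \sum_(j < n | (i < j)%N) Y i j.

Definition Psi A D lam Y : R := Hscore A D Y - lam * upper_sum Y.

Definition Tscore (K : nat) A D lam (sigma : labeling n K) : R :=
  Psi A D lam (cluster_mx sigma).

Definition psd (m : nat) (Y : 'M[R]_m) : Prop :=
  Y^T = Y /\ forall u : 'rV[R]_m, 0 <= (u *m Y *m u^T) 0 0.

Definition certC (s : nat) Y : Prop :=
  [/\ psd Y, forall i, Y i i = 1, forall i j, 0 <= Y i j
    & forall i, \sum_(j < n) Y i j = s%:R].

Definition Vcert (s : nat) A D lam theta Z : R :=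
  sup [set v : R | exists Y, certC s Y /\
    v = Psi A D lam Y + theta / n%:R * l1norm (Y - Z)]%classic.

Definition gibbs_of (K : nat) (eta : R) (score : labeling n K -> R)
    (tau : labeling n K) : R :=
  if balanced tau then
    expR (eta * score tau) /
    \sum_(sigma : labeling n K | balanced sigma) expR (eta * score sigma)
  else 0.

Definition gibbs (K : nat) A D lam eta : labeling n K -> R :=
  gibbs_of eta (@Tscore K A D lam).

Definition sbm_weight (K : nat) (sigma0 : labeling n K) (a b : R) A : R :=
  \prod_(i < n) \prod_(j < n | (i < j)%N)
    let p := (if sigma0 i == sigma0 j then a else b) / n%:R in
    if val A i j then p else 1 - p.

Definition sbm_prob (K : nat) (sigma0 : labeling n K) (a b : R)
    (E : pred (graph n)) : R :=
  \sum_(A : graph n | E A) sbm_weight sigma0 a b A.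

End Score.

Definition node_dp (R : realType) (n : nat) (O : finType) (eps : R)
    (M : graph n -> {set O} -> R) : Prop :=
  forall A A' S, node_adjacent A A' -> M A S <= expR eps * M A' S.

(* Linear/semidefinite programs: maximize <obj_mx, Y> + obj_v . x over a
   positive semidefinite matrix Y and a vector x of free real variables, subject
   to finitely many constraints <M, Y> + w . x <= r.  Taking [sdim = 0] gives
   linear programs. *)
Record sdp (R : realType) := Sdp {
  sdim : nat;
  svar : finType;
  obj_mx : 'M[R]_sdim;
  obj_v : svar -> R;
  scons : seq ('M[R]_sdim * (svar -> R) * R) }.

Section SemidefinitePrograms.
Variable R : realType.

Definition sdp_point (P : sdp R) : Type := ('M[R]_(sdim P) * (svar P -> R))%type.

Definition linform (P : sdp R) (M : 'M[R]_(sdim P)) (w : svar P -> R)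
    (y : sdp_point P) : R := \tr (M *m y.1^T) + \sum_v w v * y.2 v.

Definition sdp_value (P : sdp R) (y : sdp_point P) : R :=
  linform (obj_mx P) (@obj_v _ P) y.

Definition sdp_feasible (P : sdp R) (y : sdp_point P) : Prop :=
  psd y.1 /\ all (fun c => linform c.1.1 c.1.2 y <= c.2) (scons P).

Definition sdp_optimal (P : sdp R) (y : sdp_point P) : Prop :=
  sdp_feasible y /\
  forall y' : sdp_point P, sdp_feasible y' -> sdp_value y' <= sdp_value y.

(* Number of reals in the data of the program. *)
Definition sdp_size (P : sdp R) : nat :=
  ((sdim P ^ 2 + #|svar P|).+1 * (size (scons P)).+1)%N.

Definition exact_oracle (slv : forall P : sdp R, sdp_point P) : Prop :=
  forall P, (exists y : sdp_point P, sdp_optimal y) -> sdp_optimal (slv P).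

(* The two inequalities making up an equality. *)
Definition eq_con (m : nat) (I : Type) (M : 'M[R]_m) (w : I -> R) (r : R) :
    seq ('M[R]_m * (I -> R) * R) :=
  [:: (M, w, r); (- M, (fun v => - w v), - r)].

Definition row_mx1 (n : nat) (i : 'I_n) : 'M[R]_n :=
  \matrix_(k, l) (k == i)%:R.

Definition candidate_sdp (n K : nat) (A : graph n) : sdp R :=
  @Sdp R n void (\matrix_(i, j) (val A i j)%:R) (fun=> 0)
   ([seq (row_mx1 i, (fun=> 0), 1) | i <- enum 'I_n] ++
    eq_con 1%:M (fun=> 0) K%:R ++
    [seq (- delta_mx i j, (fun=> 0), 0) | i <- enum 'I_n, j <- enum 'I_n]).

(* The program defining [- Hscore A D Y]; [inl i] is the variable q_i, [inr (i, j)]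
   the variable z_ij, which is irrelevant unless ij is an edge with i < j. *)
Definition score_lp (n : nat) (A : graph n) (D : R) (Y : 'M[R]_n) : sdp R :=
  let var := ('I_n + 'I_n * 'I_n)%type in
  let unit_v (x v : var) : R := (v == x)%:R in
  @Sdp R 0 var 0
   (fun v => match v with
             | inl _ => - D
             | inr (i, j) => if edge A i j then - Y i j else 0
             end)
   ([seq (0, (fun v => - unit_v x v), 0) | x <- enum {: var}] ++
    [seq (0, unit_v x, 1) | x <- enum {: var}] ++
    [seq (0, (fun v => - unit_v (inl p.1) v - unit_v (inl p.2) v
                       - unit_v (inr p) v), -1)
       | p <- enum {: 'I_n * 'I_n} & edge A p.1 p.2]).

(* Up to the additive constant theta / n * (sum of the entries of Z), the
   program defining [Vcert s A D lam theta Z] for a 0/1 matrix Z.  By linear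
   programming duality, for Y >= 0, [Hscore A D Y] is the maximum of the sum of the
   u_ij over 0 <= u_ij <= Y_ij (ij an edge) such that, for every i, the u's of
   the edges at i sum to at most D; and |Y_ij - Z_ij| = Z_ij + (1 - 2 Z_ij) Y_ij
   since 0 <= Y_ij <= 1.  The variable (i, j) is u_ij. *)
Definition certificate_sdp (n s : nat) (A : graph n) (D lam theta : R)
    (Z : 'M[R]_n) : sdp R :=
  let var := ('I_n * 'I_n)%type in
  let unit_v (x v : var) : R := (v == x)%:R in
  @Sdp R n var
   (\matrix_(i, j) (theta / n%:R * (1 - 2 * Z i j)
                    - (if (i < j)%N then lam else 0)))
   (fun=> 1)
   (flatten [seq eq_con (delta_mx i i) (fun=> 0) 1 | i <- enum 'I_n] ++
    flatten [seq eq_con (row_mx1 i) (fun=> 0) s%:R | i <- enum 'I_n] ++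
    [seq (- delta_mx i j, (fun=> 0), 0) | i <- enum 'I_n, j <- enum 'I_n] ++
    [seq (0, (fun v => - unit_v x v), 0) | x <- enum {: var}] ++
    [seq (if edge A x.1 x.2 then - delta_mx x.1 x.2 else 0, unit_v x, 0)
       | x <- enum {: var}] ++
    [seq (0, (fun v : var => (v.1 == i)%:R + (v.2 == i)%:R), D)
       | i <- enum 'I_n]).

End SemidefinitePrograms.

(* Randomized programs of an exact-arithmetic machine with a solver for linear
   and semidefinite programs.  [Work c p] performs c elementary operations
   (arithmetic, comparisons, exponentials, memory accesses), [Draw w k] draws
   x with probability [w x] by inverse transform from one uniform variable on
   [0,1], [Query P k] calls the solver on P. *)
Inductive prog (R : realType) (X : Type) : Type :=
| Ret of X
| Work of nat & prog R X
| Draw (I : finType) (w : I -> R) (k : I -> prog R X)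
| Query (P : sdp R) (k : sdp_point P -> prog R X).
Arguments Ret {R X} _.
Arguments Work {R X} _ _.
Arguments Draw {R X} {I} _ _.
Arguments Query {R X} _ _.

Fixpoint bind (R : realType) (X X' : Type) (p : prog R X) (f : X -> prog R X') :
    prog R X' :=
  match p with
  | Ret x => f x
  | Work c q => Work c (bind q f)
  | @Draw _ _ J w k => Draw w (fun i => bind (k i) f)
  | Query P k => Query P (fun y => bind (k y) f)
  end.

(* At most k independent trials; [None] means that all of them failed. *)
Fixpoint retry (R : realType) (X : Type) (k : nat) (trial : prog R (option X)) :
    prog R (option X) :=
  if k is k'.+1 then
    bind trial (fun o => if o is Some x then Ret (Some x) else retry k' trial)
  else Ret None.

Section Semantics.
Variables (R : realType) (slv : forall P : sdp R, sdp_point P).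
Variable ocost : nat -> nat.

Fixpoint expected_value (X : Type) (p : prog R X) (f : X -> R) : R :=
  match p with
  | Ret x => f x
  | Work _ q => expected_value q f
  | @Draw _ _ J w k => \sum_i w i * expected_value (k i) f
  | Query P k => expected_value (k (slv P)) f
  end.

Fixpoint expected_time (X : Type) (p : prog R X) : R :=
  match p with
  | Ret _ => 0
  | Work c q => c%:R + expected_time q
  | @Draw _ _ J w k => #|J|.+1%:R + \sum_i w i * expected_time (k i)
  | Query P k => (sdp_size P + ocost (sdp_size P))%:R + expected_time (k (slv P))
  end.

End Semantics.

Definition poly_bounded (f : nat -> nat) : Prop :=
  exists c d : nat, forall N, (f N <= c * N.+1 ^ d)%N.

Section MainAlgorithm.
Variables (R : realType) (n K : nat).
Variables (D theta eps lam : R).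
(* [sel A X] is the labeling sigma* chosen in step 2 from the SDP solution X. *)
Variable sel : graph n -> 'M[R]_n -> labeling n K.
Variables (slv : forall P : sdp R, sdp_point P) (ocost : nat -> nat).
Implicit Types (A : graph n) (sigma sstar : labeling n K).

Definition eta_of : R := eps / (2 * D).
Definition kappa_of : R := 2 * eta_of * theta / K%:R.

Definition selector : Prop := forall A X,
  balanced (sel A X) /\
  ((exists sigma, balanced sigma /\ (n %/ K)%:R *: X = cluster_mx R sigma) ->
   (n %/ K)%:R *: X = cluster_mx R (sel A X)).

(* [Tscore A D lam sigma], through the program for [Hscore]; the n ^ 2 operations form the cluster
   matrix and the penalty. *)
Definition score A sigma : prog R R :=
  let Y := cluster_mx R sigma in
  Query (score_lp A D Y) (fun y =>
    Work (2 * n ^ 2) (Ret (- sdp_value y - lam * upper_sum Y))).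

Definition set_label sigma (i : 'I_n) (l : 'I_K) : labeling n K :=
  [ffun j => if j == i then l else sigma j].

Definition proposal_weight (l0 l : 'I_K) : R :=
  (if l == l0 then 1 else expR (- kappa_of)) /
  (1 + (K%:R - 1) * expR (- kappa_of)).

Definition propose sstar : prog R (labeling n K) :=
  foldr (fun i p => bind p (fun sigma =>
           Draw (proposal_weight (sstar i)) (fun l =>
             Ret (set_label sigma i l))))
        (Ret sstar) (enum 'I_n).

(* The event U <= p for a uniform U on [0,1]. *)
Definition bernoulli_weight (p : R) (x : bool) : R :=
  let q := Num.max 0 (Num.min 1 p) in if x then q else 1 - q.

(* The test [can sstar sigma == sigma] enumerates the K! permutations and, for
   each of them, compares a Hamming distance and a lexicographic rank with the
   best ones found so far. *)
Definition trial A sstar (tstar : R) : prog R (option (labeling n K)) :=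
  bind (propose sstar) (fun sigma =>
  Work (n + K) (
  if ~~ balanced sigma then Ret None else
  Work (K`! * (3 * n).+1 + n) (
  if can sstar sigma != sigma then Ret None else
  bind (score A sigma) (fun t =>
  Work n.+1 (
  Draw (bernoulli_weight
          (expR (eta_of * (t - tstar) + kappa_of * (hamming sigma sstar)%:R)))
    (fun accept =>
  if ~~ accept then Ret None else
  Draw (fun=> (K`!%:R)^-1) (fun p : {perm 'I_K} =>
  Work n (Ret (Some (relabel p sigma)))))))))).

Fixpoint scores A (l : seq (labeling n K)) : prog R (labeling n K -> R) :=
  if l is sigma :: l' then
    bind (score A sigma) (fun t =>
    bind (scores A l') (fun g =>
    Ret (fun tau => if tau == sigma then t else g tau)))
  else Ret (fun=> 0).

Definition brute_force A : prog R (option (labeling n K)) :=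
  Work (K ^ n * (n + K)) (
  bind (scores A (enum [pred sigma | balanced sigma])) (fun g =>
  Work (2 * K ^ n) (
  Draw (gibbs_of eta_of g) (fun sigma => Ret (Some sigma))))).

(* Steps 1-5, the rejection sampler being stopped after k trials.  In step 2,
   sigma* is read off the rows of X, and its cluster matrix is compared with
   s X, in 2 n ^ 2 + n operations. *)
Definition main_algorithm (k : nat) A : prog R (option (labeling n K)) :=
  Query (candidate_sdp R K A) (fun x =>
  let sstar := sel A x.1 in
  let Z := cluster_mx R sstar in
  Work (2 * n ^ 2 + n) (
  Query (certificate_sdp (n %/ K) A D lam theta Z) (fun y =>
  Work (2 * n ^ 2) (
  bind (score A sstar) (fun tstar =>
  if sdp_value y + theta / n%:R * \sum_(i < n) \sum_(j < n) Z i j == tstar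
  then retry k (trial A sstar tstar)
  else brute_force A))))).

Definition output_prob A (S : {set labeling n K}) : R :=
  limn (fun k => expected_value slv (main_algorithm k A)
                   (fun o => if o is Some tau then (tau \in S)%:R else 0)).

Definition expected_runtime A : \bar R :=
  ereal_sup (range (fun k => (expected_time slv ocost (main_algorithm k A))%:E)).

Definition sigma_star A : labeling n K := sel A (slv (candidate_sdp R K A)).1.

Definition certified A : bool :=
  let Z := cluster_mx R (sigma_star A) in
  Vcert (n %/ K) A D lam theta Z == Psi A D lam Z.

End MainAlgorithm.

(* Main.v *)
Require Import Defs.
From HB Require Import structures.
From mathcomp Require Import all_boot all_order all_algebra all_fingroup.
From mathcomp Require Import all_classical all_reals all_analysis.
From mathcomp Require Import ring lra zify.
Set Implicit Arguments.
Unset Strict Implicit.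
Unset Printing Implicit Defensive.
Import Order.TTheory GRing.Theory Num.Theory.
Import numFieldNormedType.Exports.
Local Open Scope ring_scope.

(* On the good event the clusters of sigma_0 strictly dominate the relaxation:
   after compression by the projection orthogonal to the cluster indicators,
   <A, Z - Y> is at least a constant times a / n times |Y - Z|_1, provided that
   the quadratic form of the noise W = A - E A is at most delta a / K and that
   so are the sums of the entries of W in one column over one cluster.  By linear
   programming duality 2 H(Y) <= <A, Y>, with equality at Z when all degrees
   within clusters are at most D, so the same gap identifies the solution of the
   candidate program and gives the certification condition.

   The spectral bound holds for sparse graphs without regularization.  The even
   moments E tr W^(2k) sum over closed walks using each edge at least twice;
   comparing the numbers of walks of each shape bounds them by those of a noise
   matrix with edge probability 1/3 in dimension 3k, where k is about a + ln n, and
   the latter is controlled by a union bound over a lattice net.  The column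
   sums are controlled by Chernoff's bound.

   Changing the edges at one vertex changes H by at most D, hence the Gibbs
   weights by a factor at most exp(eps / 2), which gives privacy.  When the
   certificate passes, Birkhoff--von Neumann applied to the matrix of cluster
   overlaps gives |Y^sigma - Z|_1 >= 2 s h(sigma, sigma_star) for representatives
   sigma, that is b_A(sigma) <= 1; as the group S_K acts freely on balanced
   labelings with one canonical representative per orbit, the accepted sample
   follows the Gibbs law exactly. *)

(** * Random graphs with independent edges *)

(** The relevant scale is the mean degree into one cluster, d = a / K, whereas the norm of the noise
    is controlled only at order sqrt (a + ln n). So K d must be a small multiple of d ^ 2.
    Assumption 1 gives K <= (1 + 2 Cmg) ln n, and ln n <= d / A0, hence a <= (1 + 2 Cmg) d ^ 2 / A0:
    this is why A0 has to be large. The same assumption keeps the K! steps of the test for canonical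
    labelings polynomial.

    A net argument applied directly to the sparse noise would fail: the exponential moment bound
    valid for coefficients of any size forgets the variance of an entry, about a / n, and yields a
    norm of order sqrt n. In dimension 3k with edge probability 1/3 the variance is constant and
    nothing is lost.

    The constants come from one budget. The mean gives a gap of at least (1 - rho) a / n, the noise
    costs 7 delta a / n, and delta = (1 - rho) / 14 leaves (1 - rho) / 2. Passing from <A, Y> to H
    halves this to (1 - rho) / 4, and chi <= (1 - rho) / 8 is what the l1 term 2 chi (a / n) then
    allows. *)

Definition upper_fun (n : nat) (A : graph n) : {ffun 'I_n * 'I_n -> bool} :=
  [ffun p => edge A p.1 p.2].

Definition upper_mx (n : nat) (f : {ffun 'I_n * 'I_n -> bool}) : 'M[bool]_n :=
  \matrix_(i, j) if (i < j)%N then f (i, j) else if (j < i)%N then f (j, i) else false.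

Lemma upper_mx_graph (n : nat) (f : {ffun 'I_n * 'I_n -> bool}) :
  is_graph (upper_mx f).
Proof.
apply/andP; split.
  by apply/eqP/matrixP => i j; rewrite !mxE; case: ltngtP.
by apply/forallP => i; rewrite mxE ltnn.
Qed.

Definition graph_of (n : nat) (f : {ffun 'I_n * 'I_n -> bool}) : graph n :=
  Sub (upper_mx f) (upper_mx_graph f).

Lemma graph_sym (n : nat) (A : graph n) i j : val A i j = val A j i.
Proof.
have /andP[/eqP AT _] := valP A.
by rewrite -[in LHS]AT mxE.
Qed.

Lemma graph_irr (n : nat) (A : graph n) i : val A i i = false.
Proof. by have /andP[_ /forallP/(_ i)/negbTE] := valP A. Qed.

Lemma upper_funK (n : nat) : cancel (@upper_fun n) (@graph_of n).
Proof.
move=> A; apply/val_inj/matrixP => i j; rewrite mxE !ffunE /edge /=.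
case: ltngtP => [//|_|/val_inj ->]; first by rewrite graph_sym.
by rewrite graph_irr.
Qed.

Lemma graph_ofK (n : nat) (f : {ffun 'I_n * 'I_n -> bool}) :
  (forall p, f p -> (p.1 < p.2)%N) -> upper_fun (graph_of f) = f.
Proof.
move=> fP; apply/ffunP => -[i j]; rewrite ffunE /edge /= mxE.
case: ltnP => // ji; apply/esym/negP => /fP /=.
by rewrite ltnNge ji.
Qed.

Section GraphSum.
Variables (R : comPzRingType) (n : nat).

(** Graphs are in bijection with the boolean functions on pairs supported on i < j, so the sum over
    graphs is the expansion of a product of two-term sums. *)
Lemma graph_sum_prod (g : 'I_n -> 'I_n -> bool -> R) :
  \sum_(A : graph n) \prod_(i < n) \prod_(j < n | (i < j)%N) g i j (val A i j)
  = \prod_(i < n) \prod_(j < n | (i < j)%N) (g i j true + g i j false).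
Proof.
rewrite [RHS]pair_big_dep /=.
transitivity (\sum_(A : graph n) \prod_(p : 'I_n * 'I_n | (p.1 < p.2)%N) g p.1 p.2 (val A p.1 p.2)).
  by apply: eq_bigr => A _; rewrite (pair_big_dep xpredT (fun i j : 'I_n => (i < j)%N)).
transitivity (\prod_(p : 'I_n * 'I_n | (p.1 < p.2)%N) \sum_(b : bool) g p.1 p.2 b); last first.
  by apply: eq_bigr => p _; rewrite big_bool.
(* [false] is the value of the expanded functions off the upper triangle; it singles out the
   functions of the form [upper_fun A]. *)
rewrite (big_distr_big_dep false) /=.
rewrite (reindex_onto (@graph_of n) (@upper_fun n)) /=; last first.
  by move=> A _; rewrite upper_funK.
apply: eq_big => [f|f /eqP fE].
  apply/eqP/pfamilyP => [fE|[/fintype.subsetP f0 _]].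
    split=> //; apply/fintype.subsetP => p; rewrite !inE -fE ffunE /edge.
    by case: ltnP.
  apply: graph_ofK => p fp; have := f0 p; rewrite !inE; apply.
  by rewrite fp.
apply: eq_bigr => -[i j] /= ij; congr g.
by rewrite mxE ij.
Qed.

End GraphSum.

Section GraphProbability.
Variables (R : realType) (n : nat).
Implicit Types (P : 'I_n -> 'I_n -> R) (A : graph n) (f g : graph n -> R).

(** This is [sbm_weight] with arbitrary edge probabilities: the same calculus serves the block model
    and the comparison graph with all probabilities 1/3. Only the entries with i < j enter. *)
Definition gweight P A : R :=
  \prod_(i < n) \prod_(j < n | (i < j)%N) (if val A i j then P i j else 1 - P i j).

Definition gexp P f : R := \sum_A gweight P A * f A.

Lemma gexp_prod P (h : 'I_n -> 'I_n -> bool -> R) :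
  gexp P (fun A => \prod_(i < n) \prod_(j < n | (i < j)%N) h i j (val A i j))
  = \prod_(i < n) \prod_(j < n | (i < j)%N)
      (P i j * h i j true + (1 - P i j) * h i j false).
Proof.
rewrite -(graph_sum_prod (fun i j b => (if b then P i j else 1 - P i j) * h i j b)).
apply: eq_bigr => A _; rewrite -big_split; apply: eq_bigr => i _.
by rewrite -big_split.
Qed.

Lemma gexp_cst P c : gexp P (fun=> c) = c.
Proof.
have E : gexp P (fun=> 1) = 1.
  transitivity (gexp P (fun=> \prod_(i < n) \prod_(j < n | (i < j)%N) 1)).
    by congr gexp; apply/funext => A; rewrite big1 // => i _; rewrite big1.
  rewrite (gexp_prod P (fun _ _ _ => 1)) big1 // => i _; rewrite big1 // => j _.
  by rewrite !mulr1 addrC subrK.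
by rewrite /gexp -mulr_suml; under eq_bigr do rewrite -[gweight _ _]mulr1; rewrite [X in X * _]E mul1r.
Qed.

Lemma gexp_sum P (I : finType) (F : I -> graph n -> R) :
  gexp P (fun A => \sum_i F i A) = \sum_i gexp P (F i).
Proof.
rewrite /gexp exchange_big /=; apply: eq_bigr => A _.
by rewrite mulr_sumr.
Qed.

Lemma gexpZ P c f : gexp P (fun A => c * f A) = c * gexp P f.
Proof. by rewrite /gexp mulr_sumr; apply: eq_bigr => A _; rewrite mulrCA. Qed.

Lemma gexpD P f g : gexp P (fun A => f A + g A) = gexp P f + gexp P g.
Proof. by rewrite /gexp -big_split; apply: eq_bigr => A _; rewrite mulrDr. Qed.

Definition prob_mx P := forall i j, 0 <= P i j <= 1.

Lemma gweight_ge0 P A : prob_mx P -> 0 <= gweight P A.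
Proof.
move=> P01; apply: prodr_ge0 => i _; apply: prodr_ge0 => j _.
by have /andP[? ?] := P01 i j; case: ifP; rewrite ?subr_ge0.
Qed.

Lemma ler_gexp P f g : prob_mx P -> (forall A, f A <= g A) -> gexp P f <= gexp P g.
Proof. by move=> P01 fg; apply: ler_sum => A _; rewrite ler_wpM2l ?gweight_ge0. Qed.

Definition gprob P (E : pred (graph n)) : R := \sum_(A | E A) gweight P A.

Lemma gprobE P (E : pred (graph n)) : gprob P E = gexp P (fun A => (E A)%:R).
Proof.
rewrite /gprob big_mkcond; apply: eq_bigr => A _.
by case: (E A); rewrite ?mulr1 ?mulr0.
Qed.

Lemma gprobC P E : gprob P E = 1 - gprob P (predC E).
Proof.
suff : gprob P E + gprob P (predC E) = 1 by move=> <-; rewrite addrK.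
rewrite !gprobE -gexpD -[RHS](gexp_cst P 1).
by apply: eq_bigr => A _ /=; congr (_ * _); case: (E A); rewrite /= ?addr0 ?add0r.
Qed.

Lemma gprob_markov P (E : pred (graph n)) f c : prob_mx P -> 0 < c ->
  (forall A, 0 <= f A) -> (forall A, E A -> c <= f A) -> gprob P E <= gexp P f / c.
Proof.
move=> P01 c0 f0 fE; rewrite mulrC -gexpZ gprobE; apply: ler_gexp => // A.
rewrite mulrC ler_pdivlMr //; case: (boolP (E A)) => [/fE|_]; rewrite ?mul1r ?mul0r //.
Qed.

Lemma gprob_union P (I : finType) (E : I -> pred (graph n)) (F : pred (graph n)) : prob_mx P ->
  (forall A, F A -> exists i, E i A) -> gprob P F <= \sum_i gprob P (E i).
Proof.
move=> P01 FE; under eq_bigr => i _ do rewrite gprobE.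
rewrite -gexp_sum gprobE; apply: ler_gexp => // A.
case: (boolP (F A)) => [/FE[i Ei]|_]; last exact: sumr_ge0.
by rewrite (bigD1 i) //= Ei lerDl sumr_ge0.
Qed.

End GraphProbability.

(** * Exponential moments of centered Bernoulli variables *)

Section Mgf.
Variable R : realType.
Implicit Types x c p : R.

(** Squaring 1 - x / 2 <= exp (- x / 2) bounds exp x by the inverse square of 1 - x / 2, and a
    polynomial inequality concludes. *)
Lemma expR_le_quad x : x <= 1 / 2 -> expR x <= 1 + x + 2 * x ^+ 2.
Proof.
move=> x12; have h0 : 0 < 1 - x / 2 by lra.
have hx : (1 - x / 2) ^+ 2 * expR x <= 1.
  have -> : expR x = expR (x / 2) ^+ 2 by rewrite -expRM_natl; congr (expR _); field.
  rewrite -exprMn exprn_ile1 ?mulr_ge0 ?expR_ge0 //; first lra.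
  rewrite -ler_pdivlMr ?expR_gt0 // div1r -expRN.
  by have := expR_ge1Dx (- (x / 2)); lra.
apply: (le_trans (y := ((1 - x / 2) ^+ 2)^-1)).
  by rewrite -[leRHS]mul1r ler_pdivlMr ?exprn_gt0 // mulrC.
rewrite -[leLHS]mul1r ler_pdivrMr ?exprn_gt0 //.
nra.
Qed.

Lemma expR_le_lin_expsq x : expR x <= x + expR (2 * x ^+ 2).
Proof.
have [x12|x12] := leP x (1 / 2).
  by have := expR_le_quad x12; have := expR_ge1Dx (2 * x ^+ 2); lra.
have : expR x <= expR (2 * x ^+ 2) by rewrite ler_expR; nra.
lra.
Qed.

(** The linear terms cancel because the variable is centered. The factor p of the variance is kept,
    at the price of a bounded c; this is the form needed for the column sums. *)
Lemma mgf_variance p c : 0 <= p <= 1 -> `|c| <= 1 / 2 ->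
  p * expR (c * (1 - p)) + (1 - p) * expR (c * (0 - p)) <= expR (2 * c ^+ 2 * p).
Proof.
move=> /andP[p0 p1]; rewrite ler_norml => /andP[c1 c2].
have h1 : expR (c * (1 - p)) <= 1 + c * (1 - p) + 2 * (c * (1 - p)) ^+ 2.
  by apply: expR_le_quad; nra.
have h2 : expR (c * (0 - p)) <= 1 + c * (0 - p) + 2 * (c * (0 - p)) ^+ 2.
  by apply: expR_le_quad; nra.
have h3 := expR_ge1Dx (2 * c ^+ 2 * p).
have {}h1 := ler_wpM2l p0 h1.
have q0 : 0 <= 1 - p by lra.
have {}h2 := ler_wpM2l q0 h2.
have : 0 <= c ^+ 2 * p ^+ 2 by rewrite mulr_ge0 // sqr_ge0.
lra.
Qed.

(** Here c is unrestricted but the factor p is lost, which is harmless for the comparison matrix,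
    whose entries have constant variance. *)
Lemma mgf_subgaussian p c : 0 <= p <= 1 ->
  p * expR (c * (1 - p)) + (1 - p) * expR (c * (0 - p)) <= expR (2 * c ^+ 2).
Proof.
move=> /andP[p0 p1].
have q0 : 0 <= 1 - p by lra.
have sq1 (x : R) : `|x| <= 1 -> expR (2 * (c * x) ^+ 2) <= expR (2 * c ^+ 2).
  move=> x1; rewrite ler_expR exprMn ler_wpM2l // ler_piMr ?sqr_ge0 //.
  by rewrite -real_normK ?num_real // exprn_ile1.
have h1 := le_trans (expR_le_lin_expsq (c * (1 - p))) (lerD (lexx _) (sq1 _ _)).
have h2 := le_trans (expR_le_lin_expsq (c * (0 - p))) (lerD (lexx _) (sq1 _ _)).
have {}h1 := ler_wpM2l p0 (h1 _); have {}h2 := ler_wpM2l q0 (h2 _).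
have n1 : `|1 - p| <= 1 by rewrite ger0_norm; lra.
have n2 : `|0 - p| <= 1 by rewrite ler0_norm; lra.
by have := h1 n1; have := h2 n2; lra.
Qed.

End Mgf.

Section LinearMgf.
Variables (R : realType) (n : nat) (P : 'I_n -> 'I_n -> R).
Hypothesis P01 : prob_mx P.
Implicit Types (A : graph n) (c : 'I_n -> 'I_n -> R).

Definition upper_lin c A : R :=
  \sum_(i < n) \sum_(j < n | (i < j)%N) c i j * ((val A i j)%:R - P i j).

Lemma gexp_expR c : gexp P (fun A => expR (upper_lin c A)) =
  \prod_(i < n) \prod_(j < n | (i < j)%N)
    (P i j * expR (c i j * (1 - P i j)) + (1 - P i j) * expR (c i j * (0 - P i j))).
Proof.
rewrite -(gexp_prod P (fun i j b => expR (c i j * (b%:R - P i j)))).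
apply: eq_bigr => A _; congr (_ * _); rewrite /upper_lin expR_sum.
by apply: eq_bigr => i _; rewrite expR_sum.
Qed.

Lemma gexp_expR_variance c : (forall i j, `|c i j| <= 1 / 2) ->
  gexp P (fun A => expR (upper_lin c A))
    <= expR (2 * \sum_(i < n) \sum_(j < n | (i < j)%N) c i j ^+ 2 * P i j).
Proof.
move=> c1; rewrite gexp_expR mulr_sumr expR_sum.
apply: ler_prod => i _; rewrite prodr_ge0 => [/=|j _]; last first.
  by have /andP[? ?] := P01 i j; rewrite addr_ge0 // mulr_ge0 ?subr_ge0 ?expR_ge0.
rewrite mulr_sumr expR_sum; apply: ler_prod => j _; rewrite mulrA mgf_variance // andbT.
by have /andP[? ?] := P01 i j; rewrite addr_ge0 // mulr_ge0 ?subr_ge0 ?expR_ge0.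
Qed.

Lemma gexp_expR_subgaussian c :
  gexp P (fun A => expR (upper_lin c A))
    <= expR (2 * \sum_(i < n) \sum_(j < n | (i < j)%N) c i j ^+ 2).
Proof.
rewrite gexp_expR mulr_sumr expR_sum.
apply: ler_prod => i _; rewrite prodr_ge0 => [/=|j _]; last first.
  by have /andP[? ?] := P01 i j; rewrite addr_ge0 // mulr_ge0 ?subr_ge0 ?expR_ge0.
rewrite mulr_sumr expR_sum; apply: ler_prod => j _; rewrite mgf_subgaussian // andbT.
by have /andP[? ?] := P01 i j; rewrite addr_ge0 // mulr_ge0 ?subr_ge0 ?expR_ge0.
Qed.

End LinearMgf.

(** * Moments of the noise matrix *)

Section CyclicSteps.
Variable T : eqType.
Implicit Types (w : seq T) (e : T * T).

Definition steps w : seq (T * T) := zip w (rot 1 w).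

Definition same_edge e e' : bool := (e' == e) || (e' == (e.2, e.1)).

(** The other closed walks have expected weight zero: they meet a zero diagonal entry of the noise,
    or a centered entry that occurs exactly once. *)
Definition good (s : seq (T * T)) : bool :=
  all (fun e => (e.1 != e.2) && (1 < count (same_edge e) s)%N) s.

End CyclicSteps.

Lemma undup_map_in (T U : eqType) (f : T -> U) (w : seq T) :
  {in w &, injective f} -> undup (map f w) = map f (undup w).
Proof.
elim: w => //= x w IH fI.
have -> : (f x \in map f w) = (x \in w).
  apply/mapP/idP => [[y yw /fI E]|xw]; last by exists x.
  by rewrite E // !inE ?eqxx ?yw ?orbT.
rewrite IH; last by move=> y z yw zw; apply: fI; rewrite inE ?yw ?zw orbT.
by case: ifP.
Qed.

Lemma steps_map (T U : eqType) (f : T -> U) (w : seq T) :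
  steps (map f w) = map (fun e => (f e.1, f e.2)) (steps w).
Proof.
rewrite /steps -map_rot; move: (rot 1 w) => w'.
by elim: w w' => [|x w IH] [|y w'] //=; rewrite IH.
Qed.

Lemma mem_steps (T : eqType) (w : seq T) e : e \in steps w -> e.1 \in w /\ e.2 \in w.
Proof.
move=> ew; have := map_f fst ew; have := map_f snd ew.
rewrite -/(unzip1 _) -/(unzip2 _) /steps unzip1_zip ?unzip2_zip ?size_rot //.
by rewrite mem_rot.
Qed.

Lemma good_map (T U : eqType) (f : T -> U) (w : seq T) :
  {in w &, injective f} -> good (steps (map f w)) = good (steps w).
Proof.
move=> fI; rewrite /good steps_map all_map; apply: eq_in_all => e /mem_steps[e1 e2] /=.
rewrite (inj_in_eq fI) // count_map; congr (_ && (_ < _)%N).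
apply: eq_in_count => e' /mem_steps[e1' e2'] /=.
by rewrite /same_edge -!pair_eqE /pair_eq /= !(inj_in_eq fI).
Qed.

Section WalkCount.
Variables (n r m : nat).
Hypotheses (n0 : (0 < n)%N) (r0 : (0 < r)%N).

Definition good_walks (N v : nat) : {set m.-tuple 'I_N} :=
  [set w : m.-tuple 'I_N | good (steps w) && (size (undup w) == v)].

Definition uniq_tuples (N v : nat) : {set v.-tuple 'I_N} :=
  [set u : v.-tuple 'I_N | uniq u].

Lemma card_uniq_tuplesE N v : #|uniq_tuples N v| = (N ^_ v)%N.
Proof.
rewrite -[N in RHS]card_ord -card_uniq_tuples.
by apply: eq_card => u; rewrite !inE; case: (uniq u); rewrite ?andbT ?andbF // all_predT.
Qed.

(** Double counting by an injection: a walk w on [n] with v vertices and v distinct labels u in [r]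
    are sent to the walk w relabeled by u, together with the list of the vertices of w. The
    relabeled walk gives back u, and the list then gives back w. This compares the counts without
    classifying walks by shape. *)
Lemma card_good_walks_le v :
  (#|good_walks n v| * r ^_ v <= #|good_walks r v| * n ^_ v)%N.
Proof.
pose x0 : 'I_n := Ordinal n0; pose y0 : 'I_r := Ordinal r0.
pose f (w : m.-tuple 'I_n) (u : v.-tuple 'I_r) x := nth y0 u (index x (undup w)).
(* The default of [insubd] is never reached on good walks, whose list of vertices has length v. *)
pose Phi (p : m.-tuple 'I_n * v.-tuple 'I_r) : m.-tuple 'I_r * v.-tuple 'I_n :=
  ([tuple of map (f p.1 p.2) p.1], insubd [tuple of nseq v x0] (undup p.1)).
rewrite -!card_uniq_tuplesE -!cardsX.
have wsize (w : m.-tuple 'I_n) : w \in good_walks n v -> size (undup w) = v.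
  by rewrite inE => /andP[_ /eqP].
have fI w (u : v.-tuple _) : w \in good_walks n v -> uniq u -> {in w &, injective (f w u)}.
  move=> /wsize sw uu x y xw yw /eqP.
  have iv z : z \in w -> (index z (undup w) < size u)%N.
    by move=> zw; rewrite size_tuple -[v in (_ < v)%N]sw index_mem mem_undup.
  rewrite nth_uniq ?iv // => /eqP E.
  by apply: (index_inj x0 _ _ E); rewrite mem_undup.
have fU w (u : v.-tuple _) : w \in good_walks n v -> uniq u -> undup (map (f w u) w) = u.
  move=> gw uu; rewrite undup_map_in; last exact: fI.
  apply: (@eq_from_nth _ y0) => [|i]; rewrite size_map (wsize _ gw) ?size_tuple // => iv.
  rewrite (nth_map x0) ?(wsize _ gw) // /f index_uniq ?undup_uniq //.
  by rewrite (wsize _ gw).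
rewrite -(card_in_imset (f := Phi)) ?subset_leq_card //; last first.
  move=> [w u] [w' u']; rewrite !inE /= => /andP[/andP[gw sw] uu] /andP[/andP[gw' sw'] uu'] [].
  move=> E1 E2.
  have Gw : w \in good_walks n v by rewrite inE gw sw.
  have Gw' : w' \in good_walks n v by rewrite inE gw' sw'.
  have E3 : undup w = undup w' :> seq _.
    by have := congr1 val E2; rewrite !val_insubd sw sw'.
  have E4 : u = u' by apply: val_inj; rewrite /= -(fU w u) // E1 fU.
  have -> : w = w'; last by rewrite E4.
  apply: val_inj; rewrite /=.
  have K z : z \in good_walks n v -> map (fun y => nth x0 (undup z) (index y u)) (map (f z u) z) = z.
    move=> Gz; rewrite -map_comp -[RHS]map_id; apply/eq_in_map => x xz /=.
    rewrite /f index_uniq ?size_tuple // -?(wsize _ Gz) ?index_mem ?mem_undup //.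
    by rewrite nth_index ?mem_undup.
  by rewrite -(K w) // -(K w') // E1 E3 E4.
apply/fintype.subsetP => _ /imsetP[[w u] wu ->]; move: wu; rewrite !inE /=.
move=> /andP[/andP[gw sw] uu].
have Gw : w \in good_walks n v by rewrite inE gw sw.
rewrite good_map ?gw /=; last exact: fI.
by rewrite fU // size_tuple eqxx val_insubd sw undup_uniq.
Qed.

End WalkCount.

Section TraceExpansion.
Variables (R : comPzRingType) (n : nat).
Implicit Types (W : 'M[R]_n) (s : seq ('I_n * 'I_n)).

Definition mx_weight W s : R := \prod_(e <- s) W e.1 e.2.

Lemma sum_tuple_cons (T : finType) (m : nat) (V : nmodType) (F : seq T -> V) :
  \sum_(t : m.+1.-tuple T) F t = \sum_x \sum_(t : m.-tuple T) F (x :: t).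
Proof.
rewrite pair_big /= (reindex (fun p : T * m.-tuple T => [tuple of p.1 :: p.2])) //=.
exists (fun t => (thead t, [tuple of behead t])) => [[x t] _|t _].
  by congr pair; apply: val_inj.
by rewrite /= -tuple_eta.
Qed.

Lemma expmx_walks W m x y :
  (W ^+ m.+1) x y = \sum_(t : m.-tuple 'I_n) mx_weight W (zip (x :: t) (rcons t y)).
Proof.
elim: m x => [|m IH] x.
  rewrite expr1 (big_pred1 [tuple]) => [|t]; last by apply/esym/eqP/tuple0.
  by rewrite /mx_weight /= big_seq1.
rewrite exprS mxE (sum_tuple_cons _ (fun t => mx_weight W (zip (x :: t) (rcons t y)))).
apply: eq_bigr => z _; rewrite IH mulr_sumr; apply: eq_bigr => t _.
by rewrite /mx_weight /= big_cons.
Qed.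

Lemma mxtrace_walks W m :
  \tr (W ^+ m.+1) = \sum_(w : m.+1.-tuple 'I_n) mx_weight W (steps w).
Proof.
rewrite /mxtrace (sum_tuple_cons _ (fun w => mx_weight W (steps w))).
apply: eq_bigr => x _; rewrite expmx_walks; apply: eq_bigr => t _.
by rewrite /steps rot1_cons.
Qed.

End TraceExpansion.

Section NoiseMoments.
Variables (R : realType) (n : nat).
Implicit Types (P : 'I_n -> 'I_n -> R) (A : graph n) (s : seq ('I_n * 'I_n)).

Definition noise P A : 'M[R]_n :=
  \matrix_(i, j) if i == j then 0 else (val A i j)%:R - P i j.

Definition mult s (i j : 'I_n) : nat := count (same_edge (i, j)) s.

Definition loopless s := all (fun e => e.1 != e.2) s.

(** The k-th central moment of a Bernoulli variable of parameter p. *)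
Definition cmoment (p : R) (k : nat) : R := p * (1 - p) ^+ k + (1 - p) * (0 - p) ^+ k.

(** One step of a walk as a product over all pairs; it lets a walk be regrouped by edges by
    induction on its length. *)
Lemma prod_upper_single (f : 'I_n -> 'I_n -> R) x y : x != y ->
  f x y = f y x ->
  \prod_(i < n) \prod_(j < n | (i < j)%N) f i j ^+ same_edge (i, j) (x, y) = f x y.
Proof.
wlog xy : x y / (x < y)%N.
  move=> H xy fxy; case: (ltngtP x y) => [lt|lt|/val_inj E]; first exact: H.
    have E i j : same_edge (i, j) (x, y) = same_edge (i, j) (y, x).
      by rewrite /same_edge orbC -!pair_eqE /pair_eq /= ![(x == _) && _]andbC.
    by under eq_bigr => i _ do under eq_bigr => j _ do rewrite E; rewrite H // eq_sym.
  by rewrite E eqxx in xy.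
move=> _ fxy; rewrite pair_big_dep /= (bigD1 (x, y)) //= /same_edge eqxx expr1.
rewrite big1 ?mulr1 // => -[i j] /andP[/= ij ne].
rewrite eq_sym (negbTE ne) /= -pair_eqE /pair_eq /=.
case: eqP => [E|]; last by rewrite expr0.
case: eqP => [E'|]; last by rewrite expr0.
by rewrite -E -E' ltnNge ltnW in ij.
Qed.

Lemma mx_weight_noise P A s : (forall i j, P i j = P j i) ->
  mx_weight (noise P A) s =
  (loopless s)%:R * \prod_(i < n) \prod_(j < n | (i < j)%N)
    ((val A i j)%:R - P i j) ^+ mult s i j.
Proof.
move=> PC; elim: s => [|[x y] s IH].
  rewrite /mx_weight big_nil mul1r big1 // => i _; rewrite big1 // => j _.
rewrite /mx_weight big_cons -/(mx_weight _ _) IH /= mxE.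
case: eqVneq => [_|xy]; first by rewrite !mul0r.
rewrite -(prod_upper_single (f := fun i j => (val A i j)%:R - P i j)) //; last first.
  by rewrite graph_sym PC.
rewrite mulrCA -big_split /=; congr (_ * _); apply: eq_bigr => i _.
by rewrite -big_split /=; apply: eq_bigr => j _; rewrite -exprD.
Qed.

Lemma gexp_mx_weight P s : (forall i j, P i j = P j i) ->
  gexp P (fun A => mx_weight (noise P A) s) =
  (loopless s)%:R * \prod_(i < n) \prod_(j < n | (i < j)%N) cmoment (P i j) (mult s i j).
Proof.
move=> PC; rewrite /cmoment -(gexp_prod P (fun i j b => (b%:R - P i j) ^+ mult s i j)).
by rewrite -gexpZ; apply: eq_bigr => A _; rewrite mx_weight_noise.
Qed.

Lemma cmoment0 p : cmoment p 0 = 1.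
Proof. by rewrite /cmoment !expr0; ring. Qed.

Lemma cmoment1 p : cmoment p 1 = 0.
Proof. by rewrite /cmoment !expr1; ring. Qed.

Lemma cmoment_le p k : 0 <= p <= 1 -> (1 < k)%N -> `|cmoment p k| <= p.
Proof.
move=> /andP[p0 p1] k1; have q0 : 0 <= 1 - p by lra.
rewrite /cmoment sub0r; apply: (le_trans (ler_normD _ _)).
rewrite !normrM !normrX normrN !ger0_norm //.
case: k k1 => [|[|k]] // _.
have h1 : (1 - p) ^+ k.+2 <= 1 - p by rewrite exprS ler_piMr // exprn_ile1 //; lra.
have h2 : p ^+ k.+2 <= p * p by rewrite !exprS mulrA ler_piMr ?mulr_ge0 // exprn_ile1.
have := ler_wpM2l p0 h1; have := ler_wpM2l q0 h2; nra.
Qed.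

(** The left factor turns the moment into (2 ^ k + 2 (-1) ^ k) / 3, which is 1, 0, 2, 2, ... The
    parameter 1/2 would not do: its odd central moments vanish, and a good walk may use an edge
    three times. *)
Lemma cmoment_third k : k != 1%N -> 1 <= 3 ^+ k * cmoment (1 / 3) k.
Proof.
have e1 : 2 ^+ k = 3 ^+ k * (1 - 1 / 3) ^+ k :> R by rewrite -exprMn; congr (_ ^+ _); field.
have e2 : (-1) ^+ k = 3 ^+ k * (0 - 1 / 3) ^+ k :> R by rewrite -exprMn; congr (_ ^+ _); field.
have -> : 3 ^+ k * cmoment (1 / 3) k = (2 ^+ k + 2 * (-1) ^+ k) / 3.
  rewrite e1 e2 /cmoment; set u := 3 ^+ k; set v := (1 - _) ^+ k; set w := (0 - _) ^+ k.
  by clearbody u v w; clear; field.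
move=> {e1 e2}; case: k => [|[|k]] // _; first by rewrite !expr0; lra.
rewrite -signr_odd; set b := odd _; have : 2 ^+ k.+2 >= 4 :> R.
  by rewrite !exprS; have : 1 <= 2 ^+ k :> R by [apply: exprn_ege1; lra]; lra.
case: k @b => [|k] /= ; first by rewrite expr0; lra.
have : 2 ^+ k.+3 >= 8 :> R.
  by rewrite !exprS; have : 1 <= 2 ^+ k :> R by [apply: exprn_ege1; lra]; lra.
by case: (odd k); rewrite /= ?expr0 ?expr1; lra.
Qed.

Lemma good_loopless s : good s -> loopless s.
Proof. by apply: sub_all => e /andP[]. Qed.

Lemma same_edge_sym (i j : 'I_n) : same_edge (i, j) =1 same_edge (j, i).
Proof. by move=> e; rewrite /same_edge orbC. Qed.

(** Rephrases the condition on unordered pairs, along which the expectation of a walk factors. *)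
Lemma goodE s : good s =
  loopless s && [forall i : 'I_n, forall j : 'I_n, (i < j)%N ==> (mult s i j != 1%N)].
Proof.
apply/idP/andP => [gs|[ll /forallP mP]].
  split; first exact: good_loopless.
  apply/forallP => i; apply/forallP => j; apply/implyP => ij; apply/negP => /eqP m1.
  have /hasP[e es eij] : has (same_edge (i, j)) s by rewrite has_count -/(mult s i j) m1.
  have /allP/(_ e es)/andP[_] := gs.
  suff -> : count (same_edge e) s = mult s i j by rewrite m1.
  case/orP: eij => /eqP -> //; exact/eq_count/same_edge_sym.
apply/allP => -[x y] es /=; have /allP/(_ _ es)/= xy := ll.
rewrite xy /=.
have c0 : (0 < count (same_edge (x, y)) s)%N.
  by rewrite -has_count; apply/hasP; exists (x, y); rewrite // /same_edge eqxx.
rewrite ltn_neqAle c0 andbT eq_sym.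
case: (ltngtP x y) => [lt|lt|/val_inj E]; last by rewrite E eqxx in xy.
  by have /forallP/(_ y)/implyP/(_ lt) := mP x.
have /forallP/(_ x)/implyP/(_ lt) := mP y.
by rewrite /mult (eq_count (@same_edge_sym _ _)).
Qed.

End NoiseMoments.

Lemma zip_mem (T U : eqType) (s : seq T) (t : seq U) e :
  e \in zip s t -> e.1 \in s /\ e.2 \in t.
Proof.
elim: s t => [|x s IH] [|y t] //=; rewrite inE => /orP[/eqP ->|/IH[e1 e2]].
  by rewrite !inE !eqxx.
by rewrite !inE e1 e2 !orbT.
Qed.

Section WalkEdges.
Variable n : nat.
Implicit Types (x y : 'I_n) (t w : seq 'I_n) (s : seq ('I_n * 'I_n)).

Definition edge_set s : {set 'I_n * 'I_n} :=
  [set p : 'I_n * 'I_n | (p.1 < p.2)%N && (mult s p.1 p.2 != 0%N)].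

Lemma mult_neq0 s i j : (mult s i j != 0%N) = ((i, j) \in s) || ((j, i) \in s).
Proof.
rewrite -lt0n -has_count; apply/hasP/orP => [[e es /orP[]/eqP E]|[es|es]].
- by left; rewrite -E.
- by right; move: es; rewrite E.
- by exists (i, j); rewrite // /same_edge eqxx.
- by exists (j, i); rewrite // /same_edge eqxx orbT.
Qed.

(** Read from the end: a vertex that does not occur later brings an edge that does not occur
    later. *)
Lemma card_path_vertices x t : loopless (zip (x :: t) t) ->
  (#|[set z in x :: t]| <= #|edge_set (zip (x :: t) t)| + 1)%N.
Proof.
elim: t x => [|y t IH] x /=; first by move=> _;
  rewrite (_ : finset _ = [set x]%SET) ?cards1 ?addn1 //; apply/setP => z; rewrite !inE.
move=> /andP[/= xy ll]; have {}IH := IH y ll; set s := zip (y :: t) t in IH ll *.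
have sub : edge_set s \subset edge_set ((x, y) :: s).
  apply/fintype.subsetP => -[i j]; rewrite !inE !mult_neq0 !in_cons => /andP[-> /orP[]->];
  by rewrite !orbT.
case: (boolP (x \in y :: t)) => xt.
  rewrite (_ : [set z in x :: y :: t] = [set z in y :: t]); last first.
    by apply/setP => z; rewrite !inE; case: eqP => // ->; rewrite -in_cons xt.
  by apply: (leq_trans IH); rewrite leq_add2r subset_leq_card.
rewrite (_ : [set z in x :: y :: t] = x |: [set z in y :: t]); last first.
  by apply/setP => z; rewrite !inE.
rewrite cardsU1 inE xt /= -[1%N]/(true : nat) addnC leq_add2r.
apply: (leq_trans IH); rewrite addnC.
pose e := if (x < y)%N then (x, y) else (y, x).
have es : e \notin edge_set s.
  have sy i j : (i, j) \in s -> i \in y :: t /\ j \in y :: t.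
    by move=> /zip_mem[/= -> jt]; rewrite inE jt orbT.
  rewrite inE negb_and /e; case: ifP => _; rewrite /= mult_neq0; apply/orP; right;
  by apply/norP; split; apply/negP => /sy[]; rewrite (negbTE xt).
have -> : (1 + #|edge_set s|)%N = #|e |: edge_set s| by rewrite cardsU1 es.
apply: subset_leq_card; rewrite finset.subUset sub andbT finset.sub1set inE /e.
rewrite mult_neq0; case: (ltngtP x y) xy => [lt _|lt _|/val_inj ->]; last by rewrite eqxx.
  by rewrite /= lt mem_head.
by rewrite /= lt mem_head orbT.
Qed.

Lemma card_walk_vertices w : loopless (steps w) ->
  (size (undup w) <= #|edge_set (steps w)| + 1)%N.
Proof.
have -> : size (undup w) = #|[set z in w]|.
  rewrite -(card_uniqP (undup_uniq w)); apply: eq_card => z.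
  by rewrite !inE mem_undup.
case: w => [_|x t]; first by rewrite eq_card0 // => z; rewrite inE.
have E : steps (x :: t) = zip (x :: rcons t x) (rcons t x).
  rewrite /steps rot1_cons.
  transitivity (zip ((x :: t) ++ [:: x]) (rcons t x ++ [::])).
    by rewrite zip_cat ?size_rcons //= cats0.
  by rewrite cats0 cats1.
rewrite E => /card_path_vertices; apply: leq_trans.
by apply: subset_leq_card; apply/fintype.subsetP => z; rewrite !inE mem_rcons inE orbA orbb.
Qed.

End WalkEdges.

Section WalkWeights.
Variables (R : realType) (n : nat) (P : 'I_n -> 'I_n -> R).
Hypothesis PC : forall i j, P i j = P j i.
Implicit Types (s : seq ('I_n * 'I_n)).

Lemma gexp_bad_walk s : ~~ good s -> gexp P (fun A => mx_weight (noise P A) s) = 0.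
Proof.
rewrite goodE gexp_mx_weight // negb_and.
case: (loopless s) => /=; last by rewrite mul0r.
move=> /forallPn[i /forallPn[j]]; rewrite negb_imply negbK => /andP[ij /eqP m1].
by rewrite (bigD1 i) //= (bigD1 j) //= m1 cmoment1 !(mul0r, mulr0).
Qed.

(** Each edge used contributes a central moment of order at least 2, hence at most p0, and a
    connected graph on v vertices has at least v - 1 edges. *)
Lemma gexp_good_walk p0 (w : seq 'I_n) : (forall i j, 0 <= P i j <= p0) -> p0 <= 1 ->
  good (steps w) ->
  gexp P (fun A => mx_weight (noise P A) (steps w)) <= p0 ^+ (size (undup w)).-1.
Proof.
move=> Pp p01 gw; set s := steps w in gw *.
rewrite gexp_mx_weight //; move: gw; rewrite goodE => /andP[ll /forallP mP].
(* A negative p0 is compatible with the bounds on [P] only if there is no vertex, and then the walk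
   is empty. Otherwise p0 lies in [0, 1] and its powers decrease. *)
have [p00|p00] := ltP p0 0.
  have w0 : w = [::].
    case: (w) => // x t; have /andP[a b] := Pp x x.
    by have := le_trans a b; rewrite leNgt p00.
  rewrite w0 /= expr0 /s w0 /= big1 ?mulr1 // => i _.
  by rewrite big1 // => j _; rewrite /mult /= cmoment0.
have := card_walk_vertices ll; rewrite -/s => cw.
apply: (@le_trans _ _ (p0 ^+ #|edge_set s|)); last first.
  rewrite ler_wiXn2l //; move: cw; rewrite addn1; case: (size _) => //=.
rewrite ll mul1r.
have -> : p0 ^+ #|edge_set s| = \prod_(i < n) \prod_(j < n | (i < j)%N)
    (if mult s i j == 0%N then 1 else p0).
  rewrite pair_big_dep /= -prodr_const; rewrite [RHS](bigID (fun p => mult s p.1 p.2 == 0%N)) /=.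
  rewrite [X in _ = X * _]big1 => [|p /andP[_ ->]] //; rewrite mul1r.
  by apply: eq_big => [p|p]; rewrite inE // => /andP[_ /negbTE ->].
apply: (le_trans (ler_norm _)); rewrite normr_prod; apply: ler_prod => i _.
rewrite normr_ge0 normr_prod; apply: ler_prod => j ij; rewrite normr_ge0 /=.
case: eqP => [->|/eqP m0]; first by rewrite cmoment0 normr1.
have /andP[P0 Pp0] := Pp i j.
have m1 : mult s i j != 1%N by have /forallP/(_ j)/implyP/(_ ij) := mP i.
apply: (le_trans _ Pp0); apply: cmoment_le; first by rewrite P0 (le_trans Pp0).
by move: m0 m1; case: (mult s i j) => [|[|]].
Qed.

Lemma prod_mult (c : R) s : loopless s ->
  \prod_(i < n) \prod_(j < n | (i < j)%N) c ^+ mult s i j = c ^+ size s.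
Proof.
elim: s => [_|[x y] s IH] /=; first by rewrite big1 // => i _; rewrite big1.
move=> /andP[/= xy ll]; rewrite exprS -IH //.
rewrite -[X in _ = X * _](prod_upper_single (f := fun _ _ => c) xy) // -big_split /=.
apply: eq_bigr => i _; rewrite -big_split /=; apply: eq_bigr => j _.
by rewrite -exprD.
Qed.

End WalkWeights.

(** The factors 3 of the steps are distributed over the edges; no multiplicity is 1, so each edge
    contributes at least 1 by [cmoment_third]. *)
Lemma gexp_good_walk_third (R : realType) (n : nat) (s : seq ('I_n * 'I_n)) :
  ((good s)%:R : R) <= 3 ^+ size s *
    gexp (fun _ _ => 1 / 3) (fun A => mx_weight (noise (fun _ _ => 1 / 3) A) s).
Proof.
case: (boolP (good s)) => [gs|/gexp_bad_walk ->]; rewrite ?mulr0 //.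
rewrite gexp_mx_weight //; move: gs; rewrite goodE => /andP[ll /forallP mP].
rewrite ll [X in _ * X]mul1r -prod_mult // -big_split /=.
have prod_ge1 (I : finType) (Q : pred I) (F : I -> R) :
    (forall i, Q i -> 1 <= F i) -> 1 <= \prod_(i | Q i) F i.
  move=> F1; apply: (big_ind (fun x : R => 1 <= x)) => // x y x1 y1.
  by rewrite -[1]mulr1 ler_pM.
apply: (@prod_ge1) => i _; rewrite -big_split /=; apply: (@prod_ge1) => j ij.
by apply: cmoment_third; have /forallP/(_ j)/implyP/(_ ij) := mP i.
Qed.

(* The walks on [n] of a given shape are injections of its v <= m vertices, so
   there are at most n ^ v of them, and at least r (r - m) ^ (v - 1) on [r]. *)
Lemma trace_comparison (R : realType) (n r m : nat) (P : 'I_n -> 'I_n -> R) (p0 : R) :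
  (0 < n)%N -> (m.+1 < r)%N -> (forall i j, P i j = P j i) ->
  (forall i j, 0 <= P i j <= p0) -> p0 <= 1 -> n%:R * p0 <= (r - m.+1)%:R ->
  gexp P (fun A => \tr (noise P A ^+ m.+1)) <=
  n%:R / r%:R * 3 ^+ m.+1 *
    gexp (fun _ _ : 'I_r => 1 / 3) (fun A => \tr (noise (fun _ _ => 1 / 3) A ^+ m.+1)).
Proof.
move=> n0 mr PC Pp p01 npr; have r0 : (0 < r)%N by apply: leq_trans mr.
have rm0 : 0 < (r - m.+1)%:R :> R by rewrite ltr0n subn_gt0.
have p00 : 0 <= p0 by have /andP[a b] := Pp (Ordinal n0) (Ordinal n0); apply: le_trans b.
under [X in gexp P X]eq_fun => A do rewrite mxtrace_walks.
under [X in _ * gexp _ X]eq_fun => A do rewrite mxtrace_walks.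
rewrite !gexp_sum.
set N := fun (k v : nat) => #|good_walks m.+1 k v|.
have size_w k (w : m.+1.-tuple 'I_k) : (0 < size (undup w) < m.+2)%N.
  apply/andP; split; last by rewrite ltnS (leq_trans (size_undup _)) // size_tuple.
  by case: w => [[|x t] //] i; rewrite lt0n size_eq0; apply/eqP => /undup_nil.
have Neq k (F : nat -> R) :
    \sum_(w : m.+1.-tuple 'I_k | good (steps w)) F (size (undup w))
    = \sum_(v < m.+2 | (0 < v)%N) (N k v)%:R * F v.
  rewrite (partition_big (fun w : m.+1.-tuple 'I_k => inord (size (undup w)) : 'I_m.+2)
    (fun v => (0 < v)%N)) /=; last first.
    by move=> w _; have /andP[? ?] := size_w k w; rewrite inordK.
  apply: eq_bigr => v v0; rewrite /N -sum1_card natr_sum mulr_suml.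
  apply: eq_big => [w|w /andP[_ /eqP <-]].
    rewrite inE; congr (_ && _); rewrite -val_eqE /= inordK //.
    by have /andP[? ?] := size_w k w.
  by rewrite mul1r inordK //; have /andP[? ?] := size_w k w.
apply: (@le_trans _ _ (\sum_(v < m.+2 | (0 < v)%N) (N n v)%:R * p0 ^+ v.-1)).
  rewrite -(Neq n (fun v => p0 ^+ v.-1)) big_mkcond /= [leRHS]big_mkcond /=.
  apply: ler_sum => w _; case: (boolP (good _)) => [gw|/gexp_bad_walk -> //].
  by apply: gexp_good_walk.
apply: (@le_trans _ _ (n%:R / r%:R * \sum_(v < m.+2 | (0 < v)%N) (N r v)%:R * 1)); last first.
  rewrite -(Neq r (fun=> 1)) -[leRHS]mulrA ler_wpM2l ?divr_ge0 // mulr_sumr big_mkcond /=.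
  apply: ler_sum => w _.
  have := gexp_good_walk_third R (steps w).
  have -> : size (steps w) = m.+1.
    by rewrite /steps size_zip size_rot minnn size_tuple.
  by case: (good _).
rewrite mulr_sumr; apply: ler_sum => v v0; rewrite mulr1.
rewrite -mulrA mulrCA ler_pdivlMl ?ltr0n //.
have vm : (v <= m.+1)%N by rewrite -ltnS.
have h1 : ((N n v)%:R * r%:R * (r - m.+1)%:R ^+ v.-1 : R) <= (N r v)%:R * n%:R ^+ v.
  apply: (@le_trans _ _ ((N n v * r ^_ v)%:R)); last first.
    rewrite -natrX -natrM ler_nat.
    apply: (leq_trans (card_good_walks_le m.+1 n0 r0 v)).
    rewrite leq_mul2l; apply/orP; right; elim: (v : nat) => // v' IH.
    by rewrite ffactnSr expnSr leq_mul // leq_subr.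
  rewrite natrM -mulrA ler_wpM2l ?ler0n // -natrX -natrM ler_nat.
  case: (v : nat) v0 vm => // v' _ vm /=.
  rewrite ffactnS leq_mul2l; apply/orP; right.
  have : (v' <= m)%N by [].
  elim: v' {vm} => // v' IH vm; rewrite expnSr ffactnSr leq_mul //; first by apply: IH; lia.
  lia.
(* The hypothesis n p0 <= r - m - 1 pays for each vertex after the first, and the first one leaves
   the factor n / r. *)
have h2 : p0 ^+ v.-1 * n%:R ^+ v <= n%:R * (r - m.+1)%:R ^+ v.-1 :> R.
  rewrite -{2}(prednK v0) exprS mulrCA ler_wpM2l ?ler0n // -exprMn lerXn2r ?nnegrE ?ler0n //.
    by rewrite mulr_ge0.
  by rewrite mulrC.
have x0 : 0 < (r - m.+1)%:R ^+ v.-1 :> R by apply: exprn_gt0.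
rewrite -(ler_pM2r x0); apply: (@le_trans _ _ (p0 ^+ v.-1 * ((N r v)%:R * n%:R ^+ v))).
  have pp : 0 <= p0 ^+ v.-1 by apply: exprn_ge0.
  apply: le_trans (ler_wpM2l pp h1).
  by rewrite le_eqVlt; apply/orP; left; apply/eqP; ring.
rewrite mulrCA -mulrA [leRHS]mulrCA; exact: ler_wpM2l.
Qed.

(** * Operator norm of the comparison matrix *)

Section Dot.
Variables (R : realType) (n : nat).
Implicit Types (x y z : 'rV[R]_n) (M N : 'M[R]_n).

Definition dot x y : R := (x *m y^T) 0 0.

Lemma dotE x y : dot x y = \sum_i x 0 i * y 0 i.
Proof. by rewrite /dot mxE; apply: eq_bigr => i _; rewrite mxE. Qed.

Lemma dotC x y : dot x y = dot y x.
Proof. by rewrite !dotE; apply: eq_bigr => i _; rewrite mulrC. Qed.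

Lemma dotDl x y z : dot (x + y) z = dot x z + dot y z.
Proof. by rewrite /dot mulmxDl mxE. Qed.

Lemma dotDr x y z : dot z (x + y) = dot z x + dot z y.
Proof. by rewrite dotC dotDl !(dotC z). Qed.

Lemma dotZl a x y : dot (a *: x) y = a * dot x y.
Proof. by rewrite /dot -scalemxAl mxE. Qed.

Lemma dotZr a x y : dot x (a *: y) = a * dot x y.
Proof. by rewrite dotC dotZl dotC. Qed.

Lemma dot_ge0 x : 0 <= dot x x.
Proof. by rewrite dotE sumr_ge0 // => i _; rewrite -expr2 sqr_ge0. Qed.

Lemma dot_mulmx x y M : dot (x *m M) y = dot x (y *m M^T).
Proof. by rewrite /dot trmx_mul trmxK mulmxA. Qed.

Lemma dot_eq0 x : dot x x = 0 -> x = 0.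
Proof.
rewrite dotE => /eqP; rewrite psumr_eq0 => [/allP x0|i _]; last by rewrite -expr2 sqr_ge0.
apply/matrixP => i j; rewrite ord1 mxE; apply/eqP.
by have := x0 j (mem_index_enum _); rewrite mulf_eq0 orbb.
Qed.

Lemma dot_CS x y : dot x y ^+ 2 <= dot x x * dot y y.
Proof.
have [y0|yn0] := eqVneq (dot y y) 0.
  by rewrite (dot_eq0 y0) [dot x 0]dotE big1 ?expr0n ?mulr_ge0 ?dot_ge0 // => i _; rewrite mxE mulr0.
have yp : 0 < dot y y by rewrite lt_def yn0 dot_ge0.
rewrite -(ler_pM2l yp) -subr_ge0.
have := dot_ge0 (dot y y *: x + (- dot x y) *: y).
rewrite !(dotDl, dotDr, dotZl, dotZr) (dotC y x).
by congr (0 <= _); ring.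
Qed.

Lemma dot_delta M i : dot (delta_mx 0 i *m M) (delta_mx 0 i *m M) = (M *m M^T) i i.
Proof.
rewrite dotE mxE; apply: eq_bigr => j _.
by rewrite -rowE !mxE.
Qed.

(** Cauchy-Schwarz column by column: the Frobenius norm bounds the operator norm. *)
Lemma dot_mulmx_le x M : dot (x *m M) (x *m M) <= dot x x * \tr (M *m M^T).
Proof.
have -> : \tr (M *m M^T) = \sum_j dot (col j M)^T (col j M)^T.
  rewrite mxtrace_mulC; apply: eq_bigr => j _; rewrite dotE mxE.
  by apply: eq_bigr => i _; rewrite !mxE.
rewrite dotE mulr_sumr; apply: ler_sum => j _.
apply: le_trans (dot_CS _ _); rewrite expr2 dotE mxE.
by under [in leRHS]eq_bigr => i _ do rewrite !mxE.
Qed.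

Lemma trmx_exp M k : M^T = M -> (M ^+ k)^T = M ^+ k.
Proof.
move=> MT; elim: k => [|k IH]; first by rewrite expr0 trmx1.
by rewrite [in LHS]exprS -mulmxE trmx_mul MT IH exprSr.
Qed.

Lemma dot_exp x M i j : M^T = M ->
  dot (x *m M ^+ i) (x *m M ^+ j) = dot x (x *m M ^+ (i + j)).
Proof. by move=> MT; rewrite dot_mulmx trmx_exp // -mulmxA mulmxE -exprD addnC. Qed.

(* The moments x M^j x^T are log-convex, so they grow at least like lam ^ j. *)
Lemma trace_exp_ge M lam x k : M^T = M -> 0 < lam -> 0 < dot x x ->
  lam * dot x x <= dot x (x *m M) -> lam ^+ (2 * k) <= \tr (M ^+ (2 * k)).
Proof.
move=> MT lam0 x0 hx; pose m j := dot x (x *m M ^+ j).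
have CS i j : m (i + j)%N ^+ 2 <= m (2 * i)%N * m (2 * j)%N.
  by rewrite /m !mul2n -!addnn -!dot_exp // dot_CS.
have m0 : m 0%N = dot x x by rewrite /m expr0 mulmx1.
have m1 : lam * m 0%N <= m 1%N by rewrite m0 /m expr1.
have H j : 0 < m (2 * j)%N /\ lam ^+ 2 * m (2 * j)%N <= m (2 * j.+1)%N.
  elim: j => [|j [mj IH]].
    rewrite muln0 muln1 m0; split=> //.
    have := CS 0%N 1%N; rewrite muln0 muln1 add0n => h.
    rewrite -(ler_pM2l x0) -m0; apply: le_trans h; rewrite mulrCA -expr2 -exprMn.
    have l0 : 0 <= lam * m 0%N by rewrite m0 mulr_ge0 ?ltW.
    by rewrite lerXn2r ?nnegrE // (le_trans l0 m1).
  have mj1 : 0 < m (2 * j.+1)%N by apply: lt_le_trans IH; rewrite mulr_gt0 ?exprn_gt0.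
  split=> //; rewrite -(ler_pM2l mj).
  have -> : (2 * j.+1 = j + j.+2)%N by lia.
  apply: le_trans (CS j j.+2); have -> : (j + j.+2 = 2 * j.+1)%N by lia.
  by rewrite mulrA [m _ * _]mulrC expr2; apply: ler_wpM2r => //; apply: ltW.
have G j : lam ^+ (2 * j) * m 0%N <= m (2 * j)%N.
  elim: j => [|j IH]; first by rewrite muln0 expr0 mul1r.
  have [_] := H j; apply: le_trans; rewrite (_ : 2 * j.+1 = 2 + 2 * j)%N; last lia.
  by rewrite exprD -mulrA; apply: ler_wpM2l => //; rewrite exprn_ge0 ?ltW.
have := dot_mulmx_le x (M ^+ k).
rewrite dot_exp // trmx_exp // mulmxE -exprD addnn -mul2n -/(m _) -m0.
move=> /(le_trans (G k)); rewrite mulrC ler_pM2l // m0 //.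
Qed.

(** The i-th diagonal entry of M ^ (2k) is the squared norm of e_i M ^ k. *)
Lemma trace_exp_le M rho k : M^T = M -> 0 <= rho ->
  (forall x, dot (x *m M) (x *m M) <= rho ^+ 2 * dot x x) ->
  \tr (M ^+ (2 * k)) <= n%:R * rho ^+ (2 * k).
Proof.
move=> MT rho0 hM.
have -> : n%:R * rho ^+ (2 * k) = \sum_(i < n) rho ^+ (2 * k).
  by rewrite sumr_const card_ord mulr_natl.
have H x j : dot (x *m M ^+ j) (x *m M ^+ j) <= rho ^+ (2 * j) * dot x x.
  elim: j => [|j IH]; first by rewrite expr0 mulmx1 muln0 expr0 mul1r.
  rewrite exprSr -mulmxE mulmxA; apply: (le_trans (hM _)).
  rewrite (_ : 2 * j.+1 = 2 + 2 * j)%N; last lia.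
  by rewrite exprD -mulrA ler_wpM2l ?exprn_ge0.
apply: ler_sum => i _; have := H (delta_mx 0 i) k.
rewrite dot_delta // trmx_exp // mulmxE -exprD addnn -mul2n.
suff -> : dot (delta_mx 0 i) (delta_mx 0 i) = 1 :> R by rewrite mulr1.
rewrite dotE (bigD1 i) //= big1 => [|j ji]; rewrite !mxE ?eqxx ?mulr1 ?addr0 //.
by rewrite (negbTE ji) mulr0.
Qed.

End Dot.

Section Grid.
Variables (R : realType) (r : nat).
Hypothesis r0 : (0 < r)%N.

(** Lattice points of spacing 1 / (4 sqrt r), stored as magnitude and sign. For a point of the unit
    ball the squares of the magnitudes sum to at most 16 r, which explains the range of the
    ordinals. *)
Definition grid := {ffun 'I_r -> 'I_(16 * r).+1 * bool}.

Definition mesh : R := 4 * Num.sqrt r%:R.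

Definition grid_vec (z : grid) : 'rV[R]_r :=
  \row_i ((-1) ^+ (z i).2 * ((z i).1 : nat)%:R / mesh).

Definition small (z : grid) : bool := (\sum_i (z i).1 ^ 2 <= 16 * r)%N.

Lemma mesh_gt0 : 0 < mesh.
Proof. by rewrite mulr_gt0 // sqrtr_gt0 ltr0n. Qed.

Lemma mesh_sq : mesh ^+ 2 = 16 * r%:R.
Proof. by rewrite exprMn sqr_sqrtr // -natrX. Qed.

Lemma dot_grid_vec z : small z -> dot (grid_vec z) (grid_vec z) <= 1.
Proof.
move=> sz; rewrite dotE.
under eq_bigr => i _ do rewrite mxE -expr2 exprMn exprMn sqrr_sign mul1r exprVn.
rewrite -mulr_suml ler_pdivrMr ?exprn_gt0 ?mesh_gt0 // mul1r mesh_sq -natrM.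
rewrite (eq_bigr (fun i => ((z i).1 ^ 2)%:R)); last by move=> i _; rewrite natrX.
by rewrite -natr_sum ler_nat.
Qed.

(** Rounding every coordinate towards 0 keeps the point in the unit ball and moves each coordinate
    by at most 1 / (4 sqrt r). *)
Lemma grid_approx (x : 'rV[R]_r) : dot x x <= 1 ->
  exists2 z, small z & dot (x - grid_vec z) (x - grid_vec z) <= 1 / 16.
Proof.
move=> x1; pose t i := Num.truncn (mesh * `|x 0 i|).
have m0 := mesh_gt0.
have tx i : (t i)%:R <= mesh * `|x 0 i| < (t i).+1%:R.
  by apply: truncn_itv; rewrite mulr_ge0 ?(ltW m0).
have ts : (\sum_i t i ^ 2 <= 16 * r)%N.
  rewrite -(ler_nat R) natr_sum natrM -mesh_sq -[leRHS]mulr1.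
  apply: le_trans (ler_wpM2l (ltW (exprn_gt0 2 m0)) x1).
  rewrite dotE mulr_sumr; apply: ler_sum => i _.
  rewrite natrX -expr2 -(real_normK (num_real (x 0 i))) -exprMn.
  have /andP[? _] := tx i; rewrite lerXn2r ?nnegrE //.
  by rewrite mulr_ge0 ?(ltW m0).
have tb i : (t i < (16 * r).+1)%N.
  rewrite ltnS; apply: leq_trans ts; rewrite (bigD1 i) //=.
  by apply: leq_trans (leq_addr _ _); case: (t i) => // k; rewrite -mulnn leq_pmulr.
exists [ffun i => (Ordinal (tb i), x 0 i < 0)].
  by rewrite /small; under eq_bigr => i _ do rewrite ffunE.
apply: (@le_trans _ _ (\sum_(i < r) (mesh ^+ 2)^-1)).
  rewrite dotE; apply: ler_sum => i _; rewrite !mxE !ffunE /= -expr2.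
  set y := x 0 i; have E : y = (-1) ^+ (y < 0)%R * `|y| by rewrite -realEsign ?num_real.
  rewrite [X in X - _]E -mulrA -mulrBr exprMn sqrr_sign mul1r -exprVn.
  have /andP[h1 h2] := tx i.
  have k0 : 0 <= `|y| - (t i)%:R / mesh by rewrite subr_ge0 ler_pdivrMr // mulrC.
  rewrite lerXn2r ?nnegrE ?invr_ge0 ?(ltW m0) //.
  rewrite lerBlDr -[X in X + _]mul1r -mulrDl ler_pdivlMr // mulrC ltW //.
  by rewrite addrC natr1.
rewrite sumr_const card_ord mesh_sq -[_ *+ r]mulr_natr invfM mulfVK ?div1r //.
by rewrite pnatr_eq0 -lt0n.
Qed.

(** Counting by exponential weights: sum t_i <= sum t_i ^ 2 <= 16 r, so 2 ^ (16 r) times the product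
    of the 2 ^ (- t_i) is at least 1 on small points. Summed over all magnitudes and both signs, the
    product gives at most 4 per coordinate. *)
Lemma card_small : #|[set z | small z]|%:R <= (2 ^+ 18) ^+ r :> R.
Proof.
rewrite -sum1_card natr_sum.
apply: (@le_trans _ _ (\sum_(z : grid) 2 ^+ (16 * r) * \prod_i (2 ^- (z i).1 : R))).
  rewrite big_mkcond; apply: ler_sum => z _.
  have p0 : 0 < \prod_i (2 ^- (z i).1 : R) by apply: prodr_gt0 => i _; rewrite invr_gt0 exprn_gt0.
  rewrite inE; case: (boolP (small z)) => sz; last by rewrite mulr_ge0 ?exprn_ge0 ?ltW.
  rewrite prodfV prodrXr ler_pdivlMr ?exprn_gt0 // mul1r.
  apply: ler_weXn2l; first by lra.
  apply: leq_trans sz; apply: leq_sum => i _.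
  by case: ((z i).1 : nat) => // k; rewrite -mulnn leq_pmulr.
rewrite -mulr_sumr.
rewrite -(bigA_distr_bigA (fun (i : 'I_r) (a : 'I_(16 * r).+1 * bool) => 2 ^- a.1 : R)).
rewrite prodr_const card_ord exprM -exprMn.
have s2 N : \sum_(a < N) 2 ^- a <= 2 - 2 * 2 ^- N :> R.
  elim: N => [|N IH]; first by rewrite big_ord0 expr0 invr1 mulr1 subrr.
  rewrite big_ord_recr /= exprS invfM.
  by apply: (le_trans (lerD IH (lexx _))); lra.
have q0 : 0 <= \sum_(a : 'I_(16 * r).+1 * bool) 2 ^- a.1 :> R.
  by apply: sumr_ge0 => a _; rewrite invr_ge0 exprn_ge0.
rewrite lerXn2r ?nnegrE ?mulr_ge0 ?exprn_ge0 //.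
rewrite (_ : 18 = 16 + 2)%N // exprD ler_wpM2l ?exprn_ge0 //.
rewrite -(pair_bigA _ (fun (i : 'I_(16 * r).+1) (b : bool) => 2 ^- i : R)) /=.
under eq_bigr => i _ do rewrite sumr_const card_bool -[2 ^- _ *+ _]mulr_natl.
rewrite -mulr_sumr expr2 ler_wpM2l //.
by apply: le_trans (s2 _) _; rewrite lerBlDr lerDl mulr_ge0 ?invr_ge0 ?exprn_ge0.
Qed.

(** Let rho be the supremum of the bilinear form on the unit ball, finite by the Frobenius bound.
    Rounding both arguments to the grid, with errors of norm at most 1/4, gives rho <= B + rho / 4 +
    rho / 4. *)
Lemma grid_opnorm (M : 'M[R]_r) B :
  (forall z z', small z -> small z' -> `|dot (grid_vec z) (grid_vec z' *m M)| <= B) ->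
  forall x, dot (x *m M) (x *m M) <= (2 * B) ^+ 2 * dot x x.
Proof.
move=> hB.
pose S := [set v : R | exists x y, [/\ dot x x <= 1, dot y y <= 1 & v = dot x (y *m M)]]%classic.
have d00 : dot (0 : 'rV[R]_r) 0 = 0 by rewrite dotE big1 // => i _; rewrite mxE mul0r.
have S0 : S 0 by exists 0, 0; rewrite d00 ler01; split=> //; rewrite mul0mx d00.
have Sub : has_ubound S.
  exists (1 + \tr (M *m M^T)) => _ [x [y [x1 y1 ->]]].
  have h : dot x (y *m M) ^+ 2 <= \tr (M *m M^T).
    apply: (le_trans (dot_CS _ _)); apply: (@le_trans _ _ (1 * dot (y *m M) (y *m M))).
      by rewrite ler_wpM2r // dot_ge0.
    rewrite mul1r; apply: (le_trans (dot_mulmx_le _ _)); rewrite -[leRHS]mul1r.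
    rewrite ler_wpM2r // /mxtrace sumr_ge0 // => i _.
    by rewrite -dot_delta dot_ge0.
  by nra.
pose rho := sup S.
have rhoP x y : dot x x <= 1 -> dot y y <= 1 -> dot x (y *m M) <= rho.
  by move=> x1 y1; apply: ub_le_sup => //; exists x, y.
have rho0 : 0 <= rho by apply: ub_le_sup.
have rhoB : rho <= 2 * B.
  suff : rho <= B + rho / 2 by lra.
  apply: ge_sup; first by exists 0.
  move=> _ [x [y [x1 y1 ->]]].
  have [z sz hz] := grid_approx x1; have [z' sz' hz'] := grid_approx y1.
  set e := x - _ in hz; set f := y - _ in hz'.
  have -> : dot x (y *m M) = dot (grid_vec z) (grid_vec z' *m M)
      + dot e (y *m M) + dot (grid_vec z) (f *m M).
    rewrite addrAC -dotDr -mulmxDl [grid_vec z' + f]addrC subrK -dotDl.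
    by rewrite [grid_vec z + e]addrC subrK.
  have h1 := le_trans (ler_norm _) (hB z z' sz sz').
  have scale4 (u : 'rV[R]_r) : dot u u <= 1 / 16 -> dot (4 *: u) (4 *: u) <= 1.
    by rewrite dotZl dotZr => h; lra.
  have h2 := rhoP _ _ (scale4 _ hz) y1.
  have h3 := rhoP _ _ (dot_grid_vec sz) (scale4 _ hz').
  rewrite dotZl in h2; rewrite -scalemxAl dotZr in h3; lra.
move=> x; set v := x *m M.
have [x0|xn0] := eqVneq (dot x x) 0.
  by rewrite x0 mulr0 /v (dot_eq0 x0) mul0mx d00.
have [v0|vn0] := eqVneq (dot v v) 0; first by rewrite v0 mulr_ge0 ?sqr_ge0 ?dot_ge0.
have xp : 0 < dot x x by rewrite lt_def xn0 dot_ge0.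
have vp : 0 < dot v v by rewrite lt_def vn0 dot_ge0.
pose a := Num.sqrt (dot x x); pose b := Num.sqrt (dot v v).
have a0 : 0 < a by rewrite sqrtr_gt0.
have b0 : 0 < b by rewrite sqrtr_gt0.
have aE : dot x x = a ^+ 2 by rewrite sqr_sqrtr ?dot_ge0.
have bE : dot v v = b ^+ 2 by rewrite sqr_sqrtr ?dot_ge0.
have unit1 (u : 'rV[R]_r) c : 0 < c -> dot u u = c ^+ 2 -> dot (c^-1 *: u) (c^-1 *: u) <= 1.
  move=> c0 uE; rewrite dotZl dotZr uE mulrA -expr2 exprVn mulVf //.
  by rewrite expf_neq0 // gt_eqF.
have := rhoP _ _ (unit1 _ _ b0 bE) (unit1 _ _ a0 aE).
rewrite dotZl -scalemxAl dotZr -/v bE.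
have -> : b^-1 * (a^-1 * b ^+ 2) = b / a by field; rewrite !gt_eqF.
rewrite ler_pdivrMr // => h.
rewrite aE -exprMn lerXn2r ?nnegrE ?(ltW b0) ?mulr_ge0 ?(ltW a0) //; first lra.
by apply: (le_trans h); rewrite ler_wpM2r // ltW.
Qed.

End Grid.

(** * Even moments of the noise and the spectral tail *)

Lemma exprn_le_fact_expR (R : realType) (x : R) (k : nat) : (0 < k)%N -> ~~ odd k ->
  x ^+ k <= k`!%:R * (expR x + expR (- x)).
Proof.
move=> k0 ok; have [x0|x0] := leP 0 x.
  have := expR_ge1Dxn k.-1 x0; rewrite prednK // => h.
  have : x ^+ k / k`!%:R <= expR x + expR (- x) by have := expR_gt0 (- x); lra.
  by rewrite ler_pdivrMr ?ltr0n ?fact_gt0 // mulrC.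
have -> : x ^+ k = (- x) ^+ k by rewrite exprNn -signr_odd (negbTE ok) mul1r.
have nx0 : 0 <= - x by lra.
have := expR_ge1Dxn k.-1 nx0; rewrite prednK // => h.
have : (- x) ^+ k / k`!%:R <= expR x + expR (- x) by have := expR_gt0 x; lra.
by rewrite ler_pdivrMr ?ltr0n ?fact_gt0 // mulrC.
Qed.

Lemma sum_diag_upper (V : nmodType) (n : nat) (F : 'I_n -> 'I_n -> V) :
  \sum_i \sum_j F i j =
  \sum_i F i i + \sum_(i < n) \sum_(j < n | (i < j)%N) (F i j + F j i).
Proof.
under [X in _ = _ + X]eq_bigr => i _ do rewrite big_split.
rewrite big_split /= [X in _ = _ + (_ + X)](exchange_big_dep xpredT) //= -!big_split /=.
apply: eq_bigr => i _; rewrite (bigD1 i) //= (bigID (fun j : 'I_n => i < j)%N) /=.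
congr (_ + (_ + _)); apply: eq_bigl => j; rewrite -val_eqE /=; case: ltngtP => //.
Qed.

Lemma sum_offdiag (V : nmodType) (n : nat) (F : 'I_n -> 'I_n -> V) :
  (forall i, F i i = 0) ->
  \sum_i \sum_j F i j = \sum_(i < n) \sum_(j < n | (i < j)%N) (F i j + F j i).
Proof. by move=> F0; rewrite sum_diag_upper big1 ?add0r. Qed.

Section NoiseBilinear.
Variable R : realType.

Lemma noise_sym n (P : 'I_n -> 'I_n -> R) (A : graph n) :
  (forall i j, P i j = P j i) -> (noise P A)^T = noise P A.
Proof.
move=> PC; apply/matrixP => i j; rewrite !mxE eq_sym.
by case: eqP => // _; rewrite graph_sym PC.
Qed.

Lemma dot_noise n (P : 'I_n -> 'I_n -> R) (A : graph n) (x w : 'rV[R]_n) :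
  (forall i j, P i j = P j i) ->
  dot x (w *m noise P A) =
  upper_lin P (fun i j => x 0 i * w 0 j + x 0 j * w 0 i) A.
Proof.
move=> PC; rewrite dotE.
under eq_bigr => i _ do rewrite mxE mulr_sumr.
rewrite sum_offdiag => [|i]; last by rewrite !mxE eqxx !mulr0.
apply: eq_bigr => i _; apply: eq_bigr => j ij; rewrite !mxE.
have /negbTE ne : i != j by rewrite -val_eqE ltn_eqF.
by rewrite [j == i]eq_sym ne graph_sym PC; ring.
Qed.

Lemma gexp_dot_pow n (P : 'I_n -> 'I_n -> R) (x w : 'rV[R]_n) (k : nat) :
  (forall i j, P i j = P j i) -> prob_mx P -> (0 < k)%N ->
  dot x x <= 1 -> dot w w <= 1 ->
  gexp P (fun A => dot x (w *m noise P A) ^+ (2 * k)) <= 2 * (4 * expR 4 * k%:R) ^+ k.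
Proof.
move=> PC P01 k0 x1 w1; pose c i j := x 0 i * w 0 j + x 0 j * w 0 i.
have kR : 0 < k%:R :> R by rewrite ltr0n.
have sk : 0 < Num.sqrt k%:R :> R by rewrite sqrtr_gt0.
(* The squared coefficients sum to at most 2, so the exponential moment at t is at most exp (4 t ^
   2). The choice t ^ 2 = k makes it exp (4k), while the division by t ^ (2k) reduces (2k)! <= 4 ^ k
   k ^ (2k) to 4 ^ k k ^ k. *)
pose t : R := Num.sqrt k%:R.
have t2 : t ^+ 2 = k%:R by rewrite sqr_sqrtr // ltW.
have c2 : \sum_(i < n) \sum_(j < n | (i < j)%N) c i j ^+ 2 <= 2.
  apply: (@le_trans _ _ (2 * (dot x x * dot w w))); last first.
    rewrite -[leRHS]mulr1 ler_wpM2l // -[leRHS]mulr1.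
    by apply: ler_pM; rewrite ?dot_ge0.
  apply: (@le_trans _ _ (2 * \sum_(i < n) \sum_(j < n | (i < j)%N)
      ((x 0 i * w 0 j) ^+ 2 + (x 0 j * w 0 i) ^+ 2))).
    rewrite mulr_sumr; apply: ler_sum => i _; rewrite mulr_sumr; apply: ler_sum => j _.
    rewrite /c; set u := x 0 i * _; set v := x 0 j * _.
    by have := sqr_ge0 (u - v); lra.
  rewrite ler_wpM2l // !dotE mulr_suml.
  rewrite [leRHS](_ : _ = \sum_(i < n) \sum_(j < n) (x 0 i * w 0 j) ^+ 2); last first.
    apply: eq_bigr => i _; rewrite mulr_sumr; apply: eq_bigr => j _; ring.
  by rewrite sum_diag_upper lerDr sumr_ge0 // => i _; apply: sqr_ge0.
have bound s : `|s| = t ->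
    gexp P (fun A => expR (s * dot x (w *m noise P A))) <= expR (4 * k%:R).
  move=> st; rewrite (_ : (fun A => _) = fun A => expR (upper_lin P (fun i j => s * c i j) A)).
    apply: (le_trans (gexp_expR_subgaussian P01 _)); rewrite ler_expR.
    under eq_bigr => i _ do under eq_bigr => j _ do rewrite exprMn.
    under eq_bigr => i _ do rewrite -mulr_sumr.
    rewrite -mulr_sumr -(real_normK (num_real s)) st t2.
    by have := ler_wpM2l (ltW kR) c2; lra.
  apply/funext => A; rewrite dot_noise // /upper_lin mulr_sumr; congr expR.
  by apply: eq_bigr => i _; rewrite mulr_sumr; apply: eq_bigr => j _; rewrite mulrA.
have h : k%:R ^+ k * gexp P (fun A => dot x (w *m noise P A) ^+ (2 * k))
    <= (2 * k)`!%:R * (2 * expR (4 * k%:R)).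
  rewrite -gexpZ; apply: (@le_trans _ _ (gexp P (fun A => (2 * k)`!%:R *
     (expR (t * dot x (w *m noise P A)) + expR ((- t) * dot x (w *m noise P A)))))).
    apply: ler_gexp => // A; rewrite -t2 -exprM -exprMn mulNr.
    by apply: exprn_le_fact_expR; rewrite ?muln_gt0 // mul2n odd_double.
  rewrite gexpZ gexpD ler_wpM2l ?ler0n //.
  have := bound t (gtr0_norm sk); have := bound (- t).
  by rewrite normrN gtr0_norm // => /(_ erefl); lra.
have f2 : (2 * k)`!%:R <= 4 ^+ k * (k%:R ^+ k * k%:R ^+ k) :> R.
  rewrite -!natrX -!natrM ler_nat -expnMn mulnn.
  have -> : (4 ^ k * (k ^ 2) ^ k = (2 * k) ^ (2 * k))%N.
    by rewrite [in RHS]expnM -!expnMn; congr (_ ^ _)%N; rewrite expnMn.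
  elim: (2 * k)%N => // m IH; rewrite factS expnS leq_mul2l; apply/orP; right.
  by apply: (leq_trans IH); case: (m) => // m'; rewrite leq_exp2r.
have kk : 0 < k%:R ^+ k :> R by apply: exprn_gt0.
rewrite -(ler_pM2l kk); apply: (le_trans h).
apply: (@le_trans _ _ (4 ^+ k * (k%:R ^+ k * k%:R ^+ k) * (2 * expR (4 * k%:R)))).
  by rewrite ler_wpM2r // mulr_ge0 ?expR_ge0.
rewrite [4 * k%:R]mulrC expRM_natl.
by rewrite !exprMn le_eqVlt; apply/orP; left; apply/eqP; ring.
Qed.

End NoiseBilinear.

Section SpectralTail.
Variable R : realType.

(** The factor 4 exp 4 is that of [gexp_dot_pow], another 4 is the square of the constant 2 in
    [grid_opnorm], and the last factor, to the power k, bounds the number of pairs of grid points in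
    dimension 3k. *)
Definition third_const : R := 16 * expR 4 * (2 ^+ 18) ^+ 6.

Lemma trace_exp_even_ge0 n (M : 'M[R]_n) k : M^T = M -> 0 <= \tr (M ^+ (2 * k)).
Proof.
move=> MT; apply: sumr_ge0 => i _.
by rewrite mul2n -addnn exprD -[X in _ * X](trmx_exp _ MT) -mulmxE -dot_delta dot_ge0.
Qed.

(** The trace is at most the dimension times (2 B) ^ (2k), B being the maximum over pairs of grid
    points; B ^ (2k) is at most the sum of the 2k-th powers, whose expectations are bounded one by
    one. *)
Lemma trace_noise_third (k : nat) : (0 < k)%N ->
  gexp (fun _ _ : 'I_(3 * k) => 1 / 3 : R) (fun A => \tr (noise (fun _ _ => 1 / 3) A ^+ (2 * k)))
  <= 2 * (3 * k)%:R * (third_const * k%:R) ^+ k.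
Proof.
move=> k0; set r := (3 * k)%N; have r0 : (0 < r)%N by rewrite muln_gt0.
pose P := fun _ _ : 'I_r => 1 / 3 : R.
have PC i j : P i j = P j i by [].
have P01 : prob_mx P by move=> i j; rewrite /P; apply/andP; split; lra.
pose f (p : grid r * grid r) A := dot (grid_vec R p.1) (grid_vec R p.2 *m noise P A) ^+ (2 * k).
have f0 p A : 0 <= f p A by rewrite /f exprM exprn_ge0 // sqr_ge0.
have step A : \tr (noise P A ^+ (2 * k)) <=
    r%:R * 4 ^+ k * \sum_(p | small p.1 && small p.2) f p A.
  set S := \sum_(p | _) _.
  pose B := \big[Order.max/0]_(p : grid r * grid r | small p.1 && small p.2)
     `|dot (grid_vec R p.1) (grid_vec R p.2 *m noise P A)|.
  have [B0 BS] : 0 <= B /\ B ^+ (2 * k) <= S.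
    apply: (big_ind (fun b => 0 <= b /\ b ^+ (2 * k) <= S)).
    - rewrite lexx expr0n muln_eq0 /= gtn_eqF //; split=> //.
      by apply: sumr_ge0.
    - by move=> x y [? ?] [? ?]; rewrite /Order.max; case: ifP.
    - move=> p ps; rewrite normr_ge0 exprM real_normK ?num_real // -exprM.
      split=> //; rewrite /S (bigD1 p) //= lerDl.
      by apply: sumr_ge0.
  have B20 : 0 <= 2 * B by rewrite (mulr_ge0 (ler0n _ 2) B0).
  have := trace_exp_le k (noise_sym A PC) B20.
  move=> /(_ (grid_opnorm r0 _)) h.
  apply: (le_trans (h _)) => {h} [z z' sz sz'|].
    apply: (le_bigmax_cond _ (fun p : grid r * grid r =>
      `|dot (grid_vec R p.1) (grid_vec R p.2 *m noise P A)|) (j := (z, z'))).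
    by rewrite /= sz sz'.
  rewrite -mulrA ler_wpM2l ?ler0n // exprMn exprM (_ : 2 ^+ 2 = 4) ?ler_wpM2l ?exprn_ge0 //.
  by rewrite expr2; lra.
apply: (le_trans (ler_gexp P01 step)); rewrite gexpZ.
rewrite (_ : (fun A => _) = fun A => \sum_p (if small p.1 && small p.2
   then f p A else 0)); last by apply/funext => A; rewrite big_mkcond.
rewrite gexp_sum.
apply: (@le_trans _ _ (r%:R * 4 ^+ k * \sum_(p : grid r * grid r | small p.1 && small p.2)
   (2 * (4 * expR 4 * k%:R) ^+ k))).
  rewrite ler_wpM2l ?mulr_ge0 ?exprn_ge0 // [leRHS]big_mkcond; apply: ler_sum => p _.
  case: ifP => [|_]; last by rewrite gexp_cst.
  move=> /andP[s1 s2].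
  by apply: gexp_dot_pow => //; apply: dot_grid_vec.
rewrite sumr_const -[_ *+ #|_|]mulr_natl.
pose N : R := #|[set z | @small r z]|%:R; have N0 : 0 <= N by rewrite ler0n.
rewrite (_ : #|_|%:R = N * N); last first.
  rewrite -natrM -cardX; congr (_%:R); apply: eq_card => p.
  by rewrite !inE.
have hN : N * N <= ((2 ^+ 18) ^+ 6) ^+ k :> R.
  have -> : ((2 ^+ 18) ^+ 6) ^+ k = (2 ^+ 18) ^+ r * (2 ^+ 18) ^+ r :> R.
    by rewrite -exprM -exprD /r; congr (_ ^+ _); lia.
  by apply: ler_pM => //; apply: card_small.
rewrite /third_const.
have -> : 2 * r%:R * (16 * expR 4 * (2 ^+ 18) ^+ 6 * k%:R) ^+ k =
  r%:R * 4 ^+ k * (((2 ^+ 18) ^+ 6) ^+ k * (2 * (4 * expR 4 * k%:R) ^+ k)) :> R.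
  set c := (2 ^+ 18) ^+ 6; have -> : 16 = 4 * 4 :> R by lra.
  by rewrite !exprMn; ring.
rewrite ler_wpM2l ?mulr_ge0 ?exprn_ge0 //.
by rewrite ler_wpM2r ?mulr_ge0 ?exprn_ge0.
Qed.

(** Only the upper tail of the quadratic form is recorded: recovery compares the noise with a
    multiple of the identity from above. *)
Definition spectral_bad n (P : 'I_n -> 'I_n -> R) (lam : R) : pred (graph n) :=
  fun A => `[< exists x : 'rV_n, 0 < dot x x /\ lam * dot x x <= dot x (x *m noise P A) >].

Lemma noise_spectral n (P : 'I_n -> 'I_n -> R) p0 lam (k : nat) :
  (0 < n)%N -> (0 < k)%N -> (forall i j, P i j = P j i) ->
  (forall i j, 0 <= P i j <= p0) -> p0 <= 1 -> n%:R * p0 <= k%:R -> 0 < lam ->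
  gprob P (spectral_bad P lam) <= 2 * n%:R * (9 * third_const * k%:R / lam ^+ 2) ^+ k.
Proof.
move=> n0 k0 PC Pp p01 npk lam0.
have P01 : prob_mx P.
  by move=> i j; have /andP[-> h] := Pp i j; rewrite (le_trans h p01).
have l2 : 0 < lam ^+ (2 * k) by rewrite exprn_gt0.
have h : gprob P (spectral_bad P lam) <=
    gexp P (fun A => \tr (noise P A ^+ (2 * k))) / lam ^+ (2 * k).
  apply: gprob_markov => // A; first by apply: trace_exp_even_ge0; apply: noise_sym.
  move=> /asboolP[x [x0 hx]].
  by apply: (trace_exp_ge k _ lam0 x0 hx); apply: noise_sym.
apply: (le_trans h); rewrite ler_pdivrMr //.
have [m mE] : exists m, (2 * k = m.+1)%N by exists (2 * k).-1; rewrite prednK // muln_gt0.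
(* With r = 3k and walks of length 2k, exactly k labels remain after removing 2k, so the comparison
   asks for n p0 <= k. *)
have t := @trace_comparison R n (3 * k) m P p0 n0.
rewrite -mE in t; rewrite (_ : 3 * k - 2 * k = k)%N in t; last lia.
apply: (le_trans (t _ PC Pp p01 npk)); first lia.
have r0 : 0 < (3 * k)%:R :> R by rewrite ltr0n muln_gt0.
apply: (@le_trans _ _ (n%:R / (3 * k)%:R * 3 ^+ (2 * k) *
    (2 * (3 * k)%:R * (third_const * k%:R) ^+ k))).
  rewrite ler_wpM2l ?trace_noise_third // mulr_ge0 ?divr_ge0 ?exprn_ge0 //.
rewrite (exprM 3 2 k) (exprM lam 2 k) -mulrA -mulrA -[leRHS]mulrA -exprMn.
rewrite (_ : 9 * third_const * k%:R / lam ^+ 2 * lam ^+ 2 = 9 * (third_const * k%:R)); last first.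
  by rewrite mulfVK ?mulrA // gt_eqF // exprn_gt0.
rewrite (_ : 3 ^+ 2 = 9); last by rewrite expr2; lra.
rewrite [(9 * _) ^+ k]exprMn.
move: (9 ^+ k) ((third_const * _) ^+ k) r0; set q := (3 * k)%:R; clearbody q => u v r0.
by rewrite le_eqVlt; apply/orP; left; apply/eqP; field; rewrite gt_eqF.
Qed.

End SpectralTail.

(** * Recovery by the semidefinite relaxation *)

Section Psd.
Variables (R : realType) (n : nat).
Implicit Types (B Y : 'M[R]_n) (u v : 'rV[R]_n).

Lemma psd_dot Y u : psd Y -> 0 <= dot u (u *m Y).
Proof. by move=> [_ /(_ u)]; rewrite -/(dot _ _) dotC. Qed.

Lemma psd_intro Y : Y^T = Y -> (forall u, 0 <= dot u (u *m Y)) -> psd Y.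
Proof. by move=> YT Y0; split=> // u; rewrite -/(dot _ _) dotC. Qed.

Lemma dot_delta_l u i : dot (delta_mx 0 i) u = u 0 i.
Proof.
rewrite dotE (bigD1 i) //= big1 => [|j ji]; rewrite !mxE ?eqxx ?mul1r ?addr0 //.
by rewrite (negbTE ji) mul0r.
Qed.

Lemma psd_diag_ge0 Y i : psd Y -> 0 <= Y i i.
Proof. by move=> /(psd_dot (delta_mx 0 i)); rewrite dot_delta_l -rowE mxE. Qed.

Lemma psd_shift Y i u t : psd Y ->
  dot (u + t *: delta_mx 0 i) ((u + t *: delta_mx 0 i) *m Y)
  = dot u (u *m Y) + t *+ 2 * dot u (row i Y) + t ^+ 2 * Y i i.
Proof.
move=> [YT _]; rewrite mulmxDl -scalemxAl -rowE !(dotDl, dotDr, dotZl, dotZr) !dot_delta_l.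
have -> : (u *m Y) 0 i = dot u (row i Y).
  by rewrite !mxE dotE; apply: eq_bigr => j _; rewrite !mxE -[in LHS]YT mxE.
by rewrite !mxE; ring.
Qed.

Lemma psd_zero_diag Y : psd Y -> (forall i, Y i i = 0) -> Y = 0.
Proof.
move=> Yp Y0; apply/matrixP => i j; rewrite mxE.
have H t : 0 <= t *+ 2 * Y i j.
  have := psd_dot (delta_mx 0 j + t *: delta_mx 0 i) Yp.
  by rewrite psd_shift // -rowE !dot_delta_l !mxE !Y0 mulr0 addr0 add0r.
by have := H 1; have := H (-1); lra.
Qed.

(** Elimination in place of a spectral decomposition: subtracting the rank-one matrix of a nonzero
    pivot keeps [Y] positive semidefinite, clears one more diagonal entry, and changes the trace by
    a nonnegative multiple of a value of the form of [B]. *)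
Lemma psd_trace_mul_ge0 B Y : psd B -> psd Y -> 0 <= \tr (B *m Y).
Proof.
move=> Bp; have [m] := ubnP #|[set i | Y i i != 0]|; elim: m Y => // m IH Y hm Yp.
case: (pickP (fun i => Y i i != 0)) => [i Yi0|Y0]; last first.
  by rewrite (psd_zero_diag Yp) ?mulmx0 ?mxtrace0 // => i; apply/eqP/negbFE/Y0.
have Yi : 0 < Y i i by rewrite lt_def Yi0 psd_diag_ge0.
have YT := Yp.1.
pose v := row i Y; pose Y' := Y - (Y i i)^-1 *: (v^T *m v).
have Y'E u : dot u (u *m Y') = dot u (u *m Y) - (Y i i)^-1 * dot u v ^+ 2.
  rewrite /Y' mulmxBr -scalemxAr -scaleN1r scalerA dotDr dotZr mulN1r mulNr; congr (_ - _ * _).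
  rewrite mulmxA (_ : u *m v^T = (dot u v)%:M); last first.
    by apply/matrixP => a b; rewrite !ord1 [RHS]mxE eqxx mulr1n.
  by rewrite mul_scalar_mx dotZr expr2.
have Y'p : psd Y'.
  apply: psd_intro => [|u].
    by rewrite /Y' linearB linearZ /= trmx_mul trmxK YT.
  rewrite Y'E; have := psd_dot (u + (- (dot u v / Y i i)) *: delta_mx 0 i) Yp.
  rewrite psd_shift // -/v; congr (0 <= _); field; exact: Yi0.
have Y'd j : Y' j j = Y j j - (Y i i)^-1 * Y i j ^+ 2.
  by rewrite /Y' !mxE big_ord1 !mxE expr2.
have -> : \tr (B *m Y) = \tr (B *m Y') + (Y i i)^-1 * dot v (v *m B).
  rewrite /Y' mulmxBr -scalemxAr raddfB /= mxtraceZ mulmxA [X in _ - _ * X]mxtrace_mulC mulmxA.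
  by rewrite [\tr (v *m B *m v^T)]/mxtrace big_ord1 -/(dot _ _) dotC subrK.
rewrite addr_ge0 ?mulr_ge0 ?invr_ge0 ?(ltW Yi) ?psd_dot //.
rewrite ltnS in hm; apply: IH => //; apply: leq_trans hm; apply: proper_card; apply/properP; split.
  apply/fintype.subsetP => j; rewrite !inE; apply: contra => /eqP Yj0.
  have := psd_diag_ge0 j Y'p; rewrite Y'd Yj0 sub0r oppr_ge0 => h.
  by rewrite oppr_eq0 eq_le h mulr_ge0 ?invr_ge0 ?sqr_ge0 // ltW.
exists i; rewrite !inE // Y'd negbK subr_eq0; apply/eqP; field; exact: Yi0.
Qed.

(** Perturbing u in the direction e_i gives a quadratic polynomial in t that vanishes at 0 and is
    nowhere negative; its linear coefficient, twice the i-th entry of u Y, must vanish. *)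
Lemma psd_kernel Y u : psd Y -> dot u (u *m Y) = 0 -> u *m Y = 0.
Proof.
move=> Yp u0; apply/matrixP => a i; rewrite ord1 [RHS]mxE; set y := (u *m Y) 0 i.
have H t : 0 <= t *+ 2 * y + t ^+ 2 * Y i i.
  have := psd_dot (u + t *: delta_mx 0 i) Yp; rewrite psd_shift // u0 add0r.
  suff -> : dot u (row i Y) = y by [].
  by rewrite /y mxE dotE; apply: eq_bigr => j _; rewrite !mxE -[in LHS]Yp.1 mxE.
have Yi := psd_diag_ge0 i Yp.
have [Y0|Yn0] := eqVneq (Y i i) 0.
  by have := H 1; have := H (-1); rewrite Y0; lra.
have := H (- y / Y i i).
have -> : (- y / Y i i) *+ 2 * y + (- y / Y i i) ^+ 2 * Y i i = - (y ^+ 2 / Y i i).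
  by field.
rewrite oppr_ge0 pmulr_lle0 ?invr_gt0 ?lt_def ?Yn0 // => h.
by apply/eqP; rewrite -sqrf_eq0 eq_le h sqr_ge0.
Qed.

Lemma psd_offdiag_le Y i j : psd Y -> Y i j *+ 2 <= Y i i + Y j j.
Proof.
move=> Yp; have := psd_dot (delta_mx 0 i + (-1) *: delta_mx 0 j) Yp.
have YT : Y j i = Y i j by rewrite -[in LHS]Yp.1 mxE.
by rewrite psd_shift // -rowE !dot_delta_l !mxE YT; lra.
Qed.

End Psd.

Section Recovery.
Variables (R : realType) (n K : nat) (sigma : labeling n K).
Hypotheses (K0 : (0 < K)%N) (n0 : (0 < n)%N) (Kn : (K %| n)%N) (bal : balanced sigma).
Implicit Types (W Y M N : 'M[R]_n).

Local Notation s := (n %/ K)%N.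
Local Notation Z := (cluster_mx R sigma).

Definition ip M N : R := \sum_i \sum_j M i j * N i j.

Lemma ip_trace M N : ip M N = \tr (M *m N^T).
Proof.
apply: eq_bigr => i _; rewrite mxE; apply: eq_bigr => j _; by rewrite mxE.
Qed.

Lemma ipC M N : ip M N = ip N M.
Proof. by apply: eq_bigr => i _; apply: eq_bigr => j _; rewrite mulrC. Qed.

Lemma ipDl M N Y : ip (M + N) Y = ip M Y + ip N Y.
Proof. by rewrite !ip_trace mulmxDl mxtraceD. Qed.

Lemma ipZl a M Y : ip (a *: M) Y = a * ip M Y.
Proof. by rewrite !ip_trace -scalemxAl mxtraceZ. Qed.

Lemma ipZr a M Y : ip Y (a *: M) = a * ip Y M.
Proof. by rewrite !(ipC Y) ipZl. Qed.

Lemma ipBl M N Y : ip (M - N) Y = ip M Y - ip N Y.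
Proof. by rewrite -[- N]scaleN1r ipDl ipZl mulN1r. Qed.

Lemma ipBr M N Y : ip Y (M - N) = ip Y M - ip Y N.
Proof. by rewrite !(ipC Y) ipBl. Qed.

Lemma ip_tr M N : ip M^T N^T = ip M N.
Proof.
rewrite /ip exchange_big /=; apply: eq_bigr => i _; apply: eq_bigr => j _.
by rewrite !mxE.
Qed.

Lemma size_cluster_gt0 : (0 < s)%N.
Proof. by rewrite divn_gt0 // dvdn_leq. Qed.

Lemma sR_gt0 : 0 < s%:R :> R.
Proof. by rewrite ltr0n size_cluster_gt0. Qed.

Lemma card_cluster c : #|[set i | sigma i == c]| = s.
Proof. by have /forallP/(_ c)/eqP := bal. Qed.

Lemma cluster_mx_tr : Z^T = Z.
Proof. by apply/matrixP => i j; rewrite !mxE eq_sym. Qed.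

Lemma cluster_row_sum i : \sum_j Z i j = s%:R.
Proof.
under eq_bigr do rewrite mxE; rewrite -natr_sum -(card_cluster (sigma i)).
rewrite -sum1_card big_mkcond /=; congr (_%:R); rewrite [RHS]big_mkcond /=.
by apply: eq_bigr => j _; rewrite inE eq_sym; case: eqP.
Qed.

Lemma cluster_mx_sq : Z *m Z = s%:R *: Z.
Proof.
apply/matrixP => i j; rewrite !mxE.
rewrite (eq_bigr (fun k => Z i k * (sigma i == sigma j)%:R)); last first.
  move=> k _; rewrite !mxE; case: eqP => [->|] //; by rewrite !mul0r.
by rewrite -mulr_suml cluster_row_sum.
Qed.

(** Common to the two programs: it contains the set [certC], and s times the feasible set of the
    candidate program. One gap estimate then serves both. *)
Definition relaxation Y : Prop :=
  [/\ psd Y, forall i j, 0 <= Y i j, forall i, \sum_j Y i j <= s%:R & \tr Y = n%:R].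

(** A linear substitute for the l1 distance: on [certC] it is half of |Y - Z|_1. *)
Definition gap Y : R := n%:R * s%:R - ip Z Y.

Definition proj : 'M[R]_n := s%:R^-1 *: Z.
Definition coproj : 'M[R]_n := 1%:M - proj.

Lemma proj_tr : proj^T = proj.
Proof. by rewrite linearZ /= cluster_mx_tr. Qed.

Lemma proj_idem : proj *m proj = proj.
Proof.
rewrite /proj -scalemxAl -scalemxAr cluster_mx_sq !scalerA.
by rewrite -mulrA mulVf ?mulr1 // gt_eqF ?sR_gt0.
Qed.

Lemma coproj_tr : coproj^T = coproj.
Proof. by rewrite linearB /= trmx1 proj_tr. Qed.

Lemma coproj_idem : coproj *m coproj = coproj.
Proof. by rewrite /coproj mulmxBl mul1mx mulmxBr mulmx1 proj_idem subrr subr0. Qed.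

Lemma coproj_cluster : coproj *m Z = 0.
Proof.
rewrite /coproj mulmxBl mul1mx /proj -scalemxAl cluster_mx_sq scalerA mulVf ?scale1r ?subrr //.
by rewrite gt_eqF // sR_gt0.
Qed.

Lemma ip_coproj Y : \tr Y = n%:R -> ip coproj Y = gap Y / s%:R.
Proof.
move=> trY; rewrite /coproj ipBl ipZl /gap.
have -> : ip 1%:M Y = n%:R by rewrite ip_trace mul1mx mxtrace_tr.
rewrite mulrBl mulfK ?gt_eqF ?sR_gt0 //; congr (_ - _); exact: mulrC.
Qed.

(** lam I - W stays positive semidefinite after compression by [coproj], so it pairs nonnegatively
    with [Y]; the pairing of [coproj] itself with [Y] is gap / s. *)
Lemma ip_compressed W lam Y : W^T = W -> psd Y -> \tr Y = n%:R ->
  (forall x, dot x (x *m W) <= lam * dot x x) ->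
  ip (coproj *m W *m coproj) Y <= lam * gap Y / s%:R.
Proof.
move=> WT Yp trY hW; rewrite -mulrA -ip_coproj // -ipZl -subr_ge0.
rewrite -ipBl ip_trace Yp.1.
apply: psd_trace_mul_ge0 => //; apply: psd_intro => [|u].
  by rewrite linearB linearZ /= !trmx_mul coproj_tr WT mulmxA.
rewrite mulmxBr dotDr -scaleN1r dotZr mulN1r -scalemxAr dotZr subr_ge0.
have -> : dot u (u *m coproj) = dot (u *m coproj) (u *m coproj).
  by rewrite [RHS]dot_mulmx coproj_tr -mulmxA coproj_idem.
have -> : dot u (u *m (coproj *m W *m coproj)) = dot (u *m coproj) (u *m coproj *m W).
  by rewrite [RHS]dot_mulmx coproj_tr !mulmxA.
exact: hW.
Qed.

Definition in_mass Y j : R := \sum_(i | sigma i == sigma j) Y i j.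

Lemma sum_in_mass Y : \sum_j in_mass Y j = ip Z Y.
Proof.
rewrite /ip exchange_big /=; apply: eq_bigr => j _; rewrite /in_mass big_mkcond.
by apply: eq_bigr => i _; rewrite mxE; case: eqP; rewrite ?mul1r ?mul0r.
Qed.

Lemma relaxation_col Y j : relaxation Y -> \sum_i Y i j <= s%:R.
Proof.
move=> [[YT _] _ h _]; apply: le_trans (h j).
by rewrite -[in leLHS]YT; under eq_bigr do rewrite mxE.
Qed.

Lemma in_mass_le Y j : relaxation Y -> in_mass Y j <= s%:R.
Proof.
move=> Yr; apply: le_trans (relaxation_col j Yr); have [_ Y0 _ _] := Yr.
by rewrite [leRHS](bigID (fun i => sigma i == sigma j)) /= lerDl sumr_ge0.
Qed.

Lemma gapE Y : gap Y = \sum_j (s%:R - in_mass Y j).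
Proof. by rewrite big_split /= sumr_const card_ord -[_ *+ n]mulr_natl sumrN sum_in_mass. Qed.

Lemma gap_ge0 Y : relaxation Y -> 0 <= gap Y.
Proof. by move=> Yr; rewrite gapE sumr_ge0 // => j _; rewrite subr_ge0 in_mass_le. Qed.

(** A matrix whose rows are constant on clusters sees Y - Z only through block sums in each column.
    In column j the own block loses s - in_mass, and the other blocks together gain at most as much:
    whence the factor 2. *)
Lemma ip_block_le (g : 'I_K -> 'I_n -> R) mu Y : relaxation Y -> 0 <= mu ->
  (forall c j, `|g c j| <= mu) ->
  `|ip (\matrix_(i, j) (s%:R^-1 * g (sigma i) j)) (Y - Z)| <= mu * (2 * gap Y) / s%:R.
Proof.
move=> Yr mu0 hg; have [Yp Y0 _ _] := Yr.
rewrite /ip exchange_big /=.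
apply: (le_trans (ler_norm_sum _ _ _)).
rewrite mulrAC gapE mulr_sumr mulr_sumr; apply: ler_sum => j _.
(* Bounds for the absolute block sums of Y - Z in column j. *)
pose e c := if c == sigma j then s%:R - in_mass Y j else \sum_(i | sigma i == c) Y i j.
have -> : \sum_i (\matrix_(i, j) (s%:R^-1 * g (sigma i) j)) i j * (Y - Z) i j
   = s%:R^-1 * \sum_c g c j * \sum_(i | sigma i == c) (Y - Z) i j.
  rewrite mulr_sumr (partition_big sigma xpredT) //=; apply: eq_bigr => c _.
  rewrite !mulr_sumr; apply: eq_bigr => i /eqP <-.
  by rewrite mxE mulrA.
rewrite normrM gtr0_norm ?invr_gt0 ?sR_gt0 // [mu / _]mulrC -mulrA.
rewrite ler_wpM2l ?invr_ge0 ?(ltW sR_gt0) //.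
apply: (le_trans (ler_norm_sum _ _ _)).
apply: (@le_trans _ _ (\sum_c mu * e c)).
  apply: ler_sum => c _; rewrite normrM ler_pM //.
  have -> : \sum_(i | sigma i == c) (Y - Z) i j =
      \sum_(i | sigma i == c) Y i j - \sum_(i | sigma i == c) Z i j.
    by rewrite -sumrB; apply: eq_bigr => i _; rewrite !mxE.
  rewrite /e; case: eqP => [->|cj].
    have -> : \sum_(i | sigma i == sigma j) Z i j = s%:R.
      rewrite -(cluster_row_sum j) big_mkcond; apply: eq_bigr => i _.
      by rewrite !mxE eq_sym; case: eqP.
    by rewrite distrC ger0_norm // subr_ge0 in_mass_le.
  rewrite [X in _ - X]big1 ?subr0 ?ger0_norm ?sumr_ge0 // => i /eqP ic.
  by rewrite mxE ic; case: eqP.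
rewrite -mulr_sumr ler_wpM2l // (bigD1 (sigma j)) //= /e eqxx.
rewrite mulr2n mulrDl mul1r lerD2l.
apply: (@le_trans _ _ (\sum_i Y i j - in_mass Y j)); last first.
  by rewrite lerB // relaxation_col.
rewrite [\sum_i Y i j](bigID (fun i => sigma i == sigma j)) /= -/(in_mass Y j) addrAC subrr add0r.
rewrite (partition_big sigma (fun c => c != sigma j)) //=.
apply: ler_sum => c cj; rewrite (negbTE cj) le_eqVlt; apply/orP; left; apply/eqP.
by apply: eq_bigl => i; case: eqP => [->|]; rewrite ?cj ?andbF.
Qed.

(** A = W + (p - q) Z + q J - p I. As the trace of [Y] is fixed and its total sum is at most that of
    Z, the mean contributes at least (p - q) gap. Outside its compressed part, W equals G1 + G1^T -
    G2, three block matrices that cost 2 mu gap / s each: hence 6 mu. *)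
Lemma recovery_gap (A : graph n) (p q lam mu : R) Y :
  let W := noise (fun i j => if sigma i == sigma j then p else q) A in
  let AR : 'M[R]_n := \matrix_(i, j) (val A i j)%:R in
  relaxation Y -> 0 <= q -> 0 <= mu ->
  (forall x, dot x (x *m W) <= lam * dot x x) ->
  (forall c j, `|\sum_(k | sigma k == c) W k j| <= mu) ->
  (p - q - (lam + 6 * mu) / s%:R) * gap Y <= ip AR Z - ip AR Y.
Proof.
move=> W AR Yr q0 mu0 hW hmu; have [Yp Y0 Ys Yt] := Yr.
have WT : W^T = W by apply: noise_sym => i j; rewrite eq_sym.
have s0 := sR_gt0.
pose J : 'M[R]_n := const_mx 1.
have AE : AR = W + (p - q) *: Z + q *: J - p%:M.
  apply/matrixP => i j; rewrite !mxE.
  case: (eqVneq i j) => [->|ij] /=.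
    rewrite graph_irr eqxx.
    by rewrite !mulr1n mulr0n; ring.
  by case: (sigma i == sigma j); rewrite ?mulr1 ?mulr0 ?mulr1n ?mulr0n; ring.
pose G1 : 'M[R]_n := \matrix_(i, j) (s%:R^-1 * \sum_(k | sigma k == sigma i) W k j).
pose w' c j : R := s%:R^-1 * \sum_(l | sigma l == sigma j) \sum_(k | sigma k == c) W k l.
pose G2 : 'M[R]_n := \matrix_(i, j) (s%:R^-1 * w' (sigma i) j).
have PW : proj *m W = G1.
  apply/matrixP => i j; rewrite !mxE mulr_sumr [RHS]big_mkcond; apply: eq_bigr => k _.
  by rewrite !mxE eq_sym; case: eqP; rewrite ?mulr1 ?mulr0 ?mul0r.
have PWP : proj *m W *m proj = G2.
  apply/matrixP => i j; rewrite PW mxE [RHS]mxE /w' mulrA mulr_sumr [RHS]big_mkcond.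
  apply: eq_bigr => l _; rewrite !mxE; case: eqP => _; rewrite ?mulr0 // mulr1.
  by rewrite mulrAC.
have w'mu c j : `|w' c j| <= mu.
  rewrite normrM gtr0_norm ?invr_gt0 // ler_pdivrMl //.
  apply: (le_trans (ler_norm_sum _ _ _)).
  apply: (@le_trans _ _ (\sum_(l | sigma l == sigma j) mu)); first by apply: ler_sum.
  rewrite sumr_const -[mu *+ _]mulr_natl ler_wpM2r // ler_nat -(card_cluster (sigma j)).
  by apply/eq_leq/eq_card => i; rewrite !inE.
have B1 := ip_block_le Yr mu0 hmu; rewrite -/G1 in B1.
have B2 := ip_block_le Yr mu0 w'mu; rewrite -/G2 in B2.
have B3 := ip_compressed WT Yp Yt hW.
have WE : W = coproj *m W *m coproj + G1 + G1^T - G2.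
  rewrite -PWP -PW trmx_mul WT proj_tr /coproj.
  rewrite mulmxBl mul1mx mulmxBr mulmx1 mulmxBl.
  move: (proj *m W) (W *m proj) (proj *m W *m proj) => a b c.
  by apply/matrixP => i j; rewrite !mxE; ring.
have MT : (Y - Z)^T = Y - Z by rewrite linearB /= Yp.1 cluster_mx_tr.
have Z0 : ip (coproj *m W *m coproj) Z = 0.
  by rewrite ip_trace cluster_mx_tr -mulmxA coproj_cluster mulmx0 mxtrace0.
have IW : ip W (Y - Z) <= (lam + 6 * mu) / s%:R * gap Y.
  rewrite [X in ip X _]WE ipBl !ipDl.
  rewrite -[in ip G1^T _]MT ip_tr [ip (_ *m coproj) _]ipBr Z0 subr0.
  move: B1 B2; rewrite !ler_norml => /andP[_ b1] /andP[b2 _].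
  have -> : (lam + 6 * mu) / s%:R * gap Y =
     lam * gap Y / s%:R + 3 * (mu * (2 * gap Y) / s%:R) by ring.
  by lra.
have trZ : \tr Z = n%:R.
  rewrite /mxtrace (eq_bigr (fun=> 1)) => [|i _]; last by rewrite mxE eqxx.
  by rewrite sumr_const card_ord.
have ZZ : ip Z Z = n%:R * s%:R.
  rewrite ip_trace cluster_mx_tr cluster_mx_sq mxtraceZ trZ mulrC //.
have JZ : ip J Z = n%:R * s%:R.
  rewrite /ip (eq_bigr (fun=> s%:R)) => [|i _]; last first.
    by rewrite -(cluster_row_sum i); apply: eq_bigr => j _; rewrite mxE mul1r.
  by rewrite sumr_const card_ord mulr_natl.
have JY : ip J Y <= n%:R * s%:R.
  rewrite mulr_natl -[X in _ *+ X](card_ord n) -sumr_const; apply: ler_sum => i _.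
  by apply: le_trans (Ys i); apply: ler_sum => j _; rewrite mxE mul1r.
have pI M : ip p%:M M = p * \tr M.
  by rewrite ip_trace mul_scalar_mx mxtraceZ mxtrace_tr.
rewrite AE !ipBl !ipDl !ipZl !pI trZ Yt ZZ JZ.
have : ip W Z = ip W Y - ip W (Y - Z).
  by rewrite ipBr; ring.
move: IW; rewrite /gap; set a := ip W (Y - Z) => IW ->.
have := ler_wpM2l q0 JY.
lra.
Qed.

(** Without gap every column has all its mass, s, in its own cluster, and the inequalities 2 Y_ij <=
    Y_ii + Y_jj are tight inside clusters. Then e_i - e_j lies in the kernel of [Y], so rows i and j
    agree and the blocks are constant. *)
Lemma gap_eq0 Y : relaxation Y -> gap Y = 0 -> Y = Z.
Proof.
move=> Yr g0; have [Yp Y0 Ys Yt] := Yr.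
have im j : in_mass Y j = s%:R.
  move/eqP: g0; rewrite gapE psumr_eq0 => [/allP h|i _]; last by rewrite subr_ge0 in_mass_le.
  by apply/esym/eqP; rewrite -subr_eq0; apply: h; rewrite mem_index_enum.
have off i j : sigma i != sigma j -> Y i j = 0.
  move=> ij; have := relaxation_col j Yr.
  rewrite (bigID (fun i => sigma i == sigma j)) /= -/(in_mass Y j) im gerDl => h.
  have : \sum_(i | sigma i != sigma j) Y i j = 0.
    by apply/eqP; rewrite eq_le h sumr_ge0.
  by move/eqP; rewrite psumr_eq0 // => /allP/(_ i (mem_index_enum _))/implyP/(_ ij)/eqP.
(* The sum equals twice the gap, and each of its terms is nonnegative. *)
have pairs : \sum_i \sum_(j | sigma i == sigma j) (Y i i + Y j j - Y i j *+ 2) = 0.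
  have trs : \sum_i \sum_(j | sigma i == sigma j) Y i i = s%:R * n%:R.
    rewrite -Yt /mxtrace mulr_sumr; apply: eq_bigr => i _.
    rewrite sumr_const -[Y i i *+ _]mulr_natl -(card_cluster (sigma i)); congr (_%:R * _).
    by apply: eq_card => j; rewrite !inE eq_sym.
  have trs' : \sum_i \sum_(j | sigma i == sigma j) Y j j = s%:R * n%:R.
    rewrite -trs (exchange_big_dep xpredT) //=; apply: eq_bigr => i _.
    by apply: eq_bigl => j; rewrite eq_sym.
  under eq_bigr => i _ do rewrite sumrB big_split /= sumrMnl.
  rewrite sumrB big_split /= trs trs' sumrMnl.
  have -> : \sum_i \sum_(j | sigma i == sigma j) Y i j = ip Z Y.
    rewrite -sum_in_mass; rewrite (exchange_big_dep xpredT) //=.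
  by move: g0; rewrite /gap; set a := ip _ _; nra.
have pair0 i j : sigma i = sigma j -> Y i i + Y j j - Y i j *+ 2 = 0.
  move=> ij; have nn k l : 0 <= Y k k + Y l l - Y k l *+ 2.
    by rewrite subr_ge0 psd_offdiag_le.
  move/eqP: pairs; rewrite psumr_eq0 => [/allP/(_ i (mem_index_enum _))/=|k _]; last first.
    by apply: sumr_ge0 => l _; apply: nn.
  rewrite psumr_eq0 => [/allP/(_ j (mem_index_enum _))/implyP/(_ _)/eqP|l _]; last exact: nn.
  by apply; apply/eqP.
have const i j k : sigma i = sigma j -> Y i k = Y j k.
  move=> ij; have := @psd_kernel _ _ Y (delta_mx 0 i + (-1) *: delta_mx 0 j) Yp.
  rewrite psd_shift // -rowE !dot_delta_l !mxE => /(_ _)/matrixP/(_ 0 k).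
  rewrite mulmxDl -scalemxAl -!rowE !mxE => h.
  apply/eqP; rewrite -subr_eq0 -mulN1r; apply/eqP; apply: h.
  have YT : Y j i = Y i j by rewrite -[in LHS]Yp.1 mxE.
  by rewrite YT -(pair0 i j ij); ring.
apply/matrixP => i j; rewrite mxE; case: eqP => [ij|/eqP ij]; last exact: off.
have := im j; rewrite /in_mass (eq_bigr (fun=> Y i j)) => [|k /eqP kj]; last first.
  by apply: const; rewrite kj.
rewrite sumr_const (_ : #|_| = s); last first.
  by rewrite -(card_cluster (sigma j)); apply: eq_card => k; rewrite !inE.
have sn0 : s%:R != 0 :> R by rewrite gt_eqF ?sR_gt0.
rewrite -[Y i j *+ _]mulr_natl => /eqP; rewrite -[X in _ == X]mulr1 (inj_eq (mulfI sn0)).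
by move/eqP.
Qed.

Lemma certC_relaxation Y : certC s Y -> relaxation Y.
Proof.
move=> [Yp Y1 Y0 Ys]; split=> // [i|]; first by rewrite Ys.
by rewrite /mxtrace (eq_bigr (fun=> 1)) // sumr_const card_ord.
Qed.

Lemma certC_le1 Y i j : certC s Y -> Y i j <= 1.
Proof.
by move=> [Yp Y1 _ _]; have := psd_offdiag_le i j Yp; rewrite !Y1; lra.
Qed.

Lemma certC_l1norm Y : certC s Y -> l1norm (Y - Z) = 2 * gap Y.
Proof.
move=> Yc; have [Yp Y1 Y0 Ys] := Yc; rewrite /l1norm.
have -> : \sum_i \sum_j `|(Y - Z) i j| = \sum_i \sum_j (Y i j + Z i j - 2 * (Z i j * Y i j)).
  apply: eq_bigr => i _; apply: eq_bigr => j _; rewrite !mxE.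
  have h0 := Y0 i j; have h1 := certC_le1 i j Yc.
  case: eqP => _; rewrite ?mulr1n ?mulr0n.
    by rewrite distrC ger0_norm ?subr_ge0 //; lra.
  by rewrite subr0 ger0_norm //; lra.
under eq_bigr => i _ do rewrite sumrB big_split /= Ys cluster_row_sum -mulr_sumr.
rewrite sumrB sumr_const card_ord -mulr_sumr -/(ip Z Y) /gap -mulr_natl; ring.
Qed.

Lemma cluster_certC : certC s Z.
Proof.
split=> [|i|i j|i]; rewrite ?cluster_row_sum // ?mxE ?eqxx ?ler0n //.
apply: psd_intro => [|u]; first exact: cluster_mx_tr.
rewrite -(pmulr_rge0 _ sR_gt0) -dotZr scalemxAr -cluster_mx_sq mulmxA dotC.
by rewrite dot_mulmx cluster_mx_tr dot_ge0.
Qed.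

End Recovery.

(** * Compactness and existence of optima *)

Section FiniteCompactness.
Local Open Scope classical_set_scope.
Variables (R : realType) (I : finType).
Implicit Types (f g : (I -> R) -> R) (x y : I -> R).

Definition row_point (v : 'rV[R]_#|I|) : I -> R := fun i => v ord0 (enum_rank i).
Definition point_row x : 'rV[R]_#|I| := \row_j x (enum_val j).

Lemma point_rowK : cancel point_row row_point.
Proof. by move=> x; apply/funext => i; rewrite /row_point mxE enum_rankK. Qed.

(** Continuity is transported to row vectors, where closed subsets of a box are compact. *)
Definition fcontinuous f := continuous (f \o row_point).

Lemma fcontinuous_cst c : fcontinuous (fun=> c).
Proof. by move=> v; apply: (@cst_continuous _ _ c). Qed.

Lemma fcontinuous_coord i : fcontinuous (fun x => x i).
Proof. by move=> v; apply: (@coord_continuous R 1 #|I| ord0 (enum_rank i)). Qed.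

Lemma fcontinuousD f g : fcontinuous f -> fcontinuous g -> fcontinuous (fun x => f x + g x).
Proof. by move=> cf cg v; exact: (cvgD (cf v) (cg v)). Qed.

Lemma fcontinuousB f g : fcontinuous f -> fcontinuous g -> fcontinuous (fun x => f x - g x).
Proof. by move=> cf cg v; exact: (cvgB (cf v) (cg v)). Qed.

Lemma fcontinuousM f g : fcontinuous f -> fcontinuous g -> fcontinuous (fun x => f x * g x).
Proof. by move=> cf cg v; exact: (cvgM (cf v) (cg v)). Qed.

Lemma fcontinuous_sum (T : Type) (r : seq T) (P : pred T) (F : T -> (I -> R) -> R) :
  (forall t, fcontinuous (F t)) -> fcontinuous (fun x => \sum_(t <- r | P t) F t x).
Proof.
move=> cF; elim: r => [|t r IH].
  rewrite (_ : (fun x => _) = fun=> 0); first exact: fcontinuous_cst.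
  by apply/funext => x; rewrite big_nil.
rewrite (_ : (fun x => _) = fun x =>
    (if P t then F t x else 0) + \sum_(t <- r | P t) F t x).
  apply: fcontinuousD => //; case: (P t) => //; exact: fcontinuous_cst.
by apply/funext => x; rewrite big_cons; case: (P t); rewrite ?add0r.
Qed.

Lemma fcontinuous_max0 f : fcontinuous f -> fcontinuous (fun x => Num.max 0 (f x)).
Proof.
move=> cf; rewrite (_ : (fun x => _) = fun x => (f x + `|f x|) * 2^-1).
  apply: fcontinuousM; last exact: fcontinuous_cst.
  by apply: fcontinuousD => // v; exact: (cvg_norm (cf v)).
by apply/funext => x; rewrite maxEle; case: leP => h; [rewrite ger0_norm //; lra|rewrite ler0_norm ?ltW //; lra].
Qed.

(** The constraints form an arbitrary, possibly infinite set of functions, because positive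
    semidefiniteness is one inequality for every vector. *)
Lemma bounded_maximum (C : set ((I -> R) -> R)) f (B : R) :
  fcontinuous f -> (forall g, C g -> fcontinuous g) ->
  (exists x, forall g, C g -> 0 <= g x) ->
  (forall x, (forall g, C g -> 0 <= g x) -> forall i, `|x i| <= B) ->
  exists x, (forall g, C g -> 0 <= g x) /\
    forall y, (forall g, C g -> 0 <= g y) -> f y <= f x.
Proof.
move=> cf cC [x0 x0C] CB.
pose A : set 'rV[R]_#|I| := [set v | forall g, C g -> 0 <= g (row_point v)].
have Acl : closed A.
  rewrite (_ : A = \bigcap_(g in C) (g \o row_point) @^-1` [set r | 0 <= r]).
    apply: closed_bigI => g Cg; apply: preimage_closed; last exact: closed_ge.
    by move=> v _; exact: cC.
  by apply/seteqP; split=> v hv g; apply: hv.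
have Ac : compact A.
  pose box := [set v : 'rV[R]_#|I| | forall i, `[- B, B]%classic (v ord0 i)].
  apply: (@subclosed_compact _ _ box) => //.
    by apply: (@rV_compact R #|I| (fun=> `[- B, B]%classic)) => i; apply: segment_compact.
  move=> v Av i /=; have := CB _ Av (enum_val i).
  by rewrite /row_point enum_valK in_itv /= -ler_norml.
have A0 : A !=set0 by exists (point_row x0) => g Cg; rewrite /= point_rowK; exact: x0C.
have [|c cA hc] := compact_EVT_max (f := f \o row_point) A0 Ac.
  by apply: continuous_subspaceT.
exists (row_point c); split; first by move: cA; rewrite inE.
move=> y yC; rewrite -[y]point_rowK; apply: hc.
by rewrite inE => g Cg; rewrite point_rowK; exact: yC.
Qed.

End FiniteCompactness.

Section SdpOptimum.
Local Open Scope classical_set_scope.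
Variable R : realType.
Implicit Types (P : sdp R).

Lemma linformE P M w (y : sdp_point P) :
  linform M w y = \sum_i \sum_j M i j * y.1 i j + \sum_v w v * y.2 v.
Proof.
congr (_ + _); apply: eq_bigr => i _; rewrite mxE; apply: eq_bigr => j _.
by rewrite mxE.
Qed.

(** [exact_oracle] promises an optimal point only where one exists; this supplies it for the score
    and certificate programs. *)
Lemma sdp_optimum_exists P (B : R) :
  (exists y : sdp_point P, sdp_feasible y) ->
  (forall y : sdp_point P, sdp_feasible y ->
     (forall i j, `|y.1 i j| <= B) /\ (forall v, `|y.2 v| <= B)) ->
  exists y : sdp_point P, sdp_optimal y.
Proof.
move=> [y0 y0F] FB.
pose I := ('I_(sdim P) * 'I_(sdim P) + svar P)%type.
pose dec (x : I -> R) : sdp_point P := (\matrix_(i, j) x (inl (i, j)), fun v => x (inr v)).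
pose enc (y : sdp_point P) : I -> R :=
  fun k => match k with inl p => y.1 p.1 p.2 | inr v => y.2 v end.
have encK : cancel enc dec.
  move=> [Y v]; congr pair; apply/matrixP => i j; by rewrite mxE.
pose quad (u : 'rV[R]_(sdim P)) (x : I -> R) := \sum_j \sum_i u 0 i * x (inl (i, j)) * u 0 j.
pose C : set ((I -> R) -> R) := [set g |
  [\/ exists i j, g = fun x => x (inl (i, j)) - x (inl (j, i)),
      exists u, g = quad u |
      exists2 c, c \in scons P & g = fun x => c.2 - linform c.1.1 c.1.2 (dec x)]].
have lc M w : fcontinuous (fun x : I -> R => linform M w (dec x)).
  under eq_fun => x do rewrite linformE.
  apply: fcontinuousD; apply: fcontinuous_sum => i; last first.
    by apply: fcontinuousM; [exact: fcontinuous_cst|exact: fcontinuous_coord].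
  apply: fcontinuous_sum => j; apply: fcontinuousM; first exact: fcontinuous_cst.
  by under eq_fun => x do rewrite mxE; exact: fcontinuous_coord.
have CF x : (forall g, C g -> 0 <= g x) <-> sdp_feasible (dec x).
  have qE u : quad u x = (u *m (dec x).1 *m u^T) 0 0.
    rewrite mxE; apply: eq_bigr => j _; rewrite !mxE mulr_suml; apply: eq_bigr => i _.
    by rewrite mxE.
  split=> [h|[[YT Y0] /allP cs] g].
    split; first split.
    - apply/matrixP => i j; rewrite !mxE; apply/eqP; rewrite eq_le.
      have h1 : 0 <= x (inl (i, j)) - x (inl (j, i)).
        by apply: (h (fun x => _ - _)); constructor 1; exists i, j.
      have h2 : 0 <= x (inl (j, i)) - x (inl (i, j)).
        by apply: (h (fun x => _ - _)); constructor 1; exists j, i.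
      by apply/andP; split; lra.
    - by move=> u; rewrite -qE; apply: h; constructor 2; exists u.
    apply/allP => c cs; rewrite -subr_ge0.
    by apply: (h (fun x => c.2 - linform c.1.1 c.1.2 (dec x))); constructor 3; exists c.
  move=> [[i [j ->]]|[u ->]|[c /cs c2 ->]]; last by rewrite subr_ge0.
    by move/matrixP/(_ j i): YT; rewrite !mxE => ->; rewrite subrr.
  by rewrite qE.
have cC g : C g -> fcontinuous g.
  move=> [[i [j ->]]|[u ->]|[c _ ->]].
  - by apply: fcontinuousB; exact: fcontinuous_coord.
  - apply: fcontinuous_sum => j; apply: fcontinuous_sum => i.
    apply: fcontinuousM; last exact: fcontinuous_cst.
    by apply: fcontinuousM; [exact: fcontinuous_cst|exact: fcontinuous_coord].
  - by apply: fcontinuousB; [exact: fcontinuous_cst|exact: lc].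
have [||x [/CF xF xmax]] := bounded_maximum (f := fun x => sdp_value (dec x)) (B := B) (lc _ _) cC.
- by exists (enc y0); apply/CF; rewrite encK.
- move=> x /CF/FB[h1 h2] [[i j]|v]; last exact: h2.
  by have := h1 i j; rewrite mxE.
exists (dec x); split=> // y yF; rewrite -[y]encK; apply: xmax.
by apply/CF; rewrite encK.
Qed.

End SdpOptimum.

(** * Linear programming duality for the score *)

Section ScoreDuality.
Local Open Scope classical_set_scope.
Variables (R : realType) (n : nat) (A : graph n) (D : R) (Y : 'M[R]_n).
Hypotheses (D0 : 0 < D) (Y0 : forall i j, 0 <= Y i j).
Implicit Types (u : 'I_n * 'I_n -> R) (q : 'I_n -> R) (z : 'I_n -> 'I_n -> R).

Definition cover_value q z : R :=
  \sum_(i < n) \sum_(j < n | edge A i j) z i j * Y i j + D * \sum_(i < n) q i.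

Definition load u (i : 'I_n) : R := \sum_p ((p.1 == i)%:R + (p.2 == i)%:R) * u p.

Definition cap (p : 'I_n * 'I_n) : R := if edge A p.1 p.2 then Y p.1 p.2 else 0.

(** The dual of the covering program: a fractional edge packing with edge capacities Y_ij and a
    budget D at every vertex. *)
Definition packing u : Prop :=
  (forall p, 0 <= u p <= cap p) /\ (forall i, load u i <= D).

Lemma cap_ge0 p : 0 <= cap p.
Proof. by rewrite /cap; case: ifP. Qed.

Lemma sum_load (q : 'I_n -> R) u : \sum_i q i * load u i = \sum_p (q p.1 + q p.2) * u p.
Proof.
under eq_bigr => i _ do rewrite mulr_sumr.
rewrite exchange_big /=; apply: eq_bigr => p _.
under eq_bigr => i _ do rewrite mulrA.
rewrite -mulr_suml; congr (_ * _).
under eq_bigr => i _ do rewrite mulrDr.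
rewrite big_split /=; congr (_ + _).
  rewrite (bigD1 p.1) //= eqxx mulr1 big1 ?addr0 // => i /negbTE ip.
  by rewrite eq_sym ip mulr0.
rewrite (bigD1 p.2) //= eqxx mulr1 big1 ?addr0 // => i /negbTE ip.
by rewrite eq_sym ip mulr0.
Qed.

Lemma cover_valueE q z :
  cover_value q z = \sum_p z p.1 p.2 * cap p + D * \sum_i q i.
Proof.
congr (_ + _); rewrite pair_big_dep big_mkcond /=; apply: eq_bigr => p _.
by rewrite /cap; case: ifP; rewrite ?mulr0.
Qed.

(** Weak duality: multiply 1 <= z_ij + q_i + q_j by u_ij and sum over the edges. *)
Lemma packing_le_cover u q z : packing u -> lp_feasible A q z ->
  \sum_p u p <= cover_value q z.
Proof.
move=> [u0 ul] [q01 hz]; rewrite cover_valueE.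
apply: (@le_trans _ _ (\sum_p (z p.1 p.2 * u p + (q p.1 + q p.2) * u p))).
  apply: ler_sum => p _; have /andP[up0 uc] := u0 p.
  case: (boolP (edge A p.1 p.2)) => e.
    have [_ h] := hz _ _ e; rewrite -mulrDl -[leLHS]mul1r ler_wpM2r //; lra.
  have -> : u p = 0 by apply/eqP; rewrite eq_le up0 andbT; move: uc; rewrite /cap (negbTE e).
  by rewrite !mulr0 addr0.
rewrite big_split -sum_load; apply: lerD.
  apply: ler_sum => p _; have /andP[up0 uc] := u0 p.
  case: (boolP (edge A p.1 p.2)) => e.
    by have [/andP[h _] _] := hz _ _ e; rewrite ler_wpM2l.
  by move: uc up0; rewrite /cap (negbTE e) => h1 h2; rewrite (_ : u p = 0) ?mulr0 //; lra.
rewrite mulr_sumr; apply: ler_sum => i _; rewrite mulrC ler_wpM2r //.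
by have /andP[] := q01 i.
Qed.

Lemma Hscore_le q z : lp_feasible A q z -> Hscore A D Y <= cover_value q z.
Proof.
move=> h; apply: ge_inf; last by exists q, z.
exists 0 => _ [q' [z' [[q01 hz] ->]]]; rewrite addr_ge0 //.
  apply: sumr_ge0 => i _; apply: sumr_ge0 => j e; rewrite mulr_ge0 //.
  by have [/andP[]] := hz _ _ e.
rewrite mulr_ge0 ?(ltW D0) // sumr_ge0 // => i _; by have /andP[] := q01 i.
Qed.

Lemma lp_feasible_one : lp_feasible A (fun=> 1 : R) (fun _ _ => 1).
Proof.
split=> [i|i j _]; first by rewrite lexx ler01.
by rewrite lexx ler01; split=> //; lra.
Qed.

Lemma Hscore_ge x : (forall q z, lp_feasible A q z -> x <= cover_value q z) ->
  x <= Hscore A D Y.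
Proof.
move=> h; apply: lb_le_inf.
  by exists (cover_value (fun=> 1) (fun _ _ => 1)), (fun=> 1), (fun _ _ => 1); split => //; exact: lp_feasible_one.
by move=> _ [q [z [f ->]]]; apply: h.
Qed.

(** The squared positive part lies below its expansion at x with quadratic term t ^ 2; this yields
    first-order conditions without differentiating. *)
Lemma sqr_pos_part (x t : R) :
  Num.max 0 (x + t) ^+ 2 <= Num.max 0 x ^+ 2 + 2 * t * Num.max 0 x + t ^+ 2.
Proof.
rewrite !maxEle; case: (leP 0 (x + t)) => h1; case: (leP 0 x) => h2.
- lra.
- have p1 : 0 <= - x * (x + t) by rewrite mulr_ge0 //; lra.
  nra.
- by have := sqr_ge0 (x + t); nra.
- by have := sqr_ge0 t; lra.
Qed.

Lemma le0_of_small (x T c : R) : 0 < T -> 0 < c ->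
  (forall t, 0 < t <= T -> x <= c * t) -> x <= 0.
Proof.
move=> T0 c0 h; rewrite leNgt; apply/negP => x0.
have xc : 0 < x / c / 2 by rewrite !divr_gt0.
have := h (Num.min T (x / c / 2)); rewrite lt_min T0 xc ge_min lexx => /(_ isT).
have : c * Num.min T (x / c / 2) <= c * (x / c / 2).
  by rewrite ler_wpM2l ?(ltW c0) // ge_min lexx orbT.
have -> : c * (x / c / 2) = x / 2 by field; rewrite gt_eqF.
by lra.
Qed.

(* Maximize sum u - (1 / 2 delta) sum_i (load_i - D)_+ ^ 2 over the box; the
   multipliers q_i = (load_i - D)_+ / delta form a cover by the first-order
   conditions, and the loads exceed D by at most delta. *)
Lemma approximate_packing (delta : R) : 0 < delta ->
  exists2 u, packing u & Hscore A D Y * (D / (D + delta)) <= \sum_p u p.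
Proof.
move=> d0.
pose I := ('I_n * 'I_n)%type.
pose over u i := Num.max 0 (load u i - D).
pose g u := \sum_p u p - (2 * delta)^-1 * \sum_i over u i ^+ 2.
pose C : set (((I -> R) -> R)) := [set f | exists p, f = (fun u => u p) \/ f = (fun u => cap p - u p)].
have cl i : fcontinuous (fun u : I -> R => load u i).
  apply: fcontinuous_sum => p; apply: fcontinuousM; last exact: fcontinuous_coord.
  exact: fcontinuous_cst.
have cg : fcontinuous g.
  apply: fcontinuousB; first by apply: fcontinuous_sum => p; exact: fcontinuous_coord.
  apply: fcontinuousM; first exact: fcontinuous_cst.
  apply: fcontinuous_sum => i; apply: fcontinuousM; apply: fcontinuous_max0;
    by apply: fcontinuousB => //; exact: fcontinuous_cst.
have CP u : (forall f, C f -> 0 <= f u) <-> (forall p, 0 <= u p <= cap p).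
  split=> [h p|h f [p [->|->]]].
  - apply/andP; split; first by apply: (h (fun u => u p)); exists p; left.
    by rewrite -subr_ge0; apply: (h (fun u => cap p - u p)); exists p; right.
  - by have /andP[] := h p.
  - by have /andP[_ ?] := h p; rewrite subr_ge0.
have [|||u [/CP u0 umax]] := @bounded_maximum R I C g (\sum_p cap p) cg.
- move=> f [p [->|->]]; first exact: fcontinuous_coord.
  by apply: fcontinuousB; [exact: fcontinuous_cst|exact: fcontinuous_coord].
- by exists (fun=> 0); apply/CP => p; rewrite lexx cap_ge0.
- move=> v /CP v0 p; have /andP[h1 h2] := v0 p; rewrite ger0_norm //.
  by apply: (le_trans h2); rewrite (bigD1 p) //= lerDl sumr_ge0 // => k _; apply: cap_ge0.
pose q i := over u i / delta.
have q0 i : 0 <= q i by rewrite divr_ge0 ?(ltW d0) // /over le_max lexx.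
(* First-order condition in the direction of the coordinate p. *)
have foc p : exists2 c, 0 < c & forall t, 0 <= u p + t <= cap p ->
    t * (1 - q p.1 - q p.2) <= c * t ^+ 2.
  pose a i : R := (p.1 == i)%:R + (p.2 == i)%:R.
  exists ((2 * delta)^-1 * (1 + \sum_i a i ^+ 2)).
    by rewrite mulr_gt0 ?invr_gt0 ?mulr_gt0 // ltr_wpDr // sumr_ge0 // => i _; apply: sqr_ge0.
  move=> t ht; pose v k := u k + (if k == p then t else 0).
  have lv i : load v i = load u i + t * a i.
    rewrite /load /v; under eq_bigr => k _ do rewrite mulrDr.
    rewrite big_split /=; congr (_ + _); rewrite (bigD1 p) //= eqxx big1 ?addr0 1?mulrC //.
    by move=> k /negbTE ->; rewrite mulr0.
  have /(umax v) : forall f, C f -> 0 <= f v.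
    by apply/CP => k; rewrite /v; case: eqP => [->|_] //; rewrite addr0.
  have sv : \sum_k v k = \sum_k u k + t.
    rewrite /v big_split /=; congr (_ + _); rewrite (bigD1 p) //= eqxx big1 ?addr0 //.
    by move=> k /negbTE ->.
  have ov : \sum_i over v i ^+ 2 <=
      \sum_i over u i ^+ 2 + 2 * t * delta * (q p.1 + q p.2) + t ^+ 2 * \sum_i a i ^+ 2.
    apply: (@le_trans _ _ (\sum_i (over u i ^+ 2 + 2 * (t * a i) * over u i + (t * a i) ^+ 2))).
      apply: ler_sum => i _; rewrite /over lv addrAC; exact: sqr_pos_part.
    rewrite !big_split /=; apply: lerD; last first.
      by rewrite mulr_sumr; apply: ler_sum => i _; rewrite exprMn.
    apply: lerD => //.
    have -> : q p.1 + q p.2 = \sum_i a i * q i.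
      rewrite /a; under eq_bigr => i _ do rewrite mulrDl.
      rewrite big_split /=; congr (_ + _).
        rewrite (bigD1 p.1) //= eqxx mul1r big1 ?addr0 // => i /negbTE ip.
        by rewrite eq_sym ip mul0r.
      rewrite (bigD1 p.2) //= eqxx mul1r big1 ?addr0 // => i /negbTE ip.
      by rewrite eq_sym ip mul0r.
    rewrite mulr_sumr; apply: ler_sum => i _; rewrite /q le_eqVlt; apply/orP; left; apply/eqP.
    by field; rewrite gt_eqF.
  rewrite /g sv => h.
  have d2 : 0 < (2 * delta)^-1 by rewrite invr_gt0 mulr_gt0.
  have := ler_wpM2l (ltW d2) ov; rewrite !mulrDr.
  have -> : (2 * delta)^-1 * (2 * t * delta * q p.1) = t * q p.1 by field; rewrite gt_eqF.
  have -> : (2 * delta)^-1 * (2 * t * delta * q p.2) = t * q p.2 by field; rewrite gt_eqF.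
  have : 0 <= (2 * delta)^-1 * t ^+ 2 by rewrite mulr_ge0 ?sqr_ge0 ?(ltW d2).
  move: h; set S := \sum_i _ ^+ 2; set S' := \sum_i _ ^+ 2; set S'' := \sum_i _ ^+ 2.
  by lra.
have foc1 p : u p < cap p -> 1 - q p.1 - q p.2 <= 0.
  move=> up; have [c c0 hc] := foc p; have up' : 0 < cap p - u p by rewrite subr_gt0.
  apply: (le0_of_small up' c0) => t /andP[t0 tT].
  have /hc : 0 <= u p + t <= cap p.
    by have /andP[? _] := u0 p; apply/andP; split; lra.
  by rewrite expr2 mulrCA ler_pM2l.
have foc2 p : 0 < u p -> 0 <= 1 - q p.1 - q p.2.
  move=> up; have [c c0 hc] := foc p; rewrite -oppr_le0.
  apply: (le0_of_small up c0) => t /andP[t0 tT].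
  have /hc : 0 <= u p + (- t) <= cap p.
    by have /andP[_ ?] := u0 p; apply/andP; split; lra.
  by rewrite sqrrN expr2 mulNr -mulrN mulrCA ler_pM2l.
(* If q_i > 1, the first-order conditions force u to vanish on all pairs at i; the load at i is then
   0, and so is q_i. *)
have q1 i : q i <= 1.
  rewrite leNgt; apply/negP => qi.
  have l0 : load u i = 0.
    rewrite /load big1 // => p _; case: (ltgtP (u p) 0) => [|up|->]; rewrite ?mulr0 //.
      by have /andP[+ _] := u0 p; rewrite leNgt => /negP.
    have := foc2 p up; have := q0 p.1; have := q0 p.2.
    case: (eqVneq p.1 i) => [->|_]; first by lra.
    case: (eqVneq p.2 i) => [->|_]; first by lra.
    by rewrite addr0 mul0r.
  move: qi; rewrite /q /over l0 sub0r max_l ?mul0r ?ltr10 //.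
  by rewrite oppr_le0 ltW.
pose z i j := Num.max 0 (1 - q i - q j).
have fz : lp_feasible A q z.
  split=> [i|i j _]; first by rewrite q0 q1.
  by rewrite /z le_max lexx ge_max ler01 le_max lexx orbT; split=> //; have := q0 i; have := q0 j; lra.
have lD i : load u i <= D + delta.
  have : q i * delta <= delta by rewrite ler_piMl ?(ltW d0).
  rewrite /q mulfVK ?gt_eqF // /over.
  have : load u i - D <= Num.max 0 (load u i - D) by rewrite le_max lexx orbT.
  by lra.
have Du : 0 < D / (D + delta) by rewrite divr_gt0 // addr_gt0.
have Du1 : D / (D + delta) <= 1 by rewrite ler_pdivrMr ?addr_gt0 //; lra.
(* The loads of u are at most D + delta, and this scaling brings them down to D. *)
exists (fun p => u p * (D / (D + delta))).
  split=> [p|i].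
    have /andP[h1 h2] := u0 p; rewrite mulr_ge0 ?(ltW Du) //=.
    by apply: le_trans h2; rewrite ler_piMr.
  rewrite /load; under eq_bigr => p _ do rewrite mulrA.
  rewrite -mulr_suml -/(load u i) mulrA ler_pdivrMr ?addr_gt0 // mulrC ler_wpM2l // ltW //.
rewrite -mulr_suml ler_wpM2r ?(ltW Du) //.
apply: (le_trans (Hscore_le fz)); rewrite cover_valueE.
(* Complementary slackness: u is at capacity where 1 - q_i - q_j is positive, and zero where it is
   negative. *)
have -> : \sum_p z p.1 p.2 * cap p = \sum_p (1 - q p.1 - q p.2) * u p.
  apply: eq_bigr => p _; rewrite /z; have /andP[h1 h2] := u0 p.
  case: (ltgtP (1 - q p.1 - q p.2) 0) => [h|h|->].
  - rewrite mul0r; case: (ltgtP (u p) 0) => [|up|->]; rewrite ?mulr0 //.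
      by move=> h3; lra.
    by have := foc2 p up; lra.
  - congr (_ * _); case: (ltgtP (u p) (cap p)) => // hp.
      by have := foc1 p hp; lra.
    by lra.
  - by rewrite !mul0r.
have -> : \sum_p (1 - q p.1 - q p.2) * u p = \sum_p u p - \sum_i q i * load u i.
  rewrite sum_load -sumrB; apply: eq_bigr => p _; ring.
rewrite -addrA gerDl addrC subr_le0 mulr_sumr; apply: ler_sum => i _.
case: (leP (load u i - D) 0) => h.
  by rewrite /q /over max_l // !mul0r mulr0.
by rewrite mulrC ler_wpM2l // -subr_ge0 ltW.
Qed.

End ScoreDuality.

Section ExactDuality.
Local Open Scope classical_set_scope.
Variables (R : realType) (n : nat) (A : graph n) (D : R) (Y : 'M[R]_n).
Hypotheses (D0 : 0 < D) (Y0 : forall i j, 0 <= Y i j).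
Implicit Types (u : 'I_n * 'I_n -> R).

(** A largest packing exists by compactness and dominates the approximate ones for every delta,
    which gives strong duality in the limit. *)
Lemma exact_packing : exists2 u, packing A D Y u & \sum_p u p = Hscore A D Y.
Proof.
pose I := ('I_n * 'I_n)%type.
pose C : set ((I -> R) -> R) := [set f |
  [\/ exists p, f = (fun u => u p), exists p, f = (fun u => cap A Y p - u p) |
      exists i, f = (fun u => D - load u i)]].
have cl i : fcontinuous (fun u : I -> R => load u i).
  apply: fcontinuous_sum => p; apply: fcontinuousM; last exact: fcontinuous_coord.
  exact: fcontinuous_cst.
have CP u : (forall f, C f -> 0 <= f u) <-> packing A D Y u.
  split=> [h|[u0 ul] f [[p ->]|[p ->]|[i ->]]].
  - split=> [p|i].
      apply/andP; split; first by apply: (h (fun u => u p)); constructor 1; exists p.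
      by rewrite -subr_ge0; apply: (h (fun u => _ - u p)); constructor 2; exists p.
    by rewrite -subr_ge0; apply: (h (fun u => _ - load u i)); constructor 3; exists i.
  - by have /andP[] := u0 p.
  - by rewrite subr_ge0; have /andP[] := u0 p.
  - by rewrite subr_ge0.
have cs : fcontinuous (fun u : I -> R => \sum_p u p).
  by apply: fcontinuous_sum => p; exact: fcontinuous_coord.
have [|||u [/CP uP umax]] := @bounded_maximum R I C _ (\sum_p cap A Y p) cs.
- move=> f [[p ->]|[p ->]|[i ->]]; first exact: fcontinuous_coord.
    by apply: fcontinuousB; [exact: fcontinuous_cst|exact: fcontinuous_coord].
  by apply: fcontinuousB => //; exact: fcontinuous_cst.
- exists (fun=> 0); apply/CP; split=> [p|i]; first by rewrite lexx cap_ge0.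
  by rewrite /load big1 ?ltW // => p _; rewrite mulr0.
- move=> v /CP[v0 _] p; have /andP[h1 h2] := v0 p; rewrite ger0_norm //.
  by apply: (le_trans h2); rewrite (bigD1 p) //= lerDl sumr_ge0 // => k _; apply: cap_ge0.
exists u => //; apply/eqP; rewrite eq_le; apply/andP; split.
  by apply: Hscore_ge => q z; apply: packing_le_cover.
set S := \sum_p u p; set H := Hscore A D Y.
have S0 : 0 <= S by apply: sumr_ge0 => p _; have /andP[] := uP.1 p.
rewrite -(ler_pM2r D0); apply/ler_addgt0Pr => e e0.
(* From H D <= S (D + delta), this delta costs at most e. *)
have d0 : 0 < e / (S + 1) by rewrite divr_gt0 // ltr_wpDl.
have [v vP hv] := approximate_packing A D0 Y0 d0.
have := le_trans hv (umax v ((CP v).2 vP)).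
rewrite mulrA ler_pdivrMr ?addr_gt0 // => /le_trans; apply.
rewrite mulrDr lerD2l mulrCA ler_piMr ?(ltW e0) // ler_pdivrMr ?ltr_wpDl //.
by rewrite mul1r lerDl.
Qed.

End ExactDuality.

(** * Correctness of the score and certificate programs *)

Lemma mem_Finite_enum (T : finType) (x : T) : x \in Finite.enum T.
Proof. by rewrite -has_pred1 has_count enumP. Qed.

Section ScoreProgram.
Local Open Scope classical_set_scope.
Variables (R : realType) (n : nat) (A : graph n) (D : R) (Y : 'M[R]_n).
Hypotheses (D0 : 0 < D) (Y0 : forall i j, 0 <= Y i j).

Lemma linform0 (P : sdp R) w (y : sdp_point P) : linform 0 w y = \sum_v w v * y.2 v.
Proof. by rewrite /linform mul0mx mxtrace0 add0r. Qed.

Lemma sum_unit (I : finType) (x : I) (f : I -> R) : \sum_v (v == x)%:R * f v = f x.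
Proof.
rewrite (bigD1 x) //= eqxx mul1r big1 ?addr0 // => v /negbTE ->.
by rewrite mul0r.
Qed.

Local Notation P := (score_lp A D Y).

Lemma score_lp_feasibleP (y : sdp_point P) : sdp_feasible y <->
  (forall x, 0 <= y.2 x <= 1) /\
  (forall p, edge A p.1 p.2 -> 1 - y.2 (inl p.1) - y.2 (inl p.2) <= y.2 (inr p)).
Proof.
rewrite /sdp_feasible /= !all_cat !all_map.
have un x : linform (P := P) 0 (fun v => (v == x)%:R) y = y.2 x.
  by rewrite linform0 sum_unit.
have unN x : linform (P := P) 0 (fun v => - (v == x)%:R) y = - y.2 x.
  by rewrite linform0 -{1}(sum_unit x) -sumrN; apply: eq_bigr => v _; rewrite mulNr.
have cv p : linform (P := P) 0 (fun v => - (v == inl p.1)%:R - (v == inl p.2)%:R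
                       - (v == inr p)%:R) y
    = - y.2 (inl p.1) - y.2 (inl p.2) - y.2 (inr p).
  rewrite linform0; under eq_bigr => v _ do rewrite !mulrBl mulNr.
  by rewrite !sumrB sumrN !sum_unit.
split=> [[_ /and3P[/allP h1 /allP h2 /allP h3]]|[h1 h2]].
  split=> [x|p e].
    have := h1 x (mem_Finite_enum x); have := h2 x (mem_Finite_enum x).
    by rewrite /= unN un oppr_le0 => -> ->.
  have := h3 p; rewrite mem_filter e mem_enum => /(_ isT) /=; rewrite cv; lra.
split.
  split=> [|u]; first by apply/matrixP => - [].
  by rewrite mxE big_ord0.
apply/and3P; split; apply/allP => x.
- by move=> _ /=; rewrite unN oppr_le0; have /andP[] := h1 x.
- by move=> _ /=; rewrite un; have /andP[] := h1 x.
- by rewrite mem_filter => /andP[e _] /=; rewrite cv; have := h2 x e; lra.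
Qed.

Lemma score_lp_value (y : sdp_point P) :
  sdp_value y = - cover_value A D Y (fun i => y.2 (inl i)) (fun i j => y.2 (inr (i, j))).
Proof.
rewrite /sdp_value linform0 /= big_sumType /= cover_valueE opprD addrC; congr (_ + _).
  rewrite -sumrN; apply: eq_bigr => -[i j] _; rewrite /cap /=.
  by case: ifP; rewrite ?mulr0 ?mul0r ?oppr0 // mulNr mulrC.
by rewrite mulr_sumr -sumrN; apply: eq_bigr => i _; rewrite mulNr.
Qed.

Lemma score_lp_correct (slv : forall P : sdp R, sdp_point P) : exact_oracle slv ->
  - sdp_value (slv P) = Hscore A D Y.
Proof.
move=> ex; have [|yF ymax] := ex P.
  apply: (@sdp_optimum_exists R P 1).
    exists (0, fun=> 1); apply/score_lp_feasibleP; split=> [x|p _] /=.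
      by rewrite ler01 lexx.
    lra.
  move=> y /score_lp_feasibleP[h _]; split=> [[]//|v].
  by have /andP[? ?] := h v; rewrite ger0_norm.
rewrite score_lp_value opprK; move: yF ymax; set y := slv P => /score_lp_feasibleP[y1 y2] ymax.
apply/eqP; rewrite eq_le; apply/andP; split; last first.
  apply: Hscore_le => //; split=> [i|i j e]; first exact: y1.
  by split; [exact: y1|exact: (y2 (i, j))].
apply: Hscore_ge => q z [q01 hz].
(* [lp_feasible] leaves z free off the edges, while the program confines every variable to [0, 1];
   so z is replaced by 0 there. *)
pose y' : sdp_point P := (0, fun v => match v with inl i => q i
   | inr p => if edge A p.1 p.2 then z p.1 p.2 else 0 end).
have : sdp_feasible y'.
  apply/score_lp_feasibleP; split=> [[i|p]|p e] /=; first exact: q01.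
    by case: ifP => [/hz[]//|_]; rewrite lexx ler01.
  by rewrite e; have [] := hz _ _ e.
move=> /ymax; rewrite !score_lp_value lerN2 => /le_trans; apply.
rewrite /cover_value lerD2r; apply: ler_sum => i _; apply: ler_sum => j e /=.
by rewrite e.
Qed.

End ScoreProgram.

Section CertificateProgram.
Local Open Scope classical_set_scope.
Variables (R : realType) (n K : nat) (A : graph n) (sigma : labeling n K).
Variables (D lam theta : R).
Hypotheses (D0 : 0 < D) (n0 : (0 < n)%N) (K0 : (0 < K)%N) (Kn : (K %| n)%N).
Hypothesis bal : balanced sigma.

Local Notation s := (n %/ K)%N.
Local Notation Z := (cluster_mx R sigma).
Local Notation P := (certificate_sdp s A D lam theta Z).

Lemma linform_ip (Q : sdp R) M w (y : sdp_point Q) :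
  linform M w y = ip M y.1 + \sum_v w v * y.2 v.
Proof. by rewrite linformE. Qed.

Lemma ip_delta i j (Y : 'M[R]_n) : ip (delta_mx i j) Y = Y i j.
Proof.
rewrite /ip (bigD1 i) //= [X in _ + X]big1 => [|k ki]; last first.
  by rewrite big1 // => l _; rewrite mxE (negbTE ki) mul0r.
rewrite addr0 (bigD1 j) //= [X in _ + X]big1 => [|l lj]; last first.
  by rewrite mxE (negbTE lj) andbF mul0r.
by rewrite addr0 mxE !eqxx mul1r.
Qed.

Lemma ip_row_mx1 i (Y : 'M[R]_n) : ip (row_mx1 R i) Y = \sum_j Y i j.
Proof.
rewrite /ip (bigD1 i) //= [X in _ + X]big1 => [|k ki]; last first.
  by rewrite big1 // => l _; rewrite mxE (negbTE ki) mul0r.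
by rewrite addr0; apply: eq_bigr => j _; rewrite mxE eqxx mul1r.
Qed.

Lemma ip0l (Y : 'M[R]_n) : ip 0 Y = 0.
Proof. by rewrite ip_trace mul0mx mxtrace0. Qed.

Lemma ipNl (M Y : 'M[R]_n) : ip (- M) Y = - ip M Y.
Proof. by rewrite -sub0r ipBl ip0l sub0r. Qed.

Lemma certificate_feasibleP (y : sdp_point P) : sdp_feasible y <->
  certC s y.1 /\ packing A D y.1 y.2.
Proof.
have lf M w : linform (P := P) M w y = ip M y.1 + \sum_v w v * y.2 v.
  exact: linform_ip.
have w0 : \sum_(v : 'I_n * 'I_n) 0 * y.2 v = 0.
  by rewrite big1 // => v _; rewrite mul0r.
have wN0 : \sum_(v : 'I_n * 'I_n) - 0 * y.2 v = 0.
  by rewrite big1 // => v _; rewrite oppr0 mul0r.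
have un x : \sum_(v : 'I_n * 'I_n) (v == x)%:R * y.2 v = y.2 x by rewrite sum_unit.
have unN x : \sum_(v : 'I_n * 'I_n) - (v == x)%:R * y.2 v = - y.2 x.
  by rewrite -[in RHS](sum_unit x) -sumrN; apply: eq_bigr => v _; rewrite mulNr.
have capE x : ip (if edge A x.1 x.2 then - delta_mx x.1 x.2 else 0) y.1 = - cap A y.1 x.
  by rewrite /cap; case: ifP; rewrite ?ipNl ?ip_delta ?ip0l ?oppr0.
rewrite /sdp_feasible.
rewrite /certificate_sdp; cbn [scons sdim svar].
rewrite !all_cat.
split.
  move=> [Yp /andP[/allP h1 /andP[/allP h2 /andP[/allP h3 /andP[/allP h4 /andP[/allP h5 /allP h6]]]]]].
  have d1 i : y.1 i i = 1.
    apply/eqP; rewrite eq_le; apply/andP; split.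
      have := h1 (delta_mx i i, (fun=> 0), 1); rewrite lf w0 addr0 ip_delta; apply.
      apply/flatten_mapP; exists i; rewrite ?mem_enum // inE eqxx //.
    have := h1 (- delta_mx i i, (fun=> - 0), -1); rewrite lf wN0 addr0 ipNl ip_delta lerN2; apply.
    by apply/flatten_mapP; exists i; rewrite ?mem_enum // !inE eqxx orbT.
  have d2 i : \sum_j y.1 i j = s%:R.
    apply/eqP; rewrite eq_le; apply/andP; split.
      have := h2 (row_mx1 R i, (fun=> 0), s%:R); rewrite lf w0 addr0 ip_row_mx1; apply.
      by apply/flatten_mapP; exists i; rewrite ?mem_enum // inE eqxx.
    have := h2 (- row_mx1 R i, (fun=> - 0), - s%:R).
    rewrite lf wN0 addr0 ipNl ip_row_mx1 lerN2; apply.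
    by apply/flatten_mapP; exists i; rewrite ?mem_enum // !inE eqxx orbT.
  split; split => //.
  - move=> i j; have := h3 (- delta_mx i j, (fun=> 0), 0).
    rewrite lf w0 addr0 ipNl ip_delta oppr_le0; apply.
    by apply/allpairsP; exists (i, j); rewrite !mem_enum.
  - move=> x; have h5x := h5 (_, (fun v => (v == x)%:R), 0) (map_f _ (mem_enum _ x)).
    have h4x := h4 (_, (fun v => - (v == x)%:R), 0) (map_f _ (mem_enum _ x)).
    by move: h5x h4x; rewrite !lf un unN ip0l capE add0r oppr_le0 addrC subr_le0 => -> ->.
  - move=> i; have := h6 _ (map_f _ (mem_enum _ i)).
    by rewrite lf ip0l add0r.
move=> [[Yp Y1 Y0 Ys] [u0 ul]]; split=> //.
apply/and5P; split; last (apply/andP; split); apply/allP => c.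
- move=> /flatten_mapP[i _]; rewrite !inE => /orP[]/eqP ->.
    by rewrite lf w0 addr0 ip_delta Y1.
  by rewrite lf wN0 addr0 ipNl ip_delta Y1.
- move=> /flatten_mapP[i _]; rewrite !inE => /orP[]/eqP ->.
    by rewrite lf w0 addr0 ip_row_mx1 Ys.
  by rewrite lf wN0 addr0 ipNl ip_row_mx1 Ys.
- move=> /allpairsP[[i j] [_ _ ->]].
  by rewrite lf w0 addr0 ipNl ip_delta oppr_le0.
- move=> /mapP[x _ ->]; rewrite lf ip0l add0r unN oppr_le0; by have /andP[] := u0 x.
- move=> /mapP[x _ ->]; rewrite lf un capE addrC subr_le0; by have /andP[] := u0 x.
- move=> /mapP[i _ ->]; by rewrite lf ip0l add0r; exact: ul.
Qed.

Lemma certificate_value (y : sdp_point P) : certC s y.1 ->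
  sdp_value y + theta / n%:R * \sum_i \sum_j Z i j
  = \sum_p y.2 p - lam * upper_sum y.1 + theta / n%:R * l1norm (y.1 - Z).
Proof.
move=> Yc; have [Yp Y1 Y0 Ys] := Yc.
rewrite /sdp_value linform_ip /=.
have -> : \sum_v 1 * y.2 v = \sum_p y.2 p by apply: eq_bigr => p _; rewrite mul1r.
have -> : l1norm (y.1 - Z) =
    \sum_i \sum_j Z i j + \sum_i \sum_j (1 - 2 * Z i j) * y.1 i j.
  rewrite -big_split; apply: eq_bigr => i _; rewrite -big_split; apply: eq_bigr => j _ /=.
  have h0 := Y0 i j; have h1 := certC_le1 i j Yc; rewrite !mxE.
  case: eqP => _; rewrite ?mulr1n ?mulr0n.
    by rewrite distrC ger0_norm ?subr_ge0 //; lra.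
  by rewrite subr0 ger0_norm //; lra.
have -> : ip (\matrix_(i, j) (theta / n%:R * (1 - 2 * Z i j)
     - (if (i < j)%N then lam else 0))) y.1 =
   theta / n%:R * (\sum_i \sum_j (1 - 2 * Z i j) * y.1 i j) - lam * upper_sum y.1.
  rewrite /upper_sum !mulr_sumr -sumrB; apply: eq_bigr => i _.
  rewrite !mulr_sumr [X in _ - X]big_mkcond -sumrB; apply: eq_bigr => j _.
  by rewrite mxE; case: ifP => _; ring.
ring.
Qed.

Lemma certificate_optimum_exists : exists y : sdp_point P, sdp_optimal y.
Proof.
apply: (@sdp_optimum_exists R P 1).
  exists (Z, fun=> 0); apply/certificate_feasibleP; split; first exact: cluster_certC.
  split=> [p|i]; first by rewrite lexx cap_ge0 // => i j; rewrite mxE ler0n.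
  by rewrite /load big1 ?ltW // => p _; rewrite mulr0.
move=> y /certificate_feasibleP[Yc [u0 _]]; have [Yp Y1 Y0 Ys] := Yc.
split=> [i j|p]; first by rewrite ger0_norm // (certC_le1 _ _ Yc).
have /andP[h1 h2] := u0 p; rewrite ger0_norm //; apply: (le_trans h2).
by rewrite /cap; case: ifP => // _; rewrite (certC_le1 _ _ Yc).
Qed.

(** A point of [certC] completed by an exact packing is feasible for the program, which gives the
    upper bound; weak duality at the point returned by the oracle gives the converse. The first half
    also bounds the scores of all balanced labelings when the certificate passes. *)
Lemma certificate_correct (slv : forall P : sdp R, sdp_point P) : exact_oracle slv ->
  (forall Y, certC s Y ->
    Psi A D lam Y + theta / n%:R * l1norm (Y - Z)
      <= sdp_value (slv P) + theta / n%:R * \sum_i \sum_j Z i j) /\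
  sdp_value (slv P) + theta / n%:R * \sum_i \sum_j Z i j = Vcert s A D lam theta Z.
Proof.
move=> ex; have [yF ymax] := ex _ certificate_optimum_exists.
move: yF ymax; set y := slv P => /certificate_feasibleP[Yc yp] ymax.
have ub Y : certC s Y -> Psi A D lam Y + theta / n%:R * l1norm (Y - Z)
      <= sdp_value y + theta / n%:R * \sum_i \sum_j Z i j.
  move=> Yc'; have [_ _ Y0 _] := Yc'; have [u up us] := exact_packing A D0 Y0.
  have : sdp_feasible ((Y, u) : sdp_point P) by apply/certificate_feasibleP.
  move=> /ymax; rewrite -(lerD2r (theta / n%:R * \sum_i \sum_j Z i j)).
  by rewrite [X in X <= _]certificate_value //= us.
split=> //; apply/eqP; rewrite eq_le; apply/andP; split; last first.
  apply: ge_sup; last by move=> _ [Y [Yc' ->]]; apply: ub.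
  by exists (Psi A D lam Z + theta / n%:R * l1norm (Z - Z)), Z; split=> //; exact: cluster_certC.
apply: (@le_trans _ _ (Psi A D lam y.1 + theta / n%:R * l1norm (y.1 - Z))).
  rewrite certificate_value // lerD2r lerD2r; apply: Hscore_ge => q z.
  by apply: packing_le_cover yp; have [] := Yc.
apply: ub_le_sup; last by exists y.1.
exists (sdp_value y + theta / n%:R * \sum_i \sum_j Z i j) => _ [Y [Yc' ->]]; exact: ub.
Qed.

End CertificateProgram.

(** * Labelings and cluster overlaps *)

Section Hall.
Variables (T U : finType).
Implicit Types (N : T -> {set U}) (X : {set T}).

Definition nbrs N X : {set U} := \bigcup_(x in X) N x.

Definition hall N := forall X, (#|X| <= #|nbrs N X|)%N.

Lemma nbrsU N X X' : nbrs N (X :|: X') = nbrs N X :|: nbrs N X'.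
Proof. exact: finset.bigcup_setU. Qed.

Lemma nbrs1 N x : nbrs N [set x] = N x.
Proof. by rewrite /nbrs big_set1. Qed.

Lemma nbrsS N X X' : X \subset X' -> nbrs N X \subset nbrs N X'.
Proof.
move=> /fintype.subsetP XX'; apply/finset.bigcupsP => x xX.
by apply: (finset.bigcup_sup x); last exact: XX'.
Qed.

Definition shrink N x y : T -> {set U} := fun t => if t == x then N x :\ y else N t.

Lemma nbrs_shrink N x y X : x \notin X -> nbrs (shrink N x y) X = nbrs N X.
Proof.
move=> xX; apply: eq_bigr => t tX; rewrite /shrink.
by case: eqP => // tx; rewrite -tx tX in xX.
Qed.

(** A set that violates Hall's condition once y is removed from N x must contain x; the witness is
    that set without x. *)
Lemma hall_violation N x y : hall N -> ~ hall (shrink N x y) ->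
  exists2 X : {set T}, x \notin X & (#|nbrs N X :|: (N x :\ y)| <= #|X|)%N.
Proof.
move=> hN /existsNP[X /negP]; rewrite -ltnNge => hX.
have xX : x \in X.
  by apply: contraLR hX => xX; rewrite nbrs_shrink // -leqNgt.
exists (X :\ x); first by rewrite !inE eqxx.
move: hX; rewrite -[in nbrs _ X](finset.setD1K xX) nbrsU nbrs1 finset.setUC nbrs_shrink ?inE ?eqxx //.
by rewrite /shrink eqxx (cardsD1 x X) xX add1n ltnS.
Qed.

(* Rado: if neither y nor z can be removed from N x, submodularity of the
   neighbourhood cardinality contradicts Hall's condition. *)
Lemma hall_shrink N x y z : hall N -> y \in N x -> z \in N x -> y != z ->
  hall (shrink N x y) \/ hall (shrink N x z).
Proof.
move=> hN yx zx yz; apply: contrapT => /not_orP[].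
move=> /(hall_violation hN)[P xP hP] /(hall_violation hN)[Q xQ hQ].
have h1 : (#|P :|: Q|.+1 <= #|(nbrs N P :|: (N x :\ y)) :|: (nbrs N Q :|: (N x :\ z))|)%N.
  have -> : #|P :|: Q|.+1 = #|x |: (P :|: Q)| by rewrite cardsU1 !inE negb_or xP xQ.
  apply: (leq_trans (hN _)); apply: subset_leq_card; rewrite nbrsU nbrs1 nbrsU.
  apply/fintype.subsetP => t; rewrite !inE => /orP[tx|/orP[->|->]]; rewrite ?orbT //.
  by rewrite tx !andbT; case: (eqVneq t y) => [->|]; rewrite ?orbT // yz !orbT.
have h2 : (#|P :&: Q| <= #|(nbrs N P :|: (N x :\ y)) :&: (nbrs N Q :|: (N x :\ z))|)%N.
  apply: (leq_trans (hN _)); apply: subset_leq_card; rewrite finset.subsetI.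
  apply/andP; split; apply: (fintype.subset_trans _ (finset.subsetUl _ _)); apply: nbrsS;
  [exact: finset.subsetIl|exact: finset.subsetIr].
have := cardsUI (nbrs N P :|: (N x :\ y)) (nbrs N Q :|: (N x :\ z)).
have := cardsUI P Q; lia.
Qed.

(** Neighbours are removed, by induction on their total number, until every vertex has exactly one;
    Hall's condition for pairs then makes the map injective. *)
Lemma hall_matching N : hall N -> exists f : T -> U, injective f /\ forall x, f x \in N x.
Proof.
have [m] := ubnP (\sum_x #|N x|); elim: m N => // m IH N; rewrite ltnS => hm hN.
case: (pickP (fun x => 1 < #|N x|)%N) => [x /card_gt1P[y [z [yx zx yz]]]|small].
  have dec y' : y' \in N x -> (\sum_t #|shrink N x y' t| < m)%N.
    move=> y'x; apply: leq_trans hm.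
    rewrite (bigD1 x) //= [X in (_ < X)%N](bigD1 x) //= /shrink eqxx.
    rewrite (cardsD1 y' (N x)) y'x add1n addSn ltnS leq_add2l.
    by apply: leq_sum => t /negbTE ->.
  have sub y' t : shrink N x y' t \subset N t.
    by rewrite /shrink; case: eqP => [->|] //; exact: subD1set.
  case: (hall_shrink hN yx zx yz) => h.
    by have [f [fI fN]] := IH _ (dec y yx) h; exists f; split=> // t; apply: (fintype.subsetP (sub y t)).
  by have [f [fI fN]] := IH _ (dec z zx) h; exists f; split=> // t; apply: (fintype.subsetP (sub z t)).
have N1 x : exists u, N x = [set u].
  apply/cards1P; rewrite eqn_leq leqNgt small /=.
  by have := hN [set x]; rewrite cards1 nbrs1.
have [f fN] := boolp.choice N1.
exists f; split=> [x y fxy|x]; last by rewrite fN inE.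
apply/eqP; apply/negP => /negP xy.
have := hN [set x; y]; rewrite cards2 xy nbrsU !nbrs1 !fN fxy finset.setUid cards1.
by [].
Qed.

End Hall.

(* Birkhoff--von Neumann for integer matrices: N is a sum of s permutation
   matrices, one of which has weight at least the average. *)
Lemma permutation_weight (K s : nat) (N w : 'I_K -> 'I_K -> nat) :
  (forall k, \sum_l N k l = s)%N -> (forall l, \sum_k N k l = s)%N ->
  exists p : {perm 'I_K}, (\sum_k \sum_l N k l * w k l <= s * \sum_k w k (p k))%N.
Proof.
elim: s N => [|s IH] N hr hc.
  exists 1%g; rewrite mul0n leqn0 sum_nat_eq0; apply/forallP => k; apply/implyP => _.
  rewrite sum_nat_eq0; apply/forallP => l; apply/implyP => _.
  by have := hr k; rewrite (bigD1 l) //= => /eqP; rewrite addn_eq0 => /andP[/eqP -> _]; rewrite mul0n.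
(* Each row and each column has weight s + 1, and the weight of the rows in X lies in the columns of
   their neighbours. *)
have hN : hall (fun k => [set l | (0 < N k l)%N]).
  move=> X; rewrite -(leq_pmul2l (ltn0Sn s)).
  apply: (@leq_trans (\sum_(k in X) \sum_l N k l)).
    by rewrite (eq_bigr (fun=> s.+1)) // sum_nat_const mulnC.
  rewrite exchange_big /= (bigID (mem (nbrs (fun k => [set l | (0 < N k l)%N]) X))) /=.
  rewrite [X in (_ + X)%N]big1 ?addn0 => [|l lX]; last first.
    apply/eqP; rewrite sum_nat_eq0; apply/forallP => k; apply/implyP => kX.
    rewrite -leqn0 leqNgt; apply: contra lX => kl.
    by apply/finset.bigcupP; exists k => //; rewrite inE.
  apply: (@leq_trans (\sum_(l in nbrs (fun k => [set l | (0 < N k l)%N]) X) s.+1)).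
    apply: leq_sum => l _; rewrite -(hc l) [leqRHS](bigID (mem X)) /=; exact: leq_addr.
  by rewrite sum_nat_const mulnC.
have [f [fI fN]] := hall_matching hN; pose p0 := perm fI.
pose N' k l := (N k l - (p0 k == l))%N.
have NE k l : N k l = (N' k l + (p0 k == l))%N.
  rewrite subnK //; case: eqP => // <-.
  by have := fN k; rewrite inE permE.
have row1 k : (\sum_l (p0 k == l) = 1)%N.
  by rewrite (bigD1 (p0 k)) //= eqxx big1 // => l /negbTE; rewrite eq_sym => ->.
have col1 l : (\sum_k (p0 k == l) = 1)%N.
  rewrite (bigD1 (p0^-1%g l)) //= permKV eqxx big1 // => k kl.
  by apply/eqP; rewrite eqb0; apply: contra kl => /eqP <-; rewrite permK.
have hr' k : (\sum_l N' k l = s)%N.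
  have := hr k; under eq_bigr do rewrite NE.
  by rewrite big_split /= row1 addn1 => -[].
have hc' l : (\sum_k N' k l = s)%N.
  have := hc l; under eq_bigr do rewrite NE.
  by rewrite big_split /= col1 addn1 => -[].
have [p1 hp1] := IH N' hr' hc'.
have E : (\sum_k \sum_l N k l * w k l =
    \sum_k \sum_l N' k l * w k l + \sum_k w k (p0 k))%N.
  rewrite -big_split; apply: eq_bigr => k _ /=.
  under eq_bigr do rewrite NE mulnDl.
  rewrite big_split /=; congr (_ + _)%N; rewrite (bigD1 (p0 k)) //= eqxx mul1n big1 ?addn0 //.
  by move=> l /negbTE; rewrite eq_sym => ->.
(* The better of the extracted permutation and the one found for the remainder reaches the
   average. *)
have [le|le] := leqP (\sum_k w k (p0 k)) (\sum_k w k (p1 k)).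
  by exists p1; rewrite E mulSn addnC leq_add.
exists p0; rewrite E mulSn addnC leq_add2l; apply: (leq_trans hp1).
by rewrite leq_mul2l (ltnW le) orbT.
Qed.

Section Labelings.
Variables (n K : nat).
Implicit Types (sigma tau sstar : labeling n K) (p : {perm 'I_K}).

Definition overlap sigma tau (k l : 'I_K) : nat :=
  #|[set i | (sigma i == k) && (tau i == l)]|.

Lemma balanced_card sigma k : balanced sigma -> #|[set i | sigma i == k]| = (n %/ K)%N.
Proof. by move=> /forallP/(_ k)/eqP. Qed.

Lemma overlap_row sigma tau k : balanced sigma -> (\sum_l overlap sigma tau k l = n %/ K)%N.
Proof.
move=> /(balanced_card k) <-; rewrite -sum1_card (partition_big tau xpredT) //=.
by apply: eq_bigr => l _; rewrite /overlap -sum1_card; apply: eq_bigl => i; rewrite !inE.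
Qed.

Lemma overlap_col sigma tau l : balanced tau -> (\sum_k overlap sigma tau k l = n %/ K)%N.
Proof.
move=> /(balanced_card l) <-; rewrite -sum1_card (partition_big sigma xpredT) //=.
by apply: eq_bigr => k _; rewrite /overlap -sum1_card; apply: eq_bigl => i; rewrite !inE andbC.
Qed.

Lemma relabelE p sigma i : relabel p sigma i = p (sigma i).
Proof. by rewrite ffunE. Qed.

Lemma hamming_relabel p sigma tau :
  (hamming (relabel p sigma) tau + \sum_k overlap sigma tau k (p k) = n)%N.
Proof.
have -> : (\sum_k overlap sigma tau k (p k) = #|[set i | relabel p sigma i == tau i]|)%N.
  rewrite -[RHS]sum1_card (partition_big sigma xpredT) //=.
  apply: eq_bigr => k _; rewrite /overlap -sum1_card; apply: eq_bigl => i.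
  rewrite !inE relabelE.
  by apply/andP/andP => [[/eqP <- /eqP ->]|[/eqP <- /eqP ->]]; rewrite !eqxx.
rewrite /hamming -[RHS]card_ord addnC -(cardsC [set i | relabel p sigma i == tau i]).
by congr (_ + _)%N; apply: eq_card => i; rewrite !inE.
Qed.

Lemma relabel1 sigma : relabel 1 sigma = sigma.
Proof. by apply/ffunP => i; rewrite relabelE perm1. Qed.

Lemma relabelM p p' sigma : relabel p (relabel p' sigma) = relabel (p' * p)%g sigma.
Proof. by apply/ffunP => i; rewrite !relabelE permM. Qed.

Lemma relabel_balanced p sigma : balanced (relabel p sigma) = balanced sigma.
Proof.
suff H q tau : balanced tau -> balanced (relabel q tau).
  apply/idP/idP; last exact: H.
  by move=> /(H p^-1%g); rewrite relabelM mulgV relabel1.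
move=> /forallP bt; apply/forallP => k; rewrite -(eqP (bt (q^-1%g k))).
apply/eqP/eq_card => i; rewrite !inE relabelE.
by apply/eqP/eqP => [<-|->]; rewrite ?permK ?permKV.
Qed.

Lemma relabel_cluster_mx (R : realType) p sigma :
  cluster_mx R (relabel p sigma) = cluster_mx R sigma.
Proof. by apply/matrixP => i j; rewrite !mxE !relabelE (inj_eq perm_inj). Qed.

Lemma ip_overlap (R : realType) sigma tau :
  ip (cluster_mx R sigma) (cluster_mx R tau)
  = (\sum_k \sum_l overlap sigma tau k l * overlap sigma tau k l)%:R.
Proof.
transitivity (\sum_i (overlap sigma tau (sigma i) (tau i))%:R : R).
  apply: eq_bigr => i _; rewrite /overlap -sum1_card natr_sum [RHS]big_mkcond /=.
  apply: eq_bigr => j _; rewrite !mxE inE [sigma j == _]eq_sym [tau j == _]eq_sym -natrM mulnb.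
  by case: (_ && _).
rewrite -natr_sum pair_bigA /=; congr (_%:R).
rewrite (partition_big (fun i => (sigma i, tau i)) xpredT) //=.
apply: eq_bigr => -[k l] _ /=.
rewrite (eq_bigr (fun=> overlap sigma tau k l)); last first.
  by move=> i; rewrite xpair_eqE => /andP[/eqP -> /eqP ->].
rewrite sum_nat_const; congr (_ * _)%N.
by apply: eq_card => i; rewrite !inE -xpair_eqE.
Qed.

(** The distance is 2 (n s - S), where S is the sum of the squared overlaps. With the overlaps
    themselves as weights, some permutation p satisfies S <= s times the number of agreements of
    [relabel p sigma] with tau, which is at most n - h by minimality. *)
Lemma l1norm_hamming (R : realType) sigma tau :
  (0 < K)%N -> (0 < n)%N -> (K %| n)%N -> balanced sigma -> balanced tau ->
  (forall p, (hamming sigma tau <= hamming (relabel p sigma) tau)%N) ->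
  2 * (n %/ K)%:R * (hamming sigma tau)%:R
    <= l1norm (cluster_mx R sigma - cluster_mx R tau).
Proof.
move=> K0 n0 Kn bs bt hmin.
have [p hp] := permutation_weight (overlap sigma tau)
  (fun k => overlap_row tau k bs) (fun l => overlap_col sigma l bt).
rewrite (certC_l1norm bt (cluster_certC R K0 n0 Kn bs)) /gap -mulrA ler_wpM2l //.
rewrite ipC ip_overlap.
have hb : (\sum_k overlap sigma tau k (p k) + hamming sigma tau <= n)%N.
  by have := hmin p; have := hamming_relabel p sigma tau; lia.
rewrite lerBrDr -!natrM -natrD ler_nat.
apply: (@leq_trans ((n %/ K) * hamming sigma tau + (n %/ K) * \sum_k overlap sigma tau k (p k)))%N.
  by rewrite leq_add2l.
by rewrite -mulnDr addnC mulnC leq_mul2r hb orbT.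
Qed.

Lemma lex_le_refl : reflexive (@lex_le n K).
Proof. by move=> sigma; rewrite /lex_le eqxx. Qed.

Lemma lex_leP sigma tau : reflect
  (sigma = tau \/ exists i : 'I_n, (forall j : 'I_n, (j < i)%N -> sigma j = tau j) /\
     (sigma i < tau i)%N) (lex_le sigma tau).
Proof.
apply: (iffP orP) => [[/eqP|/existsP[i /andP[/forallP h lt]]]|[->|[i [h lt]]]].
- by left.
- by right; exists i; split=> // j ji; have /implyP/(_ ji)/eqP := h j.
- by left.
- right; apply/existsP; exists i; rewrite lt andbT; apply/forallP => j.
  by apply/implyP => /h ->.
Qed.

Lemma lex_le_trans : transitive (@lex_le n K).
Proof.
move=> tau sigma rho /lex_leP[->//|[i [hi lti]]] /lex_leP[<-|[j [hj ltj]]].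
  by apply/lex_leP; right; exists i.
apply/lex_leP; right; case: (ltngtP i j) => [ij|ji|/val_inj ij].
- exists i; split=> [k ki|]; first by rewrite hi // hj // (ltn_trans ki).
  by rewrite -hj.
- exists j; split=> [k kj|]; last by rewrite hi.
  by rewrite hi ?hj // (ltn_trans kj).
- rewrite -ij in hj ltj; exists i; split=> [k ki|]; first by rewrite hi // hj.
  exact: ltn_trans ltj.
Qed.

Lemma lex_le_total : total (@lex_le n K).
Proof.
move=> sigma tau; case: (eqVneq sigma tau) => [->|ne]; first by rewrite lex_le_refl.
have ex : exists i : nat, [exists j : 'I_n, (val j == i) && (sigma j != tau j)].
  have /existsP[j hj] : [exists j, sigma j != tau j].
    apply: contraNT ne; rewrite negb_exists => /forallP h; apply/eqP/ffunP => j.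
    by apply/eqP; rewrite -[_ == _]negbK.
  by exists j; apply/existsP; exists j; rewrite eqxx.
case: (ex_minnP ex) => m /existsP[i /andP[/eqP im ne_i]] hmin.
have eqlt (j : 'I_n) : (j < i)%N -> sigma j = tau j.
  move=> ji; apply/eqP; apply: contraTT ji => nej; rewrite -leqNgt im.
  by apply: hmin; apply/existsP; exists j; rewrite eqxx.
case: (ltngtP (sigma i) (tau i)) => [lt|lt|/val_inj e]; last by rewrite e eqxx in ne_i.
- by apply/orP; left; apply/lex_leP; right; exists i.
- by apply/orP; right; apply/lex_leP; right; exists i; split=> // j /eqlt.
Qed.

Lemma best_relabelings_neq0 sstar sigma : exists tau, tau \in best_relabelings sstar sigma.
Proof.
case: (arg_minnP (P := xpredT) (fun p => hamming (relabel p sigma) sstar) (i0 := 1%g)) => // p _ hp.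
exists (relabel p sigma); apply/imsetP; exists p => //.
by rewrite inE; apply/forallP => p'; apply: hp.
Qed.

Lemma lex_min_exists (S : {set labeling n K}) tau0 : tau0 \in S ->
  exists2 tau, tau \in S & [forall tau' in S, lex_le tau tau'].
Proof.
move=> h0; case: (@extremumP _ _ (@lex_le n K) tau0 [pred t | t \in S] id
  lex_le_refl lex_le_trans lex_le_total h0) => tau ht hmin.
by exists tau => //; apply/forallP => t; apply/implyP => /hmin.
Qed.

Lemma canP sstar sigma : can sstar sigma \in best_relabelings sstar sigma.
Proof.
rewrite /can; case: pickP => [tau /andP[] //|none].
have [tau0 h0] := best_relabelings_neq0 sstar sigma.
have [tau ht hmin] := lex_min_exists h0.
by have := none tau; rewrite ht hmin.
Qed.

Lemma best_relabelings_relabel sstar p sigma :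
  best_relabelings sstar (relabel p sigma) = best_relabelings sstar sigma.
Proof.
suff H q tau : best_relabelings sstar (relabel q tau) \subset best_relabelings sstar tau.
  apply/eqP; rewrite finset.eqEsubset H /=.
  by rewrite -{1}(relabel1 sigma) -(mulgV p) -relabelM.
apply/fintype.subsetP => _ /imsetP[r + ->]; rewrite inE => /forallP hr.
rewrite relabelM; apply/imsetP; exists (q * r)%g => //; rewrite inE; apply/forallP => r'.
by have := hr (q^-1 * r')%g; rewrite !relabelM mulKVg.
Qed.

(** The set of best relabelings depends only on the orbit, hence so does its minimum; the defaults
    of [odflt], which differ on the two sides, never occur. *)
Lemma can_relabel sstar p sigma : can sstar (relabel p sigma) = can sstar sigma.
Proof.
have := canP sstar (relabel p sigma); have := canP sstar sigma; rewrite /can.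
rewrite best_relabelings_relabel; case: pickP => // none.
have [tau0 h0] := best_relabelings_neq0 sstar sigma.
have [tau ht hmin] := lex_min_exists h0.
by have := none tau; rewrite ht hmin.
Qed.

Lemma can_orbit sstar sigma : exists p, can sstar sigma = relabel p sigma.
Proof. by have /imsetP[p _ ->] := canP sstar sigma; exists p. Qed.

Lemma can_idem sstar sigma : can sstar (can sstar sigma) = can sstar sigma.
Proof. by have [p E] := can_orbit sstar sigma; rewrite {1}E can_relabel. Qed.

Lemma can_fixed_hamming sstar sigma p : can sstar sigma = sigma ->
  (hamming sigma sstar <= hamming (relabel p sigma) sstar)%N.
Proof.
move=> cs; have := canP sstar sigma; rewrite cs => /imsetP[q + E]; rewrite inE => /forallP h.
by have := h p; rewrite -E.
Qed.

Lemma relabel_inj sigma : (0 < n %/ K)%N -> balanced sigma ->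
  injective (fun p : {perm 'I_K} => relabel p sigma).
Proof.
move=> s0 bs p p' /ffunP E; apply/permP => k.
have /card_gt0P[i] : (0 < #|[set i | sigma i == k]|)%N by rewrite balanced_card.
by rewrite inE => /eqP <-; have := E i; rewrite !relabelE.
Qed.

(** The orbit of tau contains a single canonical labeling, and the action is free because no cluster
    is empty; so tau arises from one representative by one permutation. *)
Lemma relabel_representatives sstar tau : (0 < n %/ K)%N -> balanced tau ->
  (\sum_(sigma | balanced sigma && (can sstar sigma == sigma))
     #|[set p | relabel p sigma == tau]| = 1)%N.
Proof.
move=> s0 bt; have [q E] := can_orbit sstar tau.
have bc : balanced (can sstar tau) by rewrite E relabel_balanced.
rewrite (bigD1 (can sstar tau)) /=; last by rewrite bc can_idem eqxx.
rewrite big1 ?addn0 => [|sigma /andP[/andP[bs /eqP cs] ne]]; last first.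
  apply: eq_card0 => p; rewrite !inE; apply/negP => /eqP pE.
  by move: ne; rewrite -pE can_relabel cs eqxx.
rewrite (_ : [set p | _] = [set q^-1%g]%SET) ?cards1 //.
apply/setP => p; rewrite !inE; apply/eqP/eqP => [h|->]; last first.
  by rewrite E relabelM mulgV relabel1.
apply: (relabel_inj s0 bc); rewrite h.
by rewrite /= E relabelM mulgV relabel1.
Qed.

End Labelings.

(** * The rejection sampler *)

Section ProgramSemantics.
Variables (R : realType) (slv : forall P : sdp R, sdp_point P) (ocost : nat -> nat).

Lemma expected_value_bind X X' (p : prog R X) (h : X -> prog R X') f :
  expected_value slv (bind p h) f
  = expected_value slv p (fun x => expected_value slv (h x) f).
Proof.
elim: p => //= J w k IH.
by apply: eq_bigr => i _; rewrite IH.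
Qed.

Lemma expected_time_bind X X' (p : prog R X) (h : X -> prog R X') :
  expected_time slv ocost (bind p h)
  = expected_time slv ocost p + expected_value slv p (fun x => expected_time slv ocost (h x)).
Proof.
elim: p => //= [x|c p IH|J w k IH|P k IH].
- by rewrite add0r.
- by rewrite IH addrA.
- rewrite -addrA -big_split /=; congr (_ + _); apply: eq_bigr => i _.
  by rewrite IH mulrDr.
- by rewrite IH addrA.
Qed.

End ProgramSemantics.

Section Proposal.
Variables (R : realType) (n K : nat) (w : 'I_n -> 'I_K -> R).
Hypothesis w1 : forall i, \sum_a w i a = 1.
Implicit Types sigma : labeling n K.

Definition product_weight sigma : R := \prod_i w i (sigma i).

Lemma sum_product_weight : \sum_sigma product_weight sigma = 1.
Proof. by rewrite /product_weight -bigA_distr_bigA big1. Qed.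

(* Swapping the resampled label with the old one is an involution which
   preserves the weight. *)
Lemma resample i (g : labeling n K -> R) :
  \sum_sigma product_weight sigma * \sum_a w i a * g (set_label sigma i a)
  = \sum_sigma product_weight sigma * g sigma.
Proof.
under eq_bigr => sigma _ do rewrite mulr_sumr.
rewrite pair_bigA /=.
pose phi (q : labeling n K * 'I_K) := (set_label q.1 i q.2, q.1 i).
have phiK : involutive phi.
  move=> [sigma a]; rewrite /phi /= ffunE eqxx; congr pair; apply/ffunP => j.
  by rewrite !ffunE; case: eqP => [->|].
rewrite (reindex_inj (inv_inj phiK)) /=.
transitivity (\sum_(q : labeling n K * 'I_K) product_weight q.1 * (w i q.2 * g q.1)).
  apply: eq_bigr => -[sigma a] _ /=.
  have -> : set_label (set_label sigma i a) i (sigma i) = sigma.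
    by apply/ffunP => j; rewrite !ffunE; case: eqP => [->|].
  rewrite /product_weight (bigD1 i) //= [in RHS](bigD1 i) //= ffunE eqxx.
  rewrite (eq_bigr (fun j => w j (sigma j))); last first.
    by move=> j /negbTE ji; rewrite ffunE ji.
  by ring.
rewrite -(pair_bigA _ (fun sigma a => product_weight sigma * (w i a * g sigma))) /=.
apply: eq_bigr => sigma _; rewrite -mulr_sumr -mulr_suml w1 mul1r //.
Qed.

(** The labels in l are redrawn one at a time from [sstar]; by [resample], each fresh label may be
    read as a coordinate of a single product-distributed labeling. *)
Lemma expected_proposal slv sstar (l : seq 'I_n) f :
  expected_value slv (foldr (fun i p => bind p (fun sigma =>
     Draw (w i) (fun a => Ret (set_label sigma i a)))) (Ret sstar) l) f
  = \sum_sigma product_weight sigma * f [ffun i => if i \in l then sigma i else sstar i].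
Proof.
elim: l f => [|i l IH] f /=.
  rewrite (eq_bigr (fun sigma => product_weight sigma * f sstar)); last first.
    by move=> sigma _; congr (_ * f _); apply/ffunP => i; rewrite ffunE.
  by rewrite -mulr_suml sum_product_weight mul1r.
rewrite expected_value_bind IH /=.
rewrite -(resample i (fun sigma => f [ffun j => if j \in i :: l then sigma j else sstar j])).
apply: eq_bigr => sigma _; congr (_ * _); apply: eq_bigr => a _; congr (_ * f _).
apply/ffunP => j; rewrite !ffunE inE.
by case: eqP.
Qed.

End Proposal.

Section TrialLaw.
Variables (R : realType) (n K : nat) (D theta eps lam : R).
Variables (slv : forall P : sdp R, sdp_point P) (ocost : nat -> nat).
Hypotheses (n0 : (0 < n)%N) (K0 : (0 < K)%N) (Kn : (K %| n)%N).
Hypotheses (D0 : 0 < D) (theta0 : 0 <= theta) (eps0 : 0 <= eps).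
Hypothesis ex : exact_oracle slv.
Implicit Types (A : graph n) (sigma sstar tau : labeling n K).

Local Notation s := (n %/ K)%N.
Local Notation eta := (eta_of D eps).
Local Notation kappa := (kappa_of K D theta eps).

Definition normalizer : R := 1 + (K%:R - 1) * expR (- kappa).

Lemma normalizer_ge1 : 1 <= normalizer.
Proof. by rewrite lerDl mulr_ge0 ?expR_ge0 // subr_ge0 ler1n. Qed.

Lemma normalizer_gt0 : 0 < normalizer.
Proof. exact: lt_le_trans normalizer_ge1. Qed.

Lemma proposal_weight_sum (l0 : 'I_K) : \sum_a proposal_weight D theta eps l0 a = 1.
Proof.
rewrite -mulr_suml -/normalizer.
rewrite (bigD1 l0) //= eqxx (eq_bigr (fun=> expR (- kappa))) => [|a /negbTE ->] //.
rewrite sumr_const (_ : #|_| = K.-1); last first.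
  have := cardC1 l0; rewrite card_ord => <-; by apply: eq_card => a; rewrite !inE.
rewrite -[_ *+ K.-1]mulr_natl -subn1 natrB // mulfV //.
by rewrite gt_eqF // normalizer_gt0.
Qed.

Definition propose_weight sstar sigma : R :=
  product_weight (fun i => proposal_weight D theta eps (sstar i)) sigma.

Lemma propose_weightE sstar sigma :
  propose_weight sstar sigma = normalizer ^- n * expR (- kappa * (hamming sigma sstar)%:R).
Proof.
rewrite /propose_weight /product_weight big_split /= prodr_const card_ord exprVn mulrC.
congr (_ * _); rewrite (bigID (fun i => sigma i == sstar i)) /=.
rewrite big1 ?mul1r => [|i ->] //.
rewrite (eq_bigr (fun=> expR (- kappa))) => [|i /negbTE ->] //.
rewrite prodr_const mulrC expRM_natl; congr (_ ^+ _).
by apply: eq_card => i; rewrite !inE.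
Qed.

Lemma propose_weight_ge0 sstar sigma : 0 <= propose_weight sstar sigma.
Proof. by rewrite propose_weightE mulr_ge0 ?expR_ge0 // invr_ge0 exprn_ge0 // ltW // normalizer_gt0. Qed.

Lemma propose_weight_sum sstar : \sum_sigma propose_weight sstar sigma = 1.
Proof. by apply: sum_product_weight => i; apply: proposal_weight_sum. Qed.

Lemma expected_propose sstar f :
  expected_value slv (propose D theta eps sstar) f
  = \sum_sigma propose_weight sstar sigma * f sigma.
Proof.
rewrite /propose (expected_proposal (w := fun i => proposal_weight D theta eps (sstar i))).
  apply: eq_bigr => sigma _; congr (_ * f _).
  by apply/ffunP => i; rewrite ffunE mem_enum.
by move=> i; apply: proposal_weight_sum.
Qed.

Definition accept_weight A sstar tstar sigma : R :=
  expR (eta * (Tscore A D lam sigma - tstar) + kappa * (hamming sigma sstar)%:R).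

Definition representative sstar sigma : bool :=
  balanced sigma && (can sstar sigma == sigma).

(** The bound on [accept_weight] makes the clipping to [0, 1] in [bernoulli_weight] inactive, and
    the oracle returns the exact score. *)
Lemma expected_trial A sstar tstar (F : option (labeling n K) -> R) :
  (forall sigma, representative sstar sigma -> accept_weight A sstar tstar sigma <= 1) ->
  expected_value slv (trial D theta eps lam A sstar tstar) F
  = F None + \sum_(sigma | representative sstar sigma)
      propose_weight sstar sigma * accept_weight A sstar tstar sigma *
      \sum_p (K`!%:R)^-1 * (F (Some (relabel p sigma)) - F None).
Proof.
move=> acc; rewrite /trial expected_value_bind expected_propose.
have E : F None = \sum_sigma propose_weight sstar sigma * F None.
  by rewrite -mulr_suml propose_weight_sum mul1r.
rewrite [X in _ = X + _]E [X in _ + X]big_mkcond -big_split /=; apply: eq_bigr => sigma _.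
rewrite /representative; case: (boolP (balanced sigma)) => bs /=; last by rewrite addr0.
case: (eqVneq (can sstar sigma) sigma) => [cs|_] /=; last by rewrite addr0.
have aw : accept_weight A sstar tstar sigma <= 1 by apply: acc; rewrite /representative bs cs eqxx.
rewrite score_lp_correct // => [|i j]; last by rewrite mxE ler0n.
rewrite big_bool /= -[expR _]/(accept_weight A sstar tstar sigma).
rewrite min_r // max_r ?expR_ge0 //.
under [in RHS]eq_bigr => p _ do rewrite mulrBr.
have sF : \sum_(p : {perm 'I_K}) (K`!%:R)^-1 * F None = F None.
  by rewrite -mulr_suml sumr_const card_Sn -[_^-1 *+ _]mulr_natl mulfV ?mul1r.
rewrite sumrB sF; ring.
Qed.

End TrialLaw.

Lemma Tscore_relabel (R : realType) (n K : nat) A (D lam : R) p (sigma : labeling n K) :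
  Tscore A D lam (relabel p sigma) = Tscore A D lam sigma.
Proof. by rewrite /Tscore relabel_cluster_mx. Qed.

Section SamplerLaw.
Variables (R : realType) (n K : nat) (D theta eps lam : R).
Variables (slv : forall P : sdp R, sdp_point P) (ocost : nat -> nat).
Hypotheses (n0 : (0 < n)%N) (K0 : (0 < K)%N) (Kn : (K %| n)%N).
Hypotheses (D0 : 0 < D) (theta0 : 0 <= theta) (eps0 : 0 <= eps).
Hypothesis ex : exact_oracle slv.
Variables (A : graph n) (sstar : labeling n K).
Hypothesis bstar : balanced sstar.
Implicit Types (sigma tau : labeling n K).

Local Notation s := (n %/ K)%N.
Local Notation eta := (eta_of D eps).
Local Notation kappa := (kappa_of K D theta eps).
Local Notation tstar := (Tscore A D lam sstar).
Local Notation norm := (normalizer K D theta eps).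

Definition gibbs_weight tau : R := expR (eta * Tscore A D lam tau).
Lemma gibbs_weight_relabel p sigma : gibbs_weight (relabel p sigma) = gibbs_weight sigma.
Proof. by rewrite /gibbs_weight Tscore_relabel. Qed.

Definition partition_function : R := \sum_(tau : labeling n K | balanced tau) gibbs_weight tau.
(** What all outputs have in common: the normalization of the proposal, the score of sigma*, and the
    probability 1 / K! of the one permutation leading to a given labeling. *)
Definition accept_const : R := norm ^- n * expR (- (eta * tstar)) / K`!%:R.

Hypothesis acc : forall sigma, representative sstar sigma ->
  accept_weight D theta eps lam A sstar tstar sigma <= 1.

Local Notation trial_ := (trial D theta eps lam A sstar tstar).

(** The factor exp (kappa h) of the acceptance probability cancels exp (- kappa h) in the proposal
    and leaves the Gibbs weight, which is constant on orbits. *)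
Lemma trial_law (F : option (labeling n K) -> R) :
  expected_value slv trial_ F
  = F None + accept_const *
      \sum_(tau : labeling n K | balanced tau) gibbs_weight tau * (F (Some tau) - F None).
Proof.
rewrite expected_trial //; congr (_ + _).
set G := fun tau => F (Some tau) - F None.
have sumG sigma : \sum_p (K`!%:R)^-1 * (F (Some (relabel p sigma)) - F None) =
    (K`!%:R)^-1 * \sum_tau #|[set p | relabel p sigma == tau]|%:R * G tau.
  rewrite -mulr_sumr; congr (_ * _).
  rewrite (partition_big (fun p => relabel p sigma) xpredT) //=; apply: eq_bigr => tau _.
  rewrite (eq_bigr (fun=> G tau)) => [|p /eqP <-] //.
  rewrite sumr_const -[LHS]mulr_natl; congr (_%:R * _).
  by apply: eq_card => p; rewrite !inE.
have wE sigma : propose_weight D theta eps sstar sigma * accept_weight D theta eps lam A sstar tstar sigma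
    = norm ^- n * expR (- (eta * tstar)) * gibbs_weight sigma.
  rewrite propose_weightE // /accept_weight /gibbs_weight -[LHS]mulrA -[RHS]mulrA -!expRD.
  by congr (_ * expR _); ring.
transitivity (\sum_(sigma | representative sstar sigma) \sum_tau
    accept_const * (gibbs_weight tau * G tau) * #|[set p | relabel p sigma == tau]|%:R).
  apply: eq_bigr => sigma _; rewrite wE sumG mulr_sumr mulr_sumr; apply: eq_bigr => tau _.
  case: (posnP #|[set p | relabel p sigma == tau]|) => [->|/card_gt0P[p]]; first by rewrite mul0r !mulr0.
  rewrite inE => /eqP <-; rewrite gibbs_weight_relabel /accept_const; ring.
rewrite exchange_big /= mulr_sumr [RHS]big_mkcond /=; apply: eq_bigr => tau _.
rewrite -mulr_sumr -natr_sum.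
case: (boolP (balanced tau)) => bt.
  by rewrite relabel_representatives ?mulr1 // divn_gt0 // dvdn_leq.
rewrite big1 ?mulr0 // => sigma /andP[bs _]; apply: eq_card0 => p; rewrite !inE.
by apply/negP => /eqP E; move: bt; rewrite -E relabel_balanced bs.
Qed.

Lemma partition_function_gt0 : 0 < partition_function.
Proof.
rewrite /partition_function (bigD1 sstar) //= ltr_pwDl ?expR_gt0 //.
by apply: sumr_ge0 => tau _; apply: expR_ge0.
Qed.

Definition accept_prob : R := accept_const * partition_function.

Lemma accept_const_gt0 : 0 < accept_const.
Proof.
rewrite divr_gt0 ?mulr_gt0 ?expR_gt0 ?invr_gt0 ?exprn_gt0 ?ltr0n ?fact_gt0 //.
by apply: normalizer_gt0.
Qed.

Lemma accept_prob_gt0 : 0 < accept_prob.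
Proof. by rewrite mulr_gt0 ?accept_const_gt0 ?partition_function_gt0. Qed.

Lemma accept_prob_le1 : accept_prob <= 1.
Proof.
have E := expected_trial K0 D0 ex (fun o => if o is Some _ then 1 else 0) acc.
rewrite trial_law /= !add0r in E.
have -> : accept_prob = accept_const *
    \sum_(tau : labeling n K | balanced tau) gibbs_weight tau * (1 - 0).
  by rewrite /accept_prob; congr (_ * _); apply: eq_bigr => tau _; rewrite subr0 mulr1.
rewrite E.
rewrite -[leRHS](propose_weight_sum D theta eps K0 sstar) [leLHS]big_mkcond; apply: ler_sum => sigma _.
have pw := propose_weight_ge0 D theta eps K0 sstar sigma.
case: ifP => // rs; rewrite -mulrA ler_piMr //.
rewrite -mulr_sumr subr0 sumr_const card_Sn.
by rewrite mulVf // mulr1 acc.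
Qed.

(* The K! relabelings of sigma* have the same score as sigma*. *)
Lemma accept_prob_ge : norm ^- n <= accept_prob.
Proof.
have s0 : (0 < s)%N by rewrite divn_gt0 // dvdn_leq.
have h : K`!%:R * expR (eta * tstar) <= partition_function.
  have -> : K`!%:R * expR (eta * tstar) = \sum_(p : {perm 'I_K}) gibbs_weight (relabel p sstar).
    rewrite (eq_bigr (fun=> expR (eta * tstar))) => [|p _]; last by rewrite /gibbs_weight Tscore_relabel.
    by rewrite sumr_const card_Sn mulr_natl.
  have -> : \sum_(p : {perm 'I_K}) gibbs_weight (relabel p sstar) =
      \sum_(tau in [set relabel p sstar | p : {perm 'I_K}]) gibbs_weight tau.
    by rewrite big_imset //= => p q _ _; apply: (relabel_inj s0 bstar).
  rewrite /partition_function big_mkcond [leRHS]big_mkcond; apply: ler_sum => tau _.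
  case: imsetP => [[p _ ->]|_]; first by rewrite relabel_balanced bstar.
  by case: ifP => // _; apply: expR_ge0.
apply: le_trans (ler_wpM2l (ltW accept_const_gt0) h).
rewrite /accept_const mulrA mulfVK; last by rewrite pnatr_eq0 -lt0n fact_gt0.
by rewrite -mulrA -expRD addNr expR0 mulr1.
Qed.

Lemma expected_retry k (f : option (labeling n K) -> R) : f None = 0 ->
  expected_value slv (retry k trial_) f
  = (\sum_(tau : labeling n K | balanced tau) gibbs_weight tau / partition_function * f (Some tau))
    * (1 - (1 - accept_prob) ^+ k).
Proof.
move=> fN; set v := \sum_(tau | _) _.
have pf0 := partition_function_gt0.
have vE : \sum_(tau : labeling n K | balanced tau) gibbs_weight tau * f (Some tau) = v * partition_function.
  rewrite /v mulr_suml; apply: eq_bigr => tau _.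
  by field; rewrite gt_eqF.
elim: k => [|k IH]; first by rewrite /= fN expr0 subrr mulr0.
rewrite /= expected_value_bind trial_law /= IH.
under eq_bigr => tau _ do rewrite mulrBr.
rewrite sumrB vE -mulr_suml -/partition_function exprS.
set x := (1 - accept_prob) ^+ k; rewrite /accept_prob; ring.
Qed.

Lemma retry_limit (f : option (labeling n K) -> R) : f None = 0 ->
  limn (fun k => expected_value slv (retry k trial_) f)
  = \sum_(tau : labeling n K | balanced tau) gibbs_weight tau / partition_function * f (Some tau).
Proof.
move=> fN; under eq_fun => k do rewrite expected_retry //.
set v := \sum_(tau | _) _.
have E : v = v * (1 - 0) by rewrite subr0 mulr1.
rewrite [RHS]E; apply/cvg_lim => //.
apply: cvgM; first exact: cvg_cst.
apply: cvgB; first exact: cvg_cst.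
apply: cvg_expr; have := accept_prob_gt0; have := accept_prob_le1 => h1 h0.
by rewrite ger0_norm; lra.
Qed.

(** T / accept_prob is the fixed point of t = T + (1 - accept_prob) t, the recursion for the
    truncated sampler; the bound is therefore uniform in k. *)
Lemma expected_time_retry k T :
  0 <= T -> expected_time slv ocost trial_ <= T ->
  expected_time slv ocost (retry k trial_) <= T / accept_prob.
Proof.
move=> T0 hT; have p0 := accept_prob_gt0; have p1 := accept_prob_le1.
elim: k => [|k IH] /=; first by rewrite divr_ge0 // ltW.
rewrite expected_time_bind trial_law /=.
under eq_bigr => tau _ do rewrite add0r.
rewrite -mulr_suml -/partition_function.
set t := expected_time _ _ (retry k _) in IH *.
have -> : t + accept_const * (partition_function * - t) = (1 - accept_prob) * t.
  by rewrite /accept_prob; ring.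
have q0 : 0 <= 1 - accept_prob by lra.
have := ler_wpM2l q0 IH => h.
have -> : T / accept_prob = T + (1 - accept_prob) * (T / accept_prob) by field; rewrite gt_eqF.
exact: lerD.
Qed.

End SamplerLaw.

(** * Output law and privacy *)

Section MainLaw.
Variables (R : realType) (n K : nat) (D theta eps lam : R).
Variables (sel : graph n -> 'M[R]_n -> labeling n K).
Variables (slv : forall P : sdp R, sdp_point P) (ocost : nat -> nat).
Hypotheses (n0 : (0 < n)%N) (K0 : (0 < K)%N) (Kn : (K %| n)%N).
Hypotheses (D0 : 0 < D) (theta0 : 0 <= theta) (eps0 : 0 <= eps).
Hypotheses (ex : exact_oracle slv) (selP : selector sel).
Implicit Types (A : graph n) (sigma sstar tau : labeling n K).

Local Notation s := (n %/ K)%N.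
Local Notation eta := (eta_of D eps).
Local Notation kappa := (kappa_of K D theta eps).

Definition certificate_passes A sstar : bool :=
  sdp_value (slv (certificate_sdp s A D lam theta (cluster_mx R sstar)))
  + theta / n%:R * \sum_(i < n) \sum_(j < n) cluster_mx R sstar i j
  == Tscore A D lam sstar.

(** The certificate inequality at the cluster matrix of sigma, with the l1 lower bound 2 s h, puts
    the score of sigma at least (theta / n) 2 s h = (2 theta / K) h below that of sigma*; multiplied
    by eta this is kappa h, the origin of the value of kappa. *)
Lemma accept_weight_le1 A sstar sigma : balanced sstar -> certificate_passes A sstar ->
  representative sstar sigma ->
  accept_weight D theta eps lam A sstar (Tscore A D lam sstar) sigma <= 1.
Proof.
move=> bstar /eqP pass /andP[bs /eqP cs].
have [ub _] := certificate_correct A lam theta D0 n0 K0 Kn bstar ex.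
have := ub _ (cluster_certC R K0 n0 Kn bs); rewrite pass -/(Tscore A D lam sigma) => h.
have l1 := l1norm_hamming R K0 n0 Kn bs bstar (fun p => can_fixed_hamming p cs).
have tn : 0 <= theta / n%:R by rewrite divr_ge0.
have := ler_wpM2l tn l1.
have K00 : 0 < K%:R :> R by rewrite ltr0n.
have nE : n%:R = s%:R * K%:R :> R by rewrite -natrM divnK.
have s0 : 0 < s%:R :> R by rewrite sR_gt0.
have -> : theta / n%:R * (2 * s%:R * (hamming sigma sstar)%:R) =
    2 * theta / K%:R * (hamming sigma sstar)%:R.
  by rewrite nE; field; rewrite !gt_eqF.
move=> {}l1; rewrite /accept_weight -[leRHS]expR0 ler_expR.
have -> : eta * (Tscore A D lam sigma - Tscore A D lam sstar) + kappa * (hamming sigma sstar)%:R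
   = eta * (Tscore A D lam sigma + 2 * theta / K%:R * (hamming sigma sstar)%:R - Tscore A D lam sstar).
  by rewrite /kappa_of; ring.
rewrite mulr_ge0_le0 //; first by rewrite divr_ge0 // mulr_ge0 // ltW.
by rewrite subr_le0; apply: le_trans h; rewrite lerD2l.
Qed.

Lemma expected_scores A (l : seq (labeling n K)) f :
  expected_value slv (scores D lam A l) f
  = f (fun tau => if tau \in l then Tscore A D lam tau else 0).
Proof.
elim: l f => [|sigma l IH] f /=; first by [].
rewrite -/(score D lam A sigma) expected_value_bind IH /=.
rewrite score_lp_correct // => [|i j]; last by rewrite mxE ler0n.
congr f; apply/funext => tau; rewrite inE.
by case: eqP => [->|].
Qed.

Lemma gibbsE A tau : gibbs A D lam eta tau =
  if balanced tau then gibbs_weight D eps lam A tau / partition_function K D eps lam A else 0.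
Proof. by []. Qed.

Lemma expected_brute_force A (f : option (labeling n K) -> R) : f None = 0 ->
  expected_value slv (brute_force K D eps lam A) f
  = \sum_(tau : labeling n K | balanced tau)
      gibbs_weight D eps lam A tau / partition_function K D eps lam A * f (Some tau).
Proof.
move=> fN; rewrite /brute_force /= expected_value_bind expected_scores /=.
rewrite [RHS]big_mkcond; apply: eq_bigr => tau _; rewrite /gibbs_of.
case: ifP => bt; last by rewrite mul0r.
rewrite mem_enum inE bt; congr (_ / _ * _).
by apply: eq_bigr => sigma bs; rewrite mem_enum inE bs.
Qed.

(** Both branches have the same law once the truncation at k trials is removed, so the outcome of
    the certificate test leaves no trace in the output. *)
Lemma output_probE A S : output_prob D theta eps lam sel slv A S
  = \sum_(tau in S) gibbs A D lam eta tau.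
Proof.
have G (f : option (labeling n K) -> R) : f None = 0 ->
    limn (fun k => expected_value slv (main_algorithm D theta eps lam sel k A) f)
    = \sum_(tau : labeling n K | balanced tau)
      gibbs_weight D eps lam A tau / partition_function K D eps lam A * f (Some tau).
  move=> fN; rewrite /main_algorithm /=.
  set x := slv _; have [bstar _] := selP A x.1.
  rewrite score_lp_correct // => [|i j]; last by rewrite mxE ler0n.
  rewrite -/(Psi A D lam _) -/(Tscore A D lam (sel A x.1)) -/(certificate_passes A (sel A x.1)).
  case: (boolP (certificate_passes A (sel A x.1))) => pass.
    apply: retry_limit => // sigma; exact: accept_weight_le1.
  under eq_fun => k do rewrite expected_brute_force //.
  exact: lim_cst.
rewrite /output_prob G // big_mkcond [RHS]big_mkcond; apply: eq_bigr => tau _.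
by rewrite gibbsE; case: ifP => _; case: ifP => _; rewrite ?mulr1 ?mulr0.
Qed.

Lemma output_prob1 A tau :
  output_prob D theta eps lam sel slv A [set tau]%SET = gibbs A D lam eta tau.
Proof. by rewrite output_probE big_set1. Qed.

(** A cover for A' becomes one for A by setting q_v = 1 and dropping z on the edges at v; the cost
    grows by at most D. *)
Lemma Hscore_sensitivity A A' (Y : 'M[R]_n) : (forall i j, 0 <= Y i j) ->
  node_adjacent A A' -> Hscore A D Y <= Hscore A' D Y + D.
Proof.
move=> Y0 [v hv]; rewrite -lerBlDr; apply: Hscore_ge => q z [q01 hz].
rewrite lerBlDr.
pose q' i := if i == v then 1 else q i.
pose z' i j := if (i == v) || (j == v) then 0 else z i j.
have f' : lp_feasible A q' z'.
  split=> [i|i j e]; first by rewrite /q'; case: eqP; rewrite ?ler01 ?lexx.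
  have /andP[qi qi1] := q01 i; have /andP[qj qj1] := q01 j; rewrite /z' /q'.
  case: (eqVneq i v) => [_|iv] /=.
    rewrite lexx ler01; split=> //; case: eqP => _; lra.
  case: (eqVneq j v) => [_|jv] /=; first by rewrite lexx ler01; split=> //; lra.
  by apply: hz; rewrite /edge -hv.
apply: (le_trans (Hscore_le D0 Y0 f')); rewrite !cover_valueE -addrA; apply: lerD.
  apply: ler_sum => p _; rewrite /z' /cap /edge.
  case: (boolP ((p.1 == v) || (p.2 == v))) => [_|/norP[h1 h2]].
    rewrite mul0r; case: (boolP (edge A' p.1 p.2)) => e.
      by rewrite -/(edge _ _ _) e mulr_ge0 //; have [/andP[]] := hz _ _ e.
    by rewrite -/(edge A' _ _) (negbTE e) mulr0.
  by rewrite hv.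
have -> : D * \sum_i q i + D = D * (\sum_i q i + 1) by rewrite mulrDr mulr1.
rewrite ler_wpM2l ?(ltW D0) // (bigD1 v) //= [X in _ <= X + _](bigD1 v) //= /q' eqxx.
rewrite [X in 1 + X <= _](eq_bigr q) => [|i /negbTE ->] //.
have /andP[? ?] := q01 v; lra.
Qed.

Lemma node_adjacent_sym A A' : node_adjacent A A' -> node_adjacent A' A.
Proof. by move=> [v hv]; exists v => i j iv jv; rewrite hv. Qed.

Lemma gibbs_weight_sensitivity A A' tau : node_adjacent A A' ->
  gibbs_weight D eps lam A tau <= expR (eps / 2) * gibbs_weight D eps lam A' tau.
Proof.
move=> adj; rewrite /gibbs_weight -expRD ler_expR.
have -> : eps / 2 = eta * D by rewrite /eta_of; field; rewrite gt_eqF.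
rewrite -mulrDr ler_wpM2l ?divr_ge0 ?mulr_ge0 ?(ltW D0) //.
rewrite /Tscore /Psi addrA lerD2r addrC; apply: Hscore_sensitivity => // i j.
by rewrite mxE ler0n.
Qed.

(** One factor exp (eps / 2) comes from the weight and one from the partition function. *)
Lemma output_node_dp : node_dp eps (output_prob D theta eps lam sel slv).
Proof.
move=> A A' S adj; rewrite !output_probE mulr_sumr; apply: ler_sum => tau _.
rewrite !gibbsE; case: ifP => bt; last by rewrite mulr0.
have [sig bsig] : exists sigma, @balanced n K sigma.
  by exists tau.
have pf0 A1 : 0 < partition_function K D eps lam A1 by apply: (partition_function_gt0 _ _ _ _ bsig).
have hpf : partition_function K D eps lam A' <= expR (eps / 2) * partition_function K D eps lam A.
  rewrite /partition_function mulr_sumr; apply: ler_sum => sigma _.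
  exact/gibbs_weight_sensitivity/node_adjacent_sym.
have hw := gibbs_weight_sensitivity tau adj.
rewrite ler_pdivrMr // mulrA -mulrA.
have e2 : expR eps = expR (eps / 2) * expR (eps / 2) by rewrite -expRD; congr expR; lra.
apply: (le_trans hw); rewrite e2 -!mulrA ler_wpM2l ?expR_ge0 //.
rewrite mulrCA ler_peMr ?expR_ge0 //.
rewrite mulrCA mulrC -ler_pdivrMr ?invr_gt0 //.
by rewrite invrK mul1r.
Qed.

End MainLaw.

(** * Runtime *)

Section Runtime.
Variables (R : realType) (n K : nat) (D theta eps lam : R).
Variables (sel : graph n -> 'M[R]_n -> labeling n K).
Variables (slv : forall P : sdp R, sdp_point P) (ocost : nat -> nat).
Hypotheses (n0 : (0 < n)%N) (K0 : (0 < K)%N) (Kn : (K %| n)%N).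
Hypotheses (D0 : 0 < D) (theta0 : 0 <= theta) (eps0 : 0 <= eps).
Hypotheses (ex : exact_oracle slv) (selP : selector sel).
Variable Q : nat.
Hypothesis hQ : forall N, (N <= 27 * n ^ 4)%N -> (N + ocost N <= Q)%N.
Implicit Types (A : graph n) (sigma sstar tau : labeling n K).

Local Notation s := (n %/ K)%N.

Lemma size_Finite_enum (T : finType) : size (Finite.enum T) = #|T|.
Proof. by rewrite -enumT cardE. Qed.

Lemma size_flatten_map (T U : Type) (f : T -> seq U) m (l : seq T) :
  (forall i, size (f i) = m) -> size (flatten (map f l)) = (size l * m)%N.
Proof. by move=> fm; elim: l => //= x l IH; rewrite size_cat fm IH mulSn. Qed.

(** The bounds fit the two factors of [sdp_size] in all three programs; the certificate program
    reaches both of them at n = 1. *)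
Lemma size_product_le a b : (a <= 3 * n ^ 2)%N -> (b <= 9 * n ^ 2)%N ->
  (a * b <= 27 * n ^ 4)%N.
Proof.
move=> ha hb; apply: (leq_trans (leq_mul ha hb)).
by rewrite mulnACA (_ : 3 * 9 = 27)%N // -expnD.
Qed.

Lemma score_lp_size A (Y : 'M[R]_n) : (sdp_size (score_lp A D Y) <= 27 * n ^ 4)%N.
Proof.
rewrite /sdp_size /= !size_cat !size_map !size_Finite_enum.
have c2 : (size [seq p <- enum {: 'I_n * 'I_n} | edge A p.1 p.2] <= n * n)%N.
  by rewrite size_filter (leq_trans (count_size _ _)) // -cardE card_prod card_ord.
rewrite card_sum card_prod card_ord.
by apply: size_product_le; nia.
Qed.

Lemma candidate_sdp_size A : (sdp_size (candidate_sdp R K A) <= 27 * n ^ 4)%N.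
Proof.
rewrite /sdp_size /= !size_cat /= size_allpairs !size_map !size_Finite_enum card_ord card_void.
by apply: size_product_le; nia.
Qed.

Lemma certificate_sdp_size A (Z : 'M[R]_n) :
  (sdp_size (certificate_sdp s A D lam theta Z) <= 27 * n ^ 4)%N.
Proof.
rewrite /sdp_size /= !size_cat /= size_allpairs !size_map !size_Finite_enum.
rewrite !(@size_flatten_map _ _ _ 2) // size_enum_ord card_prod card_ord.
by apply: size_product_le; nia.
Qed.

Lemma propose_time sstar :
  expected_time slv ocost (propose D theta eps sstar) = (n * K.+1)%:R.
Proof.
rewrite /propose.
suff H (l : seq 'I_n) : expected_time slv ocost (foldr (fun i p => bind p (fun sigma =>
     Draw (proposal_weight D theta eps (sstar i)) (fun a => Ret (set_label sigma i a)))) (Ret sstar) l)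
   = (size l * K.+1)%:R.
  by rewrite H size_enum_ord.
elim: l => [|i l IH] //=.
rewrite expected_time_bind IH (expected_proposal (w := fun i => proposal_weight D theta eps (sstar i))); last first.
  by move=> j; apply: proposal_weight_sum.
rewrite (eq_bigr (fun sigma => propose_weight D theta eps sstar sigma * K.+1%:R)); last first.
  move=> sigma _; congr (_ * _) => /=; rewrite card_ord big1 ?addr0 // => a _.
  by rewrite mulr0.
by rewrite -mulr_suml propose_weight_sum // mul1r -natrD mulSn addnC.
Qed.

Definition trial_time_bound : nat :=
  (n * K.+1 + (n + K + (K`! * (3 * n).+1 + n + (Q + 2 * n ^ 2 + (n.+1 + (3 + (K`!.+1 + n)))))))%N.

Lemma trial_time A sstar tstar :
  expected_time slv ocost (trial D theta eps lam A sstar tstar) <= trial_time_bound%:R.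
Proof.
rewrite /trial expected_time_bind propose_time expected_propose // natrD lerD2l.
set B := (X in _ <= X).
apply: (@le_trans _ _ (\sum_sigma propose_weight D theta eps sstar sigma * B)); last first.
  by rewrite -mulr_suml propose_weight_sum // mul1r.
apply: ler_sum => sigma _; rewrite ler_wpM2l ?propose_weight_ge0 //.
rewrite /B /= [leRHS]natrD lerD2l.
case: (balanced sigma) => //=.
rewrite [leRHS]natrD lerD2l.
case: (can sstar sigma == sigma) => //=.
rewrite big_bool /= addr0 mulr0 addr0 card_bool.
rewrite [leRHS]natrD [X in _ <= X + _]natrD -[leRHS]addrA; apply: lerD.
  by rewrite ler_nat; exact/hQ/score_lp_size.
rewrite lerD2l [leRHS]natrD lerD2l [leRHS]natrD lerD2l.
set w := Num.max _ _; have /andP[w0 w1] : 0 <= w <= 1.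
  by rewrite /w le_max lexx ge_max ler01 ge_min lexx.
have cP : #|perm_type 'I_K| = K`! by exact: card_Sn.
rewrite sumr_const cP -[X in _ + X]mulr_natl mulVKf ?pnatr_eq0 -?lt0n ?fact_gt0 //.
by rewrite natrD ler_piMl // addr_ge0.
Qed.

(* The number of trials is geometric with success probability at least
   (1 + 1 / (4 n)) ^ - n, hence at least 1 / 2. *)
Lemma normalizer_pow_ge : ln (4 * n%:R * (K%:R - 1)) <= kappa_of K D theta eps ->
  1 / 2 <= normalizer K D theta eps ^- n.
Proof.
move=> hk; have nR : 0 < n%:R :> R by rewrite ltr0n.
have hc : normalizer K D theta eps <= 1 + (4 * n%:R)^-1.
  rewrite /normalizer lerD2l; move: hk; case: (K) K0 => [//|[|k]] _ hk.
    by rewrite subrr mul0r invr_ge0 mulr_ge0 // ltW.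
  have k1 : 0 < k.+2%:R - 1 :> R by rewrite subr_gt0 ltr1n.
  have p0 : 0 < 4 * n%:R * (k.+2%:R - 1) :> R by rewrite !mulr_gt0.
  have h : expR (- kappa_of k.+2 D theta eps) <= (4 * n%:R * (k.+2%:R - 1))^-1.
    by rewrite expRN lef_pV2 ?posrE ?expR_gt0 // -[leLHS]lnK // ler_expR.
  by apply: (le_trans (ler_wpM2l (ltW k1) h)); rewrite invfM mulrCA mulfV // mulr1.
have c0 := normalizer_gt0 D theta eps K0.
rewrite div1r lef_pV2 ?posrE ?exprn_gt0 //.
apply: (@le_trans _ _ ((1 + (4 * n%:R)^-1) ^+ n)).
  by rewrite lerXn2r ?nnegrE ?(ltW c0).
apply: (@le_trans _ _ (expR (4 * n%:R)^-1 ^+ n)).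
  by rewrite lerXn2r ?nnegrE ?expR_ge0 // expR_ge1Dx.
rewrite -expRM_natl invfM mulrCA mulfV ?gt_eqF // mulr1.
have e : expR (4^-1 : R) * (1 - 4^-1) <= 1.
  rewrite -ler_pdivlMl ?expR_gt0 // mulr1 -expRN.
  by have := expR_ge1Dx (- 4^-1 : R).
by have := expR_ge0 (4^-1 : R); lra.
Qed.

(** Three oracle calls with their bookkeeping, and twice the cost of one trial since the acceptance
    probability is at least 1/2. *)
Definition total_time_bound : nat :=
  (Q + (2 * n ^ 2 + n + (Q + (2 * n ^ 2 + (Q + (2 * n ^ 2 + 2 * trial_time_bound))))))%N.

Lemma certified_runtime A :
  ln (4 * n%:R * (K%:R - 1)) <= kappa_of K D theta eps ->
  certificate_passes D theta lam slv A (sigma_star sel slv A) ->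
  (expected_runtime D theta eps lam sel slv ocost A <= (total_time_bound%:R)%:E)%E.
Proof.
move=> hk pass; apply: ge_ereal_sup => _ [k _ <-]; rewrite lee_fin.
have [bstar _] := selP A (slv (candidate_sdp R K A)).1.
rewrite /main_algorithm /=.
rewrite score_lp_correct // => [|i j]; last by rewrite mxE ler0n.
rewrite -/(sigma_star sel slv A) in bstar *.
rewrite -/(Psi A D lam _) -/(Tscore A D lam (sigma_star sel slv A)).
rewrite -/(certificate_passes D theta lam slv A (sigma_star sel slv A)) pass.
have acc := accept_weight_le1 n0 K0 Kn D0 theta0 eps0 ex bstar pass.
have tt := trial_time A (sigma_star sel slv A) (Tscore A D lam (sigma_star sel slv A)).
have rt := expected_time_retry n0 K0 Kn D0 ex bstar acc k (ler0n _ _) tt.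
have ap := accept_prob_ge D theta eps lam n0 K0 Kn A bstar.
have ap0 := accept_prob_gt0 D theta eps lam K0 A bstar.
have {}rt : expected_time slv ocost
  (retry k (trial D theta eps lam A (sigma_star sel slv A) (Tscore A D lam (sigma_star sel slv A))))
    <= (2 * trial_time_bound)%:R.
  apply: (le_trans rt); rewrite ler_pdivrMr // natrM mulrAC -[leLHS]mul1r ler_wpM2r //.
  by have := normalizer_pow_ge hk; lra.
rewrite /total_time_bound.
rewrite [leRHS]natrD lerD ?ler_nat ?hQ ?candidate_sdp_size // [leRHS]natrD lerD2l.
rewrite [leRHS]natrD lerD ?ler_nat ?hQ ?certificate_sdp_size // [leRHS]natrD lerD2l.
by rewrite [leRHS]natrD lerD ?ler_nat ?hQ ?score_lp_size // [leRHS]natrD lerD2l.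
Qed.

End Runtime.

Lemma total_time_bound_le n K Q : (0 < n)%N -> (K <= n)%N ->
  (total_time_bound n K Q <= 5 * Q + 60 * (n * K`!) + 60 * n ^ 2)%N.
Proof.
move=> n0 Kn; rewrite /total_time_bound /trial_time_bound.
have := fact_gt0 K; move: K`! => F F0; rewrite -!mulnn.
have h1 : (n * K.+1 <= 2 * (n * n))%N by nia.
have h2 : (n <= n * n)%N by nia.
have h3 : (F <= n * F)%N by nia.
have h4 : (F * (3 * n).+1 <= 4 * (n * F))%N by nia.
move: h1 h2 h3 h4; set a := (n * K.+1)%N; set b := (n * n)%N; set c := (n * F)%N.
set e := (F * _)%N; lia.
Qed.

(** * The good event *)

Section Certification.
Variables (R : realType) (n K : nat) (sigma : labeling n K) (A : graph n).
Variables (a b D theta lam rho chi delta : R).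
Hypotheses (n0 : (0 < n)%N) (K0 : (0 < K)%N) (Kn : (K %| n)%N) (bal : balanced sigma).
Hypotheses (a0 : 0 < a) (b0 : 0 <= b) (ba : b <= rho * a) (rho1 : rho < 1).
Hypotheses (deltaE : delta = (1 - rho) / 14) (chi0 : 0 < chi) (chi1 : chi <= (1 - rho) / 8).
Hypotheses (DE : 2 * (a / K%:R) <= D) (thetaE : theta = chi * a) (rho0 : 0 < rho).

Local Notation s := (n %/ K)%N.
Local Notation Z := (cluster_mx R sigma).
Local Notation P := (fun i j => (if sigma i == sigma j then a else b) / n%:R).
Local Notation W := (noise P A).
Local Notation d := (a / K%:R).

Hypothesis spectral : forall x, dot x (x *m W) <= delta * d * dot x x.
Hypothesis columns : forall c j, `|\sum_(k | sigma k == c) W k j| <= delta * d.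

Definition adj_mx : 'M[R]_n := \matrix_(i, j) (val A i j)%:R.

Let nR : 0 < n%:R :> R. Proof. by rewrite ltr0n. Qed.
Let KR : 0 < K%:R :> R. Proof. by rewrite ltr0n. Qed.
Let sR : 0 < s%:R :> R. Proof. exact: sR_gt0. Qed.
Let nE : n%:R = s%:R * K%:R :> R. Proof. by rewrite -natrM divnK. Qed.
Let d0 : 0 < d. Proof. by rewrite divr_gt0. Qed.
Let ds : d / s%:R = a / n%:R. Proof. by rewrite nE; field; rewrite !gt_eqF. Qed.

Let delta0 : 0 < delta. Proof. by rewrite deltaE divr_gt0 ?subr_gt0. Qed.

Lemma certification_gap Y : relaxation K Y ->
  (1 - rho) / 2 * (a / n%:R) * gap sigma Y <= ip adj_mx Z - ip adj_mx Y.
Proof.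
move=> Yr.
have PE : P = fun i j => if sigma i == sigma j then a / n%:R else b / n%:R.
  by apply/funext => i; apply/funext => j; case: ifP.
have b1 : 0 <= b / n%:R by rewrite divr_ge0 // ltW.
have mu0 : 0 <= delta * d.
  by rewrite mulr_ge0 // ltW.
have := @recovery_gap R n K sigma K0 n0 Kn bal A (a / n%:R) (b / n%:R) (delta * d) (delta * d) Y.
rewrite -PE => /(_ Yr b1 mu0 spectral columns); apply: le_trans.
apply: ler_wpM2r; first exact: gap_ge0.
(* One delta from the spectral bound and six from the column sums: 7 delta = (1 - rho) / 2 is half
   of the available gap. *)
have -> : (delta * d + 6 * (delta * d)) / s%:R = 7 * delta * (a / n%:R).
  by rewrite -ds; ring.
have : b / n%:R <= rho * (a / n%:R) by rewrite mulrA ler_pM2r ?invr_gt0.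
rewrite deltaE; have : 0 < a / n%:R by rewrite divr_gt0.
by set x := a / n%:R; set y := b / n%:R => ? ?; lra.
Qed.

Lemma relaxation_optimal Y : relaxation K Y -> ip adj_mx Z <= ip adj_mx Y -> Y = Z.
Proof.
move=> Yr h; apply: gap_eq0 => //; apply/eqP; rewrite eq_le gap_ge0 // andbT.
have := certification_gap Yr; have x0 : 0 < (1 - rho) / 2 * (a / n%:R).
  by rewrite mulr_gt0 ?divr_gt0 // subr_gt0.
by rewrite -(pmulr_rle0 _ x0); lra.
Qed.

Lemma sum_cap (Y : 'M[R]_n) : Y^T = Y -> 2 * \sum_p cap A Y p = ip adj_mx Y.
Proof.
move=> YT; rewrite /ip sum_offdiag => [|i]; last by rewrite mxE graph_irr mul0r.
rewrite mulr_sumr pair_big_dep [RHS]big_mkcond /=; apply: eq_bigr => -[i j] _ /=.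
rewrite /cap /edge /=; case: ltnP => ij /=; last by rewrite mulr0.
have YE : Y j i = Y i j by rewrite -[in LHS]YT mxE.
rewrite !mxE [val A j i]graph_sym YE.
by case: (val A i j); rewrite /= ?mulr1n ?mulr0n; ring.
Qed.

Lemma certC_upper_sum (Y : 'M[R]_n) : certC s Y -> 2 * upper_sum Y = n%:R * s%:R - n%:R.
Proof.
move=> [[YT _] Y1 _ Ys].
have := sum_diag_upper (fun i j => Y i j).
rewrite (eq_bigr (fun=> s%:R)) => [|i _]; last exact: Ys.
rewrite [X in _ = X + _](eq_bigr (fun=> 1)) => [|i _]; last exact: Y1.
rewrite !sumr_const card_ord => h.
have -> : 2 * upper_sum Y = \sum_(i < n) \sum_(j < n | (i < j)%N) (Y i j + Y j i).
  rewrite /upper_sum mulr_sumr; apply: eq_bigr => i _; rewrite mulr_sumr.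
  apply: eq_bigr => j _; have -> : Y j i = Y i j by rewrite -[in LHS]YT mxE.
  by ring.
by rewrite [n%:R * _]mulr_natl h addrAC subrr add0r.
Qed.

(** The load at i is its degree inside its own cluster: a mean of at most d, plus a column deviation
    of at most delta d, so at most 2 d <= D. *)
Lemma cluster_load i : load (cap A Z) i <= D.
Proof.
have -> : load (cap A Z) i = \sum_(k | sigma k == sigma i) (val A k i)%:R.
  rewrite /load -(pair_bigA _ (fun x y => ((x == i)%:R + (y == i)%:R) * cap A Z (x, y))) /=.
  rewrite sum_offdiag; last by move=> x; rewrite /cap /edge ltnn mulr0.
  rewrite [RHS]big_mkcond /=.
  pose F x y : R := (x == i)%:R * (if (sigma x == sigma y) then (val A x y)%:R else 0).
  transitivity (\sum_x \sum_y F x y).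
    rewrite [RHS]sum_offdiag => [|x]; last by rewrite /F graph_irr; case: ifP; rewrite mulr0.
    apply: eq_bigr => x _; apply: eq_bigr => y xy; rewrite /F /cap /edge /= xy.
    rewrite [(y < x)%N]ltnNge (ltnW xy) /= mulr0 addr0 !mxE [val A y x]graph_sym [sigma y == _]eq_sym.
    by case: (val A x y); case: (sigma x == sigma y); rewrite ?mulr1n ?mulr0n; ring.
  rewrite (bigD1 i) //= [X in _ + X]big1 => [|x /negbTE xi]; last first.
    by rewrite big1 // => y _; rewrite /F xi mul0r.
  rewrite addr0; apply: eq_bigr => y _; rewrite /F eqxx mul1r eq_sym.
  by rewrite [val A i y]graph_sym.
apply: le_trans DE.
have hc := columns (sigma i) i.
have : \sum_(k | sigma k == sigma i) (val A k i)%:R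
    <= \sum_(k | sigma k == sigma i) W k i + \sum_(k | sigma k == sigma i) a / n%:R.
  rewrite -big_split /=; apply: ler_sum => k /eqP ki; rewrite mxE ki eqxx.
  (* On the diagonal the adjacency and noise entries both vanish, and what remains is 0 <= a / n. *)
  case: eqP => [->|_]; rewrite /=; last by rewrite subrK.
  by rewrite graph_irr add0r divr_ge0 ?ltW.
rewrite sumr_const (_ : #|_| = s); last first.
  by rewrite -(card_cluster bal (sigma i)); apply: eq_card => k; rewrite !inE.
have -> : a / n%:R *+ s = d by rewrite -[_ *+ s]mulr_natl nE; field; rewrite !gt_eqF.
have := ler_norm (\sum_(k | sigma k == sigma i) W k i).
have r0 := rho0.
have : delta * d <= d by rewrite ler_piMl ?(ltW d0) // deltaE; lra.
by move: hc; set S := \sum_(k | _) _; set T := \sum_(k | _) _; lra.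
Qed.

Let D0 : 0 < D.
Proof. by apply: lt_le_trans DE; rewrite mulr_gt0. Qed.

(** The cover with q = 0 and z = 1 counts every edge once, whereas the inner product counts it
    twice. *)
Lemma Hscore_le_half (Y : 'M[R]_n) : Y^T = Y -> (forall i j, 0 <= Y i j) ->
  2 * Hscore A D Y <= ip adj_mx Y.
Proof.
move=> YT Y0; rewrite -sum_cap // ler_wpM2l //.
have f : lp_feasible A (fun=> 0) (fun _ _ => 1 : R).
  by split=> [i|i j _]; rewrite ?lexx ?ler01 //; split=> //; lra.
apply: (le_trans (Hscore_le D0 Y0 f)); rewrite cover_valueE.
rewrite [X in D * X]big1 // mulr0 addr0.
by apply: ler_sum => p _; rewrite mul1r.
Qed.

(** By [cluster_load] the capacities of Z form a packing themselves, and weak duality applies. *)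
Lemma Hscore_cluster : ip adj_mx Z <= 2 * Hscore A D Z.
Proof.
rewrite -sum_cap ?cluster_mx_tr // ler_wpM2l //; apply: Hscore_ge => q z.
apply: packing_le_cover; split=> [p|]; last exact: cluster_load.
rewrite lexx andbT; apply: cap_ge0 => i j; by rewrite mxE ler0n.
Qed.

(** All points of [certC] have the same penalty. Half of the gap in <A, Y>, namely (1 - rho) / 4
    times (a / n) gap, passes to H, and the l1 term 2 chi (a / n) gap does not exceed it. *)
Lemma certificate_bound Y : certC s Y ->
  Psi A D lam Y + theta / n%:R * l1norm (Y - Z) <= Psi A D lam Z.
Proof.
move=> Yc; have [[YT _] _ Y0 _] := Yc.
have Zc := cluster_certC R K0 n0 Kn bal.
have us : upper_sum Y = upper_sum Z.
  by have := certC_upper_sum Yc; have := certC_upper_sum Zc; lra.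
have Yr := certC_relaxation Yc.
rewrite /Psi us (certC_l1norm bal Yc) addrAC lerD2r.
have g0 := gap_ge0 sigma Yr.
have := certification_gap Yr; have := Hscore_le_half YT Y0; have := Hscore_cluster.
have x0 : 0 < a / n%:R by rewrite divr_gt0.
have : theta / n%:R * (2 * gap sigma Y) <= (1 - rho) / 4 * (a / n%:R) * gap sigma Y.
  have -> : theta / n%:R * (2 * gap sigma Y) = 2 * chi * ((a / n%:R) * gap sigma Y).
    by rewrite thetaE; ring.
  rewrite -[leRHS]mulrA; apply: ler_wpM2r; first by rewrite mulr_ge0 ?(ltW x0).
  have aux (c r : R) : c <= (1 - r) / 8 -> 2 * c <= (1 - r) / 4 by move=> h; lra.
  exact: aux chi1.
by set x := a / n%:R; lra.
Qed.

Lemma Vcert_cluster : Vcert s A D lam theta Z = Psi A D lam Z.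
Proof.
have Zc := cluster_certC R K0 n0 Kn bal.
have l0 : l1norm (Z - Z) = 0.
  by rewrite subrr /l1norm big1 // => i _; rewrite big1 // => j _; rewrite mxE normr0.
apply/eqP; rewrite eq_le; apply/andP; split.
  apply: ge_sup; first by exists (Psi A D lam Z + theta / n%:R * l1norm (Z - Z)), Z.
  by move=> _ [Y [Yc ->]]; apply: certificate_bound.
apply: ub_le_sup; last by exists Z; rewrite l0 mulr0 addr0.
by exists (Psi A D lam Z) => _ [Y [Yc ->]]; apply: certificate_bound.
Qed.

Lemma candidate_feasibleP (y : sdp_point (candidate_sdp R K A)) : sdp_feasible y <->
  [/\ psd y.1, forall i, \sum_j y.1 i j <= 1, \tr y.1 = K%:R & forall i j, 0 <= y.1 i j].
Proof.
have lf M w : linform (P := candidate_sdp R K A) M w y = ip M y.1.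
  rewrite linformE [X in _ + X]big1 ?addr0 // => -[].
have tE : ip 1%:M y.1 = \tr y.1 by rewrite ip_trace mul1mx mxtrace_tr.
rewrite /sdp_feasible; cbn [candidate_sdp scons sdim svar]; rewrite !all_cat.
split.
  move=> [Yp /andP[/allP h1 /andP[/and3P[h2 h3 _] /allP h4]]].
  split=> //.
  - move=> i; have := h1 _ (map_f _ (mem_enum _ i)); by rewrite lf ip_row_mx1.
  - by move: h2 h3; rewrite !lf ipNl tE lerN2 => h2 h3; apply/eqP; rewrite eq_le h2.
  - move=> i j; have := h4 (- delta_mx i j, (fun=> 0), 0); rewrite lf ipNl ip_delta oppr_le0.
    by apply; apply/allpairsP; exists (i, j); rewrite !mem_enum.
move=> [Yp Y1 Yt Y0]; split=> //; apply/and3P; split.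
- by apply/allP => c /mapP[i _ ->]; rewrite lf ip_row_mx1.
- by apply/and3P; split; rewrite // lf ?ipNl tE Yt.
- by apply/allP => c /allpairsP[[i j] [_ _ ->]]; rewrite lf ipNl ip_delta oppr_le0.
Qed.

Lemma candidate_value (y : sdp_point (candidate_sdp R K A)) : sdp_value y = ip adj_mx y.1.
Proof. by rewrite /sdp_value linformE [X in _ + X]big1 ?addr0 // => -[]. Qed.

Lemma psdZ c (Y : 'M[R]_n) : 0 <= c -> psd Y -> psd (c *: Y).
Proof.
move=> c0 Yp; apply: psd_intro => [|u]; first by rewrite linearZ /= Yp.1.
by rewrite -scalemxAr dotZr mulr_ge0 // psd_dot.
Qed.

Lemma candidate_relaxation (y : sdp_point (candidate_sdp R K A)) :
  sdp_feasible y <-> relaxation K (s%:R *: y.1).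
Proof.
rewrite candidate_feasibleP; split=> [[Yp Y1 Yt Y0]|[Yp Y0 Y1 Yt]].
  split.
  - by apply: psdZ => //; exact: ltW.
  - by move=> i j; rewrite mxE mulr_ge0 // ltW.
  - move=> i; under eq_bigr do rewrite mxE.
    by rewrite -mulr_sumr ler_piMr // ltW.
  - by rewrite mxtraceZ Yt nE.
have yE : y.1 = s%:R^-1 *: (s%:R *: y.1) by rewrite scalerA mulVf ?scale1r // gt_eqF.
split.
- by rewrite yE; apply: psdZ => //; rewrite invr_ge0 ltW.
- move=> i; rewrite -(ler_pM2l sR) mulr1 mulr_sumr; apply: le_trans (Y1 i).
  by apply: ler_sum => j _; rewrite mxE.
- move: Yt; rewrite mxtraceZ nE => /(mulfI _); apply; by rewrite gt_eqF.
- by move=> i j; have := Y0 i j; rewrite mxE pmulr_rge0.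
Qed.

Variables (sel : graph n -> 'M[R]_n -> labeling n K) (slv : forall P : sdp R, sdp_point P).
Hypotheses (ex : exact_oracle slv) (selP : selector sel).

(** Z / s is the only optimum of the candidate program, so the oracle returns it and the selector
    has to recognize it. Only the cluster matrices are compared, as the labels are determined only
    up to a permutation. *)
Lemma sigma_star_cluster : cluster_mx R (sigma_star sel slv A) = Z.
Proof.
have Zr := certC_relaxation (cluster_certC R K0 n0 Kn bal).
have sZ (M : 'M[R]_n) : s%:R *: (s%:R^-1 *: M) = M by rewrite scalerA mulfV ?scale1r // gt_eqF.
pose y0 : sdp_point (candidate_sdp R K A) := (s%:R^-1 *: Z, fun v : void => match v with end).
have y0F : sdp_feasible y0 by apply/candidate_relaxation; rewrite sZ.
have opt : sdp_optimal y0.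
  split=> // y /candidate_relaxation yr; rewrite !candidate_value /= ipZr.
  rewrite -(ler_pM2l sR) mulrA mulfV ?gt_eqF // mul1r -ipZr.
  have := certification_gap yr; have := gap_ge0 sigma yr => g0.
  have : 0 <= (1 - rho) / 2 * (a / n%:R) * gap sigma (s%:R *: y.1).
    by rewrite mulr_ge0 // mulr_ge0 ?divr_ge0 ?subr_ge0 ?(ltW rho1) ?(ltW a0) ?(ltW nR).
  lra.
have [xF xmax] := ex (ex_intro _ y0 opt).
set x := slv _ in xF xmax.
have xr : relaxation K (s%:R *: x.1) by apply/candidate_relaxation.
have xZ : s%:R *: x.1 = Z.
  apply: relaxation_optimal => //; have := xmax y0 y0F.
  rewrite !candidate_value /= !ipZr => h.
  by rewrite -ler_pdivrMl.
have [bs] := selP A x.1; rewrite xZ => /(_ (ex_intro _ sigma (conj bal erefl))) => h.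
by rewrite /sigma_star -/x -h.
Qed.

Lemma good_certified : certified D theta lam sel slv A.
Proof. by rewrite /certified sigma_star_cluster Vcert_cluster. Qed.

Lemma good_passes : certificate_passes D theta lam slv A (sigma_star sel slv A).
Proof.
have [bs _] := selP A (slv (candidate_sdp R K A)).1.
have [_ h] := certificate_correct A lam theta D0 n0 K0 Kn bs ex.
rewrite /certificate_passes h -/(sigma_star sel slv A) /Tscore.
by rewrite sigma_star_cluster Vcert_cluster.
Qed.

End Certification.

(** The column sum is a linear form in the independent entries above the diagonal, with variance at
    most (n / K) p0; Markov's inequality for the exponentials of both signs gives the factor 2. *)
Lemma column_tail (R : realType) (n K : nat) (sigma : labeling n K)
    (P : 'I_n -> 'I_n -> R) (p0 delta : R) (c : 'I_K) (j : 'I_n) :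
  balanced sigma -> (forall i j, P i j = P j i) -> (forall i j, 0 <= P i j <= p0) ->
  p0 <= 1 -> 0 < delta <= 1 ->
  gprob P (fun A => delta * ((n %/ K)%:R * p0) < `|\sum_(k | sigma k == c) noise P A k j|)
    <= 2 * expR (- (delta ^+ 2 / 8 * ((n %/ K)%:R * p0))).
Proof.
move=> bs PC Pp p01 /andP[d0 d1].
have P01 : prob_mx P by move=> x y; have /andP[-> h] := Pp x y; rewrite (le_trans h p01).
set s := (n %/ K)%:R : R; set m := s * p0.
have p00 : 0 <= p0 by have /andP[h1 h2] := Pp j j; apply: le_trans h2.
pose w : 'rV[R]_n := \row_k (sigma k == c)%:R.
pose x : 'rV[R]_n := delta_mx 0 j.
have SE A : \sum_(k | sigma k == c) noise P A k j =
    upper_lin P (fun i l => x 0 i * w 0 l + x 0 l * w 0 i) A.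
  rewrite -dot_noise // dot_delta_l mxE big_mkcond; apply: eq_bigr => k _.
  by rewrite [w 0 k]mxE; case: eqP; rewrite ?mul1r ?mul0r.
pose co (i l : 'I_n) : R := x 0 i * w 0 l + x 0 l * w 0 i.
have x01 i : x 0 i = (i == j)%:R by rewrite mxE eqxx.
have w01 i : w 0 i = (sigma i == c)%:R by rewrite mxE.
have co2 i l : 0 <= co i l <= 2.
  rewrite /co !x01 !w01 -!natrM -natrD ler0n ler_nat.
  by do 4! case: (_ == _).
have cosq : \sum_(i < n) \sum_(l < n | (i < l)%N) co i l ^+ 2 * P i l <= m.
  apply: (@le_trans _ _ (\sum_(i < n) \sum_(l < n | (i < l)%N)
      (x 0 i * w 0 l * p0 + x 0 l * w 0 i * p0))).
    apply: ler_sum => i _; apply: ler_sum => l il.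
    have /andP[q0 q1] := Pp i l.
    apply: (@le_trans _ _ (co i l ^+ 2 * p0)); first by rewrite ler_wpM2l ?sqr_ge0.
    rewrite -mulrDl ler_wpM2r // /co !x01 !w01.
    (* As i < l, at most one of the two terms of the coefficient is nonzero, so the coefficient
       equals its square. *)
    have : ~~ ((i == j) && (l == j)).
      by apply/negP => /andP[/eqP E1 /eqP E2]; rewrite E1 E2 ltnn in il.
    rewrite -!natrM -!natrD -natrX ler_nat.
    by case: (i == j); case: (l == j) => //= _; case: (_ == _); case: (_ == _).
  have := sum_diag_upper (fun i l => x 0 i * w 0 l * p0) => E.
  apply: (@le_trans _ _ (\sum_i \sum_l x 0 i * w 0 l * p0)).
    rewrite E lerDr sumr_ge0 // => i _.
    by rewrite !mulr_ge0 // ?x01 ?w01 ler0n.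
  rewrite (bigD1 j) //= [X in _ + X]big1 ?addr0 => [|i /negbTE ij]; last first.
    by rewrite big1 // => l _; rewrite x01 ij !mul0r.
  rewrite -mulr_suml /m /s ler_wpM2r // -(balanced_card c bs).
  rewrite -sum1_card natr_sum [leRHS]big_mkcond /=; apply: ler_sum => l _.
  by rewrite x01 eqxx mul1r w01 inE; case: eqP.
have mgf t : `|t| <= delta / 4 ->
    gexp P (fun A => expR (t * \sum_(k | sigma k == c) noise P A k j)) <= expR (2 * t ^+ 2 * m).
  move=> td.
  rewrite (_ : (fun A => _) = fun A => expR (upper_lin P (fun i l => t * co i l) A)).
    apply: (le_trans (gexp_expR_variance P01 _)).
      move=> i l; rewrite normrM; have /andP[h1 h2] := co2 i l; rewrite (ger0_norm h1).
      have := normr_ge0 t; nra.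
    rewrite ler_expR -mulrA ler_wpM2l //.
    under eq_bigr => i _ do under eq_bigr => l _ do rewrite exprMn -mulrA.
    under eq_bigr => i _ do rewrite -mulr_sumr.
    by rewrite -mulr_sumr ler_wpM2l ?sqr_ge0.
  apply/funext => A; rewrite SE /upper_lin mulr_sumr; congr (expR _).
  by apply: eq_bigr => i _; rewrite mulr_sumr; apply: eq_bigr => l _; rewrite mulrA.
(* The minimizer of 2 t ^ 2 m - t delta m; it is admissible because the coefficients are at most 2
   and delta <= 1. *)
pose t := delta / 4.
have t0 : 0 < t by rewrite divr_gt0.
have c0 : 0 < expR (t * (delta * m)) by apply: expR_gt0.
apply: (le_trans (@gprob_markov _ _ P _ (fun A => expR (t * \sum_(k | sigma k == c) noise P A k j)
   + expR (- t * \sum_(k | sigma k == c) noise P A k j)) _ P01 c0 _ _)).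
- by move=> A; rewrite addr_ge0 ?expR_ge0.
- move=> A; rewrite ltr_normr => /orP[h|h].
    apply: (@le_trans _ _ (expR (t * \sum_(k | sigma k == c) noise P A k j))).
      by rewrite ler_expR ler_wpM2l ?(ltW t0) ?ltW.
    by rewrite lerDl expR_ge0.
  apply: (@le_trans _ _ (expR (- t * \sum_(k | sigma k == c) noise P A k j))).
    by rewrite ler_expR mulNr -mulrN ler_wpM2l ?(ltW t0) ?ltW.
  by rewrite lerDr expR_ge0.
rewrite gexpD ler_pdivrMr // -[leRHS]mulrA -expRD.
have h1 : `|t| <= delta / 4 by rewrite gtr0_norm.
have h2 : `|- t| <= delta / 4 by rewrite normrN.
have e1 := mgf _ h1; have e2 := mgf _ h2; rewrite sqrrN in e2.
have -> : - (delta ^+ 2 / 8 * m) + t * (delta * m) = 2 * t ^+ 2 * m by rewrite /t; field.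
lra.
Qed.

Section BadEvents.
Variables (R : realType) (n K : nat) (sigma : labeling n K) (a b delta : R).

Definition edge_prob (i j : 'I_n) : R := (if sigma i == sigma j then a else b) / n%:R.

Definition bad_event (e : option ('I_n * 'I_K)) : pred (graph n) :=
  match e with
  | None => spectral_bad edge_prob (delta * (a / K%:R))
  | Some (j, c) => fun A => delta * (a / K%:R) < `|\sum_(k | sigma k == c) noise edge_prob A k j|
  end.

Lemma sbm_probE E : sbm_prob sigma a b E = gprob edge_prob E.
Proof. by []. Qed.

Lemma good_events A : (forall e, ~~ bad_event e A) ->
  (forall x, dot x (x *m noise edge_prob A) <= delta * (a / K%:R) * dot x x) /\
  (forall c j, `|\sum_(k | sigma k == c) noise edge_prob A k j| <= delta * (a / K%:R)).
Proof.
move=> good; split=> [x|c j]; last first.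
  by have := good (Some (j, c)); rewrite /= -leNgt.
have [x0|xn0] := eqVneq (dot x x) 0.
  rewrite x0 mulr0 (dot_eq0 x0) mul0mx.
  by rewrite dotE big1 // => i _; rewrite !mxE mul0r.
rewrite leNgt; apply/negP => h; have /negP := good None; apply.
by apply/asboolP; exists x; rewrite lt_def xn0 dot_ge0 ltW.
Qed.

Lemma bad_events_prob (k : nat) :
  (0 < n)%N -> (0 < K)%N -> (K %| n)%N -> balanced sigma ->
  0 < a -> 0 <= b <= a -> a / n%:R <= 1 -> 0 < delta <= 1 -> (0 < k)%N -> a <= k%:R ->
  \sum_e gprob edge_prob (bad_event e) <=
    2 * n%:R * (9 * third_const R * k%:R / (delta * (a / K%:R)) ^+ 2) ^+ k
    + 2 * (n * K)%:R * expR (- (delta ^+ 2 / 8 * (a / K%:R))).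
Proof.
move=> n0 K0 Kn bs a0 /andP[b0 ba] an d01 k0 ak.
have nR : 0 < n%:R :> R by rewrite ltr0n.
have KR : 0 < K%:R :> R by rewrite ltr0n.
have PC i j : edge_prob i j = edge_prob j i by rewrite /edge_prob eq_sym.
have Pp i j : 0 <= edge_prob i j <= a / n%:R.
  rewrite /edge_prob ler_pM2r ?invr_gt0 //; case: ifP => _.
    by rewrite lexx divr_ge0 // ltW.
  by rewrite ba divr_ge0 // ltW.
have sE : (n %/ K)%:R * (a / n%:R) = a / K%:R.
  have nE : n%:R = (n %/ K)%:R * K%:R :> R by rewrite -natrM divnK.
  have s0 : 0 < (n %/ K)%:R :> R by rewrite sR_gt0.
  by rewrite nE; field; rewrite !gt_eqF.
have D0 : 0 < delta * (a / K%:R) by have /andP[? _] := d01; rewrite mulr_gt0 ?divr_gt0.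
rewrite (bigD1 None) //=; apply: lerD.
  apply: (noise_spectral n0 k0 PC Pp an) => //.
  by rewrite mulrCA mulfV ?gt_eqF // mulr1.
rewrite (reindex_omap Some id) /=; last by case.
rewrite (eq_bigl xpredT); last by move=> e /=; rewrite eqxx.
apply: (@le_trans _ _ (\sum_(e : 'I_n * 'I_K) 2 * expR (- (delta ^+ 2 / 8 * (a / K%:R))))).
  apply: ler_sum => -[j c] _ /=; rewrite -sE.
  exact: column_tail.
rewrite sumr_const card_prod !card_ord -[leLHS]mulr_natl mulrA le_eqVlt; apply/orP; left; apply/eqP.
by ring.
Qed.

End BadEvents.

Lemma third_const_gt0 (R : realType) : 0 < third_const R.
Proof. by rewrite !mulr_gt0 ?expR_gt0 ?exprn_gt0. Qed.

Lemma half_le_ln2 (R : realType) : 1 / 2 <= ln (2 : R).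
Proof.
rewrite -ler_expR lnK ?posrE //.
have h : expR (1 / 2 : R) * (1 - 1 / 2) <= 1.
  rewrite -ler_pdivlMl ?expR_gt0 // mulr1 -expRN.
  by have := expR_ge1Dx (- (1 / 2) : R); lra.
by lra.
Qed.

Lemma powR_expR (R : realType) (x y : R) : 0 < x -> x `^ y = expR (y * ln x).
Proof. by move=> x0; rewrite /powR gt_eqF. Qed.

(** [e0] is such that k <= e0 d ^ 2 brings the base of the spectral tail down to exp (- 3); with k
    >= ln n this leaves 2 n n ^ (-3) <= 1 / n. For the columns, A0 c1 >= 4 lets half of the exponent
    absorb the factor 2 n K. *)
Lemma bad_events_bound (R : realType) (n K : nat) (sigma : labeling n K)
    (a b delta Cmg A0 : R) :
  let c1 := delta ^+ 2 / 8 in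
  let e0 := delta ^+ 2 * expR (- 3) / (9 * third_const R) in
  1 + 4 / c1 + (4 + 2 * Cmg) / e0 <= A0 ->
  (2 < n)%N -> 1 <= ln (n%:R : R) -> (0 < K)%N -> (K %| n)%N -> balanced sigma ->
  0 < delta <= 1 -> 0 < Cmg ->
  K%:R * ln K%:R <= Cmg * ln n%:R -> A0 * ln (n * K)%:R <= a / K%:R ->
  0 < a -> 0 <= b <= a -> a / n%:R <= 1 ->
  \sum_e gprob (edge_prob sigma a b) (bad_event sigma a b delta e)
    <= n%:R `^ (- (c1 / 2)) + (n * K)%:R `^ (- (c1 / 2 * A0)).
Proof.
move=> c1 e0 hA n2 ln1 K0 Kn bs d01 C0 hK ha a0 hb an.
have /andP[dp d1] := d01.
have n0 : (0 < n)%N by apply: ltn_trans n2.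
have nR : 0 < n%:R :> R by rewrite ltr0n.
have KR : 0 < K%:R :> R by rewrite ltr0n.
have nKR : 0 < (n * K)%:R :> R by rewrite ltr0n muln_gt0 n0.
have T0 := third_const_gt0 R.
have c10 : 0 < c1 by rewrite divr_gt0 ?exprn_gt0.
have dq : delta ^+ 2 <= 1 by rewrite exprn_ile1 // ltW.
have c1le : c1 <= 1 by rewrite /c1; lra.
have e00 : 0 < e0 by rewrite divr_gt0 ?mulr_gt0 ?expR_gt0 ?exprn_gt0.
have f1 : 0 <= 4 / c1 by rewrite divr_ge0 // ltW.
have f2 : 0 <= (4 + 2 * Cmg) / e0 by apply: divr_ge0; [lra|exact: ltW].
have [A1 A2 A3] : [/\ 1 <= A0, 4 / c1 <= A0 & (4 + 2 * Cmg) / e0 <= A0].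
  by move: hA f1 f2; move: (4 / c1) (_ / e0) => u v *; split; lra.
set d := a / K%:R in ha *.
set l := ln (n%:R : R) in ln1 hK *; set L := ln ((n * K)%:R : R) in ha *.
have lL : l <= L by rewrite ler_ln ?posrE // ler_nat leq_pmulr.
have hl : A0 * l <= d by apply: le_trans ha; rewrite ler_wpM2l //; lra.
have d1' : 1 <= d by apply: le_trans hl; nra.
have dpos : 0 < d by lra.
(* For K >= 2, ln K >= 1/2 and Assumption 1 gives K <= 2 Cmg ln n; the summand 1 covers K = 1, where
   ln n >= 1 suffices. *)
have hKl : K%:R <= (1 + 2 * Cmg) * l.
  case: (ltngtP K 1) K0 => [|K1 _|-> _]; first by case: (K).
    have : 1 / 2 <= ln (K%:R : R).
      by apply: (le_trans (half_le_ln2 R)); rewrite ler_ln ?posrE // ler_nat.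
    have := ltW KR; nra.
  nra.
(* Just above a + ln n: the trace comparison needs k >= a, and the final power needs k >= ln n. *)
pose k := ((Num.truncn a).+1 + (Num.truncn l).+1)%N.
have l0 : 0 <= l by lra.
have /andP[ta1 ta2] := truncn_itv (ltW a0).
have /andP[tl1 tl2] := truncn_itv l0.
have kE : k%:R = (Num.truncn a)%:R + 1 + ((Num.truncn l)%:R + 1) :> R.
  by rewrite /k natrD -!natr1.
have ak : a <= k%:R by rewrite kE; move: ta2; rewrite -natr1; have := ler0n R (Num.truncn l); lra.
have aE : a = K%:R * d by rewrite /d mulrCA mulfV ?mulr1 // gt_eqF.
(* k <= a + l + 2 <= a + 3 l; in units of d ^ 2 / A0 the two terms are at most 1 + 2 Cmg and 3,
   which explains the numerator 4 + 2 Cmg. *)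
have ke : k%:R <= e0 * d ^+ 2.
  have A0pos : 0 < A0 by lra.
  apply: (@le_trans _ _ ((4 + 2 * Cmg) * (d ^+ 2 / A0))).
    have ld : l <= d / A0 by rewrite ler_pdivlMr // mulrC.
    have h1 : a <= (1 + 2 * Cmg) * (d ^+ 2 / A0).
      rewrite aE; apply: (@le_trans _ _ ((1 + 2 * Cmg) * l * d)).
        by rewrite ler_wpM2r // ltW.
      have -> : (1 + 2 * Cmg) * (d ^+ 2 / A0) = (1 + 2 * Cmg) * (d / A0) * d by ring.
      by rewrite ler_wpM2r ?(ltW dpos) // ler_wpM2l //; lra.
    have h2 : d / A0 <= d ^+ 2 / A0.
      by rewrite ler_wpM2r ?invr_ge0 ?(ltW A0pos) // expr2 ler_peMr // ltW.
    have -> : (4 + 2 * Cmg) * (d ^+ 2 / A0) = (1 + 2 * Cmg) * (d ^+ 2 / A0) + 3 * (d ^+ 2 / A0) by ring.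
    lra.
  rewrite mulrA ler_pdivrMr // mulrAC ler_wpM2r ?sqr_ge0 //.
  by rewrite [e0 * A0]mulrC -ler_pdivrMr.
have dd : 0 < (delta * d) ^+ 2 by rewrite exprn_gt0 // mulr_gt0.
have := bad_events_prob n0 K0 Kn bs a0 hb an d01 (k := k) isT ak.
rewrite -/d; move=> /le_trans; apply; apply: lerD.
  have X : 9 * third_const R * k%:R / (delta * d) ^+ 2 <= expR (- 3).
    rewrite ler_pdivrMr //.
    apply: (@le_trans _ _ (9 * third_const R * (e0 * d ^+ 2))).
      by rewrite ler_wpM2l // mulr_ge0 // ltW.
    rewrite /e0 [(delta * d) ^+ 2]exprMn le_eqVlt; apply/orP; left; apply/eqP.
    move: (third_const R) T0 (expR (- 3)) => T T0 E.
    by field; rewrite gt_eqF.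
  have X0 : 0 <= 9 * third_const R * k%:R / (delta * d) ^+ 2.
    by rewrite divr_ge0 ?sqr_ge0 // !mulr_ge0 // ltW.
  have Xk : (9 * third_const R * k%:R / (delta * d) ^+ 2) ^+ k <= expR (- 3 * l).
    apply: (@le_trans _ _ (expR (- 3) ^+ k)).
      rewrite lerXn2r ?nnegrE ?expR_ge0 //.
    by rewrite -expRM_natl ler_expR; lra.
  rewrite powR_expR // -/l.
  have nE : n%:R = expR l :> R by rewrite lnK ?posrE.
  apply: (@le_trans _ _ (expR l * expR l * expR (- 3 * l))).
    have h2n : 2 * n%:R <= expR l * expR l :> R.
      by rewrite -nE ler_wpM2r ?(ltW nR) // ler_nat ltnW.
    have xk0 : 0 <= (9 * third_const R * k%:R / (delta * d) ^+ 2) ^+ k by rewrite exprn_ge0.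
    by apply: (ler_pM _ xk0 h2n Xk); rewrite mulr_ge0 // ltW.
  rewrite -!expRD ler_expR; nra.
rewrite powR_expR // -/L.
have nE : (n * K)%:R = expR L :> R by rewrite lnK ?posrE.
have two : 2 <= expR L :> R.
  by rewrite -nE ler_nat (leq_trans (ltnW n2)) // leq_pmulr.
apply: (@le_trans _ _ (expR L * expR L * expR (- (c1 * (A0 * L))))).
  have h2n : 2 * (n * K)%:R <= expR L * expR L :> R by rewrite nE ler_wpM2r ?expR_ge0.
  apply: ler_pM; rewrite ?expR_ge0 ?mulr_ge0 ?(ltW nKR) //.
  by rewrite ler_expR lerN2 ler_wpM2l ?(ltW c10).
rewrite -!expRD ler_expR.
have : 4 <= A0 * c1 by rewrite -ler_pdivrMr.
nra.
Qed.

(** The oracle, on programs of size at most 27 n ^ 4, accounts for the exponent 4 (dg + 1); the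
    canonical test accounts for 1 + Cmg, as K! <= K ^ K = exp (K ln K) <= n ^ Cmg. *)
Lemma runtime_poly (R : realType) (n K co dg : nat) (Cmg : R) :
  (0 < n)%N -> (0 < K)%N -> (K <= n)%N -> 0 < Cmg -> K%:R * ln K%:R <= Cmg * ln n%:R ->
  (total_time_bound n K (27 * n ^ 4 + co * (27 * n ^ 4).+1 ^ dg))%:R
    <= (5 * (27 + co * 28 ^ dg) + 120)%:R * n%:R `^ (4 * dg.+1%:R + Cmg + 1) :> R.
Proof.
move=> n0 K0 Kn C0 hK.
have nR : 0 < n%:R :> R by rewrite ltr0n.
have KR : 0 < K%:R :> R by rewrite ltr0n.
have n1 : 1 <= n%:R :> R by rewrite ler1n.
set al := 4 * dg.+1%:R + Cmg + 1.
have d1 : 1 <= dg.+1%:R :> R by rewrite ler1n.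
have mono x : x <= al -> n%:R `^ x <= n%:R `^ al by move=> h; apply: ler_powR.
have powN m : (m%:R : R) <= al -> (n ^ m)%:R <= n%:R `^ al.
  by move=> h; rewrite natrX -powR_mulrn ?(ltW nR) //; apply: mono.
have hQ : (27 * n ^ 4 + co * (27 * n ^ 4).+1 ^ dg)%:R <= (27 + co * 28 ^ dg)%:R * n%:R `^ al.
  apply: (@le_trans _ _ ((27 + co * 28 ^ dg) * n ^ (4 * dg.+1))%:R).
    rewrite ler_nat mulnDl leq_add //.
      by rewrite leq_mul2l /= leq_pexp2l // leq_pmulr.
    rewrite -mulnA leq_mul2l; apply/orP; right.
    apply: (@leq_trans ((28 * n ^ 4) ^ dg)).
      have : (0 < n ^ 4)%N by rewrite expn_gt0 n0.
      by case: (dg) => // d' h; rewrite leq_exp2r //; lia.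
    by rewrite expnMn -expnM leq_mul2l leq_pexp2l ?orbT // leq_mul2l leqnSn orbT.
  by rewrite natrM ler_wpM2l // powN // natrM /al; lra.
have hF : (n * K`!)%:R <= n%:R `^ al.
  apply: (@le_trans _ _ (n%:R `^ (1 + Cmg))); last by apply: mono; rewrite /al; lra.
  have -> : n%:R `^ (1 + Cmg) = n%:R * n%:R `^ Cmg :> R.
    by rewrite powRD ?powRr1 ?(ltW nR) // (gt_eqF nR) implybT.
  rewrite natrM ler_wpM2l ?(ltW nR) //.
  apply: (@le_trans _ _ ((K ^ K)%:R)).
    rewrite ler_nat; elim: (K) => // m IH.
    by rewrite factS expnS leq_mul2l (leq_trans IH) ?orbT //; case: (m) => // m'; rewrite leq_exp2r.
  have kE : K%:R = expR (ln (K%:R : R)) by rewrite lnK ?posrE.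
  by rewrite natrX kE -expRM_natl powR_expR // ler_expR.
have h2 : (n ^ 2)%:R <= n%:R `^ al by apply: powN; rewrite /al; lra.
apply: (@le_trans _ _ ((5 * (27 * n ^ 4 + co * (27 * n ^ 4).+1 ^ dg) + 60 * (n * K`!) + 60 * n ^ 2)%:R)).
  by rewrite ler_nat; apply: total_time_bound_le.
rewrite 2!natrD (natrM _ 5) (natrM _ 60) (natrM _ 60 (n ^ 2)) [in leRHS]natrD (natrM _ 5 (27 + _)).
have aux (q f g cc x : R) : q <= cc * x -> f <= x -> g <= x ->
    5 * q + 60 * f + 60 * g <= (5 * cc + 120) * x.
  move=> *; have -> : (5 * cc + 120) * x = 5 * (cc * x) + 120 * x by ring.
  lra.
exact: aux.
Qed.

(** For this D and theta the factors a and K cancel: kappa = eps chi / Cdeg, which is at least 2 ln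
    (n K), and 4 n (K - 1) <= (n K) ^ 2 because 4 (K - 1) <= K ^ 2. *)
Lemma kappa_large (R : realType) (n K : nat) (Cdeg chi a eps : R) :
  (0 < n)%N -> (0 < K)%N -> 0 < Cdeg -> 0 < chi -> 0 < a ->
  2 * Cdeg / chi * ln (n * K)%:R <= eps ->
  ln (4 * n%:R * (K%:R - 1)) <= kappa_of K (Cdeg * (a / K%:R)) (chi * a) eps.
Proof.
move=> n0 K0 Cd ch a0 he.
have KR : 0 < K%:R :> R by rewrite ltr0n.
have -> : kappa_of K (Cdeg * (a / K%:R)) (chi * a) eps = eps * (chi / Cdeg).
  by rewrite /kappa_of /eta_of; field; rewrite !gt_eqF.
have le2 : 2 * ln (n * K)%:R <= eps * (chi / Cdeg).
  have -> : 2 * ln (n * K)%:R = 2 * Cdeg / chi * ln (n * K)%:R * (chi / Cdeg) :> R.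
    by field; rewrite !gt_eqF.
  by rewrite ler_wpM2r // divr_ge0 // ltW.
apply: le_trans le2; case: K K0 KR {he} => [//|[|k]] _ KR.
  (* For K = 1 the argument of the logarithm is 0, where [ln] takes the value 0. *)
  rewrite subrr mulr0 ln0 // mulr_ge0 // ln_ge0 // ler1n muln1 //.
have k1 : 0 < k.+2%:R - 1 :> R by rewrite subr_gt0 ltr1n.
have nR : 0 < n%:R :> R by rewrite ltr0n.
have nk : 0 < (n * k.+2)%:R :> R by rewrite ltr0n muln_gt0 n0.
have -> : 2 * ln (n * k.+2)%:R = ln ((n * k.+2)%:R ^+ 2) :> R.
  by rewrite lnXn // mulr_natl.
rewrite ler_ln ?posrE ?mulr_gt0 ?exprn_gt0 //.
have -> : k.+2%:R - 1 = k.+1%:R :> R by rewrite -[k.+2%:R]natr1 addrK.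
rewrite -natrX -!natrM ler_nat.
have : (4 * k.+1 <= k.+2 ^ 2)%N by rewrite -mulnn; nia.
by rewrite expnMn -!mulnn; nia.
Qed.

Lemma good_prob (R : realType) (n K : nat) (sigma : labeling n K) (a b delta : R)
    (E : pred (graph n)) :
  (0 < n)%N -> 0 < a -> 0 <= b <= a -> a / n%:R <= 1 ->
  (forall A, (forall e, ~~ bad_event sigma a b delta e A) -> E A) ->
  1 - \sum_e gprob (edge_prob sigma a b) (bad_event sigma a b delta e)
    <= sbm_prob sigma a b E.
Proof.
move=> n0 a0 /andP[b0 ba] an good.
have nR : 0 < n%:R :> R by rewrite ltr0n.
have Pp : prob_mx (edge_prob sigma a b).
  move=> i j; rewrite /edge_prob; case: ifP => _.
    by rewrite an divr_ge0 // ltW.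
  by rewrite divr_ge0 ?(ltW nR) //= (le_trans _ an) // ler_pM2r ?invr_gt0.
rewrite sbm_probE gprobC lerB //; apply: gprob_union => // A nE.
apply: contrapT => h; move/negP: nE; apply; apply: good => e.
by apply/negP => Be; apply: h; exists e.
Qed.

Local Open Scope classical_set_scope.
Local Open Scope ring_scope.

Theorem theorem1 (R : realType) :
  exists2 C0 : R, 0 < C0 &
  forall rhop : R, 0 < rhop < 1 ->
  exists2 chi0 : R, 0 < chi0 &
  forall Cdeg chi Cmg rhom : R,
    C0 <= Cdeg -> 0 < chi <= chi0 -> 0 < Cmg -> 0 < rhom <= rhop ->
  exists L c Amin : R, [/\ 0 < L, 0 < c, 0 < Amin &
  forall ocost : nat -> nat, poly_bounded ocost ->
  exists alpha Cpoly : R, [/\ 0 < alpha, 0 < Cpoly &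
  forall (A0 : R) (n K : nat -> nat) (a b eps : nat -> R),
    0 < A0 ->
    n @ \oo --> \oo ->
    (forall t, [/\ (0 < n t)%N, (0 < K t)%N & (K t %| n t)%N]) ->
    (forall t, (K t)%:R * ln (K t)%:R <= Cmg * ln (n t)%:R) ->
    (forall t, A0 * ln (n t * K t)%:R <= a t / (K t)%:R) ->
    (fun t => a t / (n t)%:R) @ \oo --> (0 : R) ->
    (fun t => b t / (n t)%:R) @ \oo --> (0 : R) ->
    (forall t, rhom <= b t / a t <= rhop) ->
    (forall t, L * ln (n t * K t)%:R <= eps t) ->
    let D t := Cdeg * (a t / (K t)%:R) in
    let theta t := chi * a t in
    (forall t (lam : R) (slv : forall P : sdp R, sdp_point P)
        (sel : graph (n t) -> 'M[R]_(n t) -> labeling (n t) (K t)),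
      exact_oracle slv -> selector sel ->
      let law := output_prob (D t) (theta t) (eps t) lam sel slv in
      [/\ ln (4 * (n t)%:R * ((K t)%:R - 1))
            <= kappa_of (K t) (D t) (theta t) (eps t),
          forall A tau, law A [set tau]%SET
            = gibbs A (D t) lam (eta_of (D t) (eps t)) tau
        & node_dp (eps t) law]) /\
    (Amin <= A0 ->
     \forall t \near \oo, forall (lam : R) (slv : forall P : sdp R, sdp_point P)
        (sel : graph (n t) -> 'M[R]_(n t) -> labeling (n t) (K t))
        (sigma0 : labeling (n t) (K t)),
      exact_oracle slv -> selector sel -> balanced sigma0 ->
      1 - (n t)%:R `^ (- c) - (n t * K t)%:R `^ (- (c * A0))
        <= sbm_prob sigma0 (a t) (b t) (fun A =>
             certified (D t) (theta t) lam sel slv A &&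
             (expected_runtime (D t) (theta t) (eps t) lam sel slv ocost A
                <= (Cpoly * (n t)%:R `^ alpha)%:E)%E))]].

Proof.
(* On the good event the degrees inside clusters are at most 2 a / K, so Cdeg >= 2 is large
   enough. *)
exists 2 => // rhop /andP[rp0 rp1].
exists ((1 - rhop) / 8) => [|Cdeg chi Cmg rhom hC /andP[ch0 ch1] Cm0 /andP[rm0 rm1]].
  by rewrite divr_gt0 ?subr_gt0.
have [delta dE] : exists delta, delta = (1 - rhop) / 14 by exists ((1 - rhop) / 14).
pose c1 := delta ^+ 2 / 8; pose e0 := delta ^+ 2 * expR (- 3) / (9 * third_const R).
have d0 : 0 < delta by rewrite dE divr_gt0 ?subr_gt0.
have d1 : delta <= 1 by rewrite dE; lra.
have Cd0 : 0 < Cdeg by lra.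
have c10 : 0 < c1 by rewrite divr_gt0 ?exprn_gt0.
have T0 := third_const_gt0 R.
have e00 : 0 < e0 by rewrite divr_gt0 ?mulr_gt0 ?expR_gt0 ?exprn_gt0.
(* L makes kappa at least 2 ln (n K), c is half the rate of the column tail, and the threshold on A0
   collects the three requirements of [bad_events_bound]. *)
exists (2 * Cdeg / chi), (c1 / 2), (1 + 4 / c1 + (4 + 2 * Cmg) / e0); split.
- by rewrite !mulr_gt0 ?invr_gt0.
- by rewrite divr_gt0.
- have h1 : 0 < 4 / c1 by rewrite divr_gt0.
  have h2 : 0 < (4 + 2 * Cmg) / e0 by rewrite divr_gt0 // addr_gt0 // mulr_gt0.
  by rewrite addr_gt0 // addr_gt0.
move=> ocost [co [dg hco]].
exists (4 * dg.+1%:R + Cmg + 1), (5 * (27 + co * 28 ^ dg) + 120)%:R; split.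
- by rewrite !addr_gt0 // mulr_gt0.
- by rewrite ltr0n addn_gt0 orbT.
move=> A0 n K a b eps A00 noo nK hK ha an bn hr heps D theta.
(* The lower bound on a / K gives a >= 0. If a were 0 then b / a would be 0, the inverse of 0 being
   0, against rhom > 0. *)
have a0 t : 0 < a t.
  have [n0 K0 _] := nK t.
  have : 0 <= a t / (K t)%:R.
    by apply: (le_trans _ (ha t)); rewrite mulr_ge0 ?(ltW A00) // ln_ge0 // ler1n muln_gt0 n0.
  rewrite pmulr_lge0 ?invr_gt0 ?ltr0n // le_eqVlt => /orP[/eqP a0|//].
  by have /andP[] := hr t; rewrite -a0 invr0 mulr0 leNgt rm0.
have ba t : b t <= rhop * a t by have /andP[_] := hr t; rewrite ler_pdivrMr.
have b0 t : 0 <= b t.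
  have /andP[h _] := hr t; move: h; rewrite ler_pdivlMr //; apply: le_trans.
  by rewrite mulr_ge0 ?(ltW rm0) ?(ltW (a0 t)).
have D0 t : 0 < D t.
  by have [_ K0 _] := nK t; rewrite mulr_gt0 ?divr_gt0 ?ltr0n.
have th0 t : 0 <= theta t by rewrite mulr_ge0 ?(ltW ch0) ?(ltW (a0 t)).
have e0t t : 0 <= eps t.
  have [n0 K0 _] := nK t; apply: (le_trans _ (heps t)).
  have L0 : 0 <= ln (n t * K t)%:R :> R by rewrite ln_ge0 // ler1n muln_gt0 n0.
  by rewrite mulr_ge0 // divr_ge0 ?(ltW ch0) // mulr_ge0 ?(ltW Cd0).
have kap t : ln (4 * (n t)%:R * ((K t)%:R - 1)) <= kappa_of (K t) (D t) (theta t) (eps t).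
  by have [n0 K0 _] := nK t; apply: kappa_large.
split=> [t lam slv sel ex selP law|hA0].
  have [n0 K0 Kn] := nK t; split=> // [A tau|].
    exact: output_prob1.
  exact: output_node_dp.
have n2 : \forall t \near \oo, (2 < n t)%N by exact: (noo _ (nbhs_infty_gt 2)).
(* From n >= e on, ln n >= 1, as the tail estimates require. *)
have n3 : \forall t \near \oo, ((Num.truncn (expR 1 : R)).+1 <= n t)%N.
  exact: (noo _ (nbhs_infty_ge _)).
have an1 : \forall t \near \oo, a t / (n t)%:R <= 1.
  by near=> t; apply: ltW; near: t; exact: (cvgr_lt 0 an _ ltr01).
near=> t => lam slv sel sigma0 ex selP bal.
have [n0 K0 Kn] := nK t.
have ln1 : 1 <= ln ((n t)%:R : R).
  rewrite -ler_expR lnK ?posrE ?ltr0n //.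
  have /andP[_ h] := truncn_itv (expR_ge0 (1 : R)).
  by apply: (le_trans (ltW h)); rewrite ler_nat; near: t.
have ba1 : 0 <= b t <= a t.
  by rewrite b0 (le_trans (ba t)) // ler_piMl ?(ltW (a0 t)) ?(ltW rp1).
have n2t : (2 < n t)%N by near: t.
have an1t : a t / (n t)%:R <= 1 by near: t.
have d01 : 0 < delta <= 1 by rewrite d0.
have bound := bad_events_bound hA0 n2t ln1 K0 Kn bal d01 Cm0 (hK t) (ha t) (a0 t) ba1 an1t.
apply: (@le_trans _ _ (1 - \sum_e gprob (edge_prob sigma0 (a t) (b t))
                             (bad_event sigma0 (a t) (b t) delta e))).
  by rewrite -addrA -opprD lerD2l lerN2.
apply: good_prob => // A /good_events[spectral columns].
have DE : 2 * (a t / (K t)%:R) <= D t.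
  by rewrite ler_wpM2r // divr_ge0 ?(ltW (a0 t)).
apply/andP; split.
  exact: (good_certified lam n0 K0 Kn bal (a0 t) (b0 t) (ba t) rp1 dE ch1 DE erefl rp0 spectral columns ex selP).
have pass := good_passes lam n0 K0 Kn bal (a0 t) (b0 t) (ba t) rp1 dE ch1 DE erefl rp0 spectral columns ex selP.
have hQ N : (N <= 27 * n t ^ 4 ->
    N + ocost N <= 27 * n t ^ 4 + co * (27 * n t ^ 4).+1 ^ dg)%N.
  move=> h; apply: leq_add => //; apply: (leq_trans (hco N)).
  rewrite leq_mul2l; apply/orP; right.
  by case: (dg) => // d; rewrite leq_exp2r.
have rt := certified_runtime n0 K0 Kn (D0 t) (th0 t) (e0t t) ex selP hQ (kap t) pass.
apply: (le_trans rt); rewrite lee_fin; apply: runtime_poly => //.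
exact: dvdn_leq.
Unshelve. all: by end_near.
Qed.
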